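(* Let $W$ be a locally presentable category, let $U:V\to W$ be a monadic, accessible and coproduct-preserving functor with left adjoint denoted $F$, and let $(E,u,\sigma)$ be a closed normal multitensor on $V$. Then $$(UEF)'\cong E$$ as multitensors on $V\cong W^{(UEF)_1}=W^{UF}$.
   Context: A multitensor (lax monoidal structure) $(E,u,\sigma)$ on a category $V$ consists of functors $E_n:V^n\to V$ ($n\ge0$), written $(X_1,\dots,X_n)\mapsto \mathrm{E}_iX_i$, and natural maps $u_X:X\to E_1X$ and $\sigma:\mathrm{E}_i\mathrm{E}_jX_{ij}\to\mathrm{E}_{ij}X_{ij}$ (the codomain being $E$ applied to the concatenated sequence), satisfying the evident unit and associativity axioms. A morphism of multitensors is a family of natural transformations compatible with units and substitutions. $E_1$ is a monad on $V$. $E$ is normal if $E_1$ is the identity functor and $u$ is the identity; distributive if each $E_n$ preserves (small) coproducts in each variable; and, for $V$ locally presentable, closed if each $E_n$ preserves all colimits in each variable. An $E$-category is a $V$-graph $X$ (a set $X_0$ with objects $X(a,b)\in V$ for $a,b\in X_0$) with composition maps $\mathrm{E}_iX(x_{i-1},x_i)\to X(x_0,x_n)$ for all $n\ge0$ and $x_0,\dots,x_n\in X_0$, compatible with $u$ and $\sigma$. $E$-functors are $V$-graph morphisms preserving composition; $E\text{-}\mathbf{Cat}$ denotes the category of these. $\mathcal{G}V$ is the category of $V$-graphs. Here ''monadic'' means that the comparison functor $V\to W^{UF}$ is an isomorphism; ''accessible'' means preserving $\lambda$-filtered colimits for some regular cardinal $\lambda$. It follows that $V$ is locally presentable. The multitensor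 $UEF$ on $W$ has $(UEF)_n(X_1,\dots,X_n)=U\,\mathrm{E}_iFX_i$. Its unit is $X\to UFX\xrightarrow{Uu}UE_1FX$, and its substitution is $U\mathrm{E}_iFU\mathrm{E}_jFX_{ij}\to U\mathrm{E}_i\mathrm{E}_jFX_{ij}\to U\mathrm{E}_{ij}FX_{ij}$, using the counit of $F\dashv U$ and then $\sigma$. For $E$ normal, $(UEF)_1$ is the monad $UF$. In the situation of the statement $UEF$ is distributive. Lifting: let $D$ be a distributive multitensor, accessible in each variable, on a locally presentable category $W$. For every $D$-category $X$, the unary compositions $D_1X(a,b)\to X(a,b)$ make the homs $D_1$-algebras, giving a functor $D\text{-}\mathbf{Cat}\to\mathcal{G}(W^{D_1})$. It is a known theorem that there is, up to isomorphism, a unique normal distributive multitensor $D'$ on $W^{D_1}$ with an isomorphism $D'\text{-}\mathbf{Cat}\cong D\text{-}\mathbf{Cat}$ commuting with the functors to $\mathcal{G}(W^{D_1})$; $D'$ is called the lifted multitensor. *)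

(* Defs.v *)
From Stdlib Require Import FunctionalExtensionality ProofIrrelevance.
From mathcomp Require Import all_boot.

Set Implicit Arguments.
Unset Strict Implicit.
Unset Printing Implicit Defensive.

Declare Scope cat_scope.
Delimit Scope cat_scope with cat.
Local Open Scope cat_scope.
Local Obligation Tactic := idtac.

(** One fixed universe of small types ("sets"); homs are small, objects need
    not be.  Equality of objects, morphisms and functors is Leibniz equality. *)
Definition SmallType := Type.

Record isCategory (Ob : Type) := IsCategory {
  hom_ : Ob -> Ob -> SmallType;
  id_ : forall x, hom_ x x;
  comp_ : forall x y z, hom_ y z -> hom_ x y -> hom_ x z;
  comp_idl_ : forall x y (f : hom_ x y), comp_ (id_ y) f = f;
  comp_idr_ : forall x y (f : hom_ x y), comp_ f (id_ x) = f;
  comp_assoc_ : forall x y z w (h : hom_ z w) (g : hom_ y z) (f : hom_ x y),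
    comp_ h (comp_ g f) = comp_ (comp_ h g) f
}.

Record Category := MkCategory {
  Ob :> Type;
  cat_ax : isCategory Ob
}.

Record SmallCategory := MkSmallCategory {
  SOb : SmallType;
  scat_ax : isCategory SOb
}.

Coercion cat_of_small (J : SmallCategory) : Category :=
  MkCategory (scat_ax J).

Definition hom (C : Category) (x y : C) : SmallType := hom_ (cat_ax C) x y.
Definition idm (C : Category) (x : C) : hom x x := id_ (cat_ax C) x.
Definition compm (C : Category) (x y z : C) (g : hom y z) (f : hom x y) :
  hom x z := comp_ g f.
Arguments idm {C} x.

Notation "g ∘ f" := (compm g f) (at level 40, left associativity) : cat_scope.

Lemma comp_idl (C : Category) (x y : C) (f : hom x y) : idm y ∘ f = f.
Proof. exact: comp_idl_. Qed.

Lemma comp_idr (C : Category) (x y : C) (f : hom x y) : f ∘ idm x = f.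
Proof. exact: comp_idr_. Qed.

Lemma comp_assoc (C : Category) (x y z w : C)
    (h : hom z w) (g : hom y z) (f : hom x y) : h ∘ (g ∘ f) = h ∘ g ∘ f.
Proof. exact: comp_assoc_. Qed.

(** The identity, read as a morphism between two equal objects. *)
Definition eq_hom (C : Category) (x y : C) (p : x = y) : hom x y :=
  match p in _ = z return hom x z with erefl => idm x end.

Lemma eq_hom_id (C : Category) (x : C) (p : x = x) : eq_hom p = idm x.
Proof. by rewrite (proof_irrelevance _ p erefl). Qed.

Lemma eq_hom_comp (C : Category) (x y z : C) (p : x = y) (q : y = z) :
  eq_hom q ∘ eq_hom p = eq_hom (etrans p q).
Proof. by case: z / q; case: y / p; rewrite comp_idl. Qed.

Record Functor (C D : Category) := MkFunctor {
  fobj :> C -> D;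
  fmap : forall x y : C, hom x y -> hom (fobj x) (fobj y);
  fmap_id : forall x, fmap (idm x) = idm (fobj x);
  fmap_comp : forall (x y z : C) (g : hom y z) (f : hom x y),
    fmap (g ∘ f) = fmap g ∘ fmap f
}.
Arguments fmap {C D} _ {x y} _.

Lemma fmap_eq_hom (C D : Category) (F : Functor C D) (x y : C) (p : x = y)
    (q : F x = F y) : fmap F (eq_hom p) = eq_hom q.
Proof. by case: y / p q => q; rewrite fmap_id eq_hom_id. Qed.

Definition functor_id (C : Category) : Functor C C :=
  @MkFunctor C C id (fun _ _ => id) (fun _ => erefl) (fun _ _ _ _ _ => erefl).

Program Definition functor_comp (A B C : Category)
    (G : Functor B C) (F : Functor A B) : Functor A C :=
  {| fobj := fun x => G (F x); fmap := fun _ _ f => fmap G (fmap F f) |}.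
Next Obligation. by move=> * /=; rewrite !fmap_id. Qed.
Next Obligation. by move=> * /=; rewrite !fmap_comp. Qed.

Notation "G ⊚ F" := (functor_comp G F) (at level 40, left associativity)
  : cat_scope.

Record NatTrans (C D : Category) (F G : Functor C D) := MkNatTrans {
  nt :> forall x, hom (F x) (G x);
  nt_nat : forall (x y : C) (f : hom x y), nt y ∘ fmap F f = fmap G f ∘ nt x
}.

Program Definition nt_id (C D : Category) (F : Functor C D) : NatTrans F F :=
  {| nt := fun x => idm (F x) |}.
Next Obligation. by move=> * /=; rewrite comp_idl comp_idr. Qed.

Lemma functor_ext (C D : Category) (f : C -> D)
    (m m' : forall x y : C, hom x y -> hom (f x) (f y)) i i' c c' :
  (forall x y h, m x y h = m' x y h) ->
  @MkFunctor C D f m i c = @MkFunctor C D f m' i' c'.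
Proof.
move=> e; have e' : m = m'.
  by do 3![apply: functional_extensionality_dep => ?].
by subst m'; f_equal; apply: proof_irrelevance.
Qed.

Lemma nt_ext (C D : Category) (F G : Functor C D) (a b : NatTrans F G) :
  (forall x, a x = b x) -> a = b.
Proof.
case: a b => [a ha] [b hb] /= e.
have e' : a = b by apply: functional_extensionality_dep.
by subst b; f_equal; apply: proof_irrelevance.
Qed.

Record invertible (C D : Category) (K : Functor C D) := Invertible {
  inverse : Functor D C;
  inverseK : inverse ⊚ K = functor_id C;
  Kinverse : K ⊚ inverse = functor_id D
}.

Record CatIso (C D : Category) := MkCatIso {
  iso_fun :> Functor C D;
  iso_inv : invertible iso_fun
}.

Record Cocone (J C : Category) (D : Functor J C) := MkCocone {
  apex : C;
  leg : forall j, hom (D j) apex;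
  leg_nat : forall (i j : J) (f : hom i j), leg j ∘ fmap D f = leg i
}.

Definition is_colimit (J C : Category) (D : Functor J C) (c : Cocone D) :=
  forall c' : Cocone D,
    exists! h : hom (apex c) (apex c'), forall j, h ∘ leg c j = leg c' j.

Program Definition cocone_map (J C C' : Category) (G : Functor C C')
    (D : Functor J C) (c : Cocone D) : Cocone (G ⊚ D) :=
  {| apex := G (apex c); leg := fun j => fmap G (leg c j) |}.
Next Obligation. by move=> *; rewrite /= -fmap_comp leg_nat. Qed.

Definition preserves_colimit (J C C' : Category) (G : Functor C C')
    (D : Functor J C) :=
  forall c : Cocone D, is_colimit c -> is_colimit (cocone_map G c).

Definition preserves_colimits (C C' : Category) (G : Functor C C') :=
  forall (J : SmallCategory) (D : Functor J C), preserves_colimit G D.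

Definition discrete (I : SmallType) : SmallCategory :=
  @MkSmallCategory I (@IsCategory I (fun i j => i = j) (fun i => erefl i)
    (fun i j k q p => etrans p q)
    (fun _ _ _ => proof_irrelevance _ _ _)
    (fun _ _ _ => proof_irrelevance _ _ _)
    (fun _ _ _ _ _ _ _ => proof_irrelevance _ _ _)).

Definition preserves_coproducts (C C' : Category) (G : Functor C C') :=
  forall (I : SmallType) (D : Functor (discrete I) C), preserves_colimit G D.

Definition cocomplete (C : Category) :=
  forall (J : SmallCategory) (D : Functor J C),
    exists c : Cocone D, is_colimit c.

(** Cardinals are represented by small types. *)
Definition card_le (A B : SmallType) : Prop :=
  exists f : A -> B, injective f.

Definition card_lt (A B : SmallType) : Prop := card_le A B /\ ~ card_le B A.

Definition regular_cardinal (L : SmallType) : Prop :=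
  card_le nat L /\
  forall (I : SmallType) (A : I -> SmallType),
    card_lt I L -> (forall i, card_lt (A i) L) -> card_lt {i : I & A i} L.

Definition filtered (L : SmallType) (J : SmallCategory) : Prop :=
  forall A : SmallCategory,
    card_lt {a : SOb A & {b : SOb A & hom_ (scat_ax A) a b}} L ->
    forall D : Functor A J, inhabited (Cocone D).

Definition preserves_filtered_colimits (L : SmallType) (C C' : Category)
    (G : Functor C C') :=
  forall J : SmallCategory, filtered L J ->
    forall D : Functor J C, preserves_colimit G D.

Definition accessible (C C' : Category) (G : Functor C C') :=
  exists L : SmallType,
    regular_cardinal L /\ preserves_filtered_colimits L G.

Definition Sets : Category :=
  @MkCategory SmallType (@IsCategory SmallType (fun A B => A -> B)
    (fun _ => id) (fun _ _ _ g f x => g (f x))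
    (fun _ _ _ => erefl) (fun _ _ _ => erefl) (fun _ _ _ _ _ _ _ => erefl)).

Program Definition hom_functor (C : Category) (p : C) : Functor C Sets :=
  {| fobj := fun x => hom p x : Sets; fmap := fun _ _ f g => f ∘ g |}.
Next Obligation.
by move=> C p x; apply: functional_extensionality => g; apply: comp_idl.
Qed.
Next Obligation.
by move=> C p x y z g f; apply: functional_extensionality => h /=;
  rewrite -comp_assoc.
Qed.

Definition presentable (L : SmallType) (C : Category) (p : C) :=
  preserves_filtered_colimits L (hom_functor p).

Definition locally_presentable (C : Category) : Prop :=
  cocomplete C /\
  exists L : SmallType, regular_cardinal L /\
  exists (I : SmallType) (G : I -> C),
    (forall i, presentable L (G i)) /\
    forall x : C, exists (J : SmallCategory) (D : Functor J C) (c : Cocone D),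
      [/\ filtered L J, is_colimit c, apex c = x
        & forall j, exists i, D j = G i].

Record Adjunction (C D : Category) (F : Functor D C) (U : Functor C D) :=
  MkAdjunction {
  adj_unit : NatTrans (functor_id D) (U ⊚ F);
  adj_counit : NatTrans (F ⊚ U) (functor_id C);
  adj_triangleF : forall d, adj_counit (F d) ∘ fmap F (adj_unit d) = idm (F d);
  adj_triangleU : forall c, fmap U (adj_counit c) ∘ adj_unit (U c) = idm (U c)
}.

Record Monad (C : Category) := MkMonad {
  mnd :> Functor C C;
  mnd_eta : NatTrans (functor_id C) mnd;
  mnd_mu : NatTrans (mnd ⊚ mnd) mnd;
  mnd_unitl : forall x, mnd_mu x ∘ mnd_eta (mnd x) = idm (mnd x);
  mnd_unitr : forall x, mnd_mu x ∘ fmap mnd (mnd_eta x) = idm (mnd x);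
  mnd_assoc : forall x,
    mnd_mu x ∘ fmap mnd (mnd_mu x) = mnd_mu x ∘ mnd_mu (mnd x)
}.

Program Definition adj_monad (C D : Category) (F : Functor D C)
    (U : Functor C D) (adj : Adjunction F U) : Monad D :=
  {| mnd := U ⊚ F;
     mnd_eta := adj_unit adj;
     mnd_mu := {| nt := fun x => fmap U (adj_counit adj (F x)) |} |}.
Next Obligation.
move=> C D F U adj x y f /=; rewrite -!fmap_comp; congr fmap.
exact: (nt_nat (adj_counit adj)).
Qed.
Next Obligation. by move=> C D F U adj x /=; rewrite adj_triangleU. Qed.
Next Obligation.
by move=> C D F U adj x /=; rewrite -fmap_comp adj_triangleF fmap_id.
Qed.
Next Obligation.
move=> C D F U adj x /=; rewrite -!fmap_comp; congr fmap.
exact: (nt_nat (adj_counit adj) (adj_counit adj (F x))).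
Qed.

Record Algebra (C : Category) (T : Monad C) := MkAlgebra {
  alg_ob : C;
  alg_act : hom (T alg_ob) alg_ob;
  alg_unit : alg_act ∘ mnd_eta T alg_ob = idm alg_ob;
  alg_assoc : alg_act ∘ fmap T alg_act = alg_act ∘ mnd_mu T alg_ob
}.

Record AlgHom (C : Category) (T : Monad C) (a b : Algebra T) := MkAlgHom {
  alg_hom : hom (alg_ob a) (alg_ob b);
  alg_homP : alg_hom ∘ alg_act a = alg_act b ∘ fmap T alg_hom
}.

Lemma alg_hom_ext (C : Category) (T : Monad C) (a b : Algebra T)
    (f g : AlgHom a b) : alg_hom f = alg_hom g -> f = g.
Proof.
case: f g => [f hf] [g hg] /= e; subst g.
by f_equal; apply: proof_irrelevance.
Qed.

Program Definition EM (C : Category) (T : Monad C) : Category :=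
  @MkCategory (Algebra T) (@IsCategory (Algebra T) (@AlgHom C T)
    (fun a => {| alg_hom := idm (alg_ob a) |})
    (fun a b c g f => {| alg_hom := alg_hom g ∘ alg_hom f |}) _ _ _).
Next Obligation. by move=> C T a; rewrite comp_idl fmap_id comp_idr. Qed.
Next Obligation.
move=> C T a b c g f.
by rewrite fmap_comp -comp_assoc alg_homP !comp_assoc alg_homP.
Qed.
Next Obligation. by move=> *; apply: alg_hom_ext; apply: comp_idl. Qed.
Next Obligation. by move=> *; apply: alg_hom_ext; apply: comp_idr. Qed.
Next Obligation. by move=> *; apply: alg_hom_ext; apply: comp_assoc. Qed.

Program Definition comparison (C D : Category) (F : Functor D C)
    (U : Functor C D) (adj : Adjunction F U) :
    Functor C (EM (adj_monad adj)) :=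
  @MkFunctor C (EM (adj_monad adj))
    (fun c => @MkAlgebra D (adj_monad adj) (U c) (fmap U (adj_counit adj c)) _ _)
    (fun x y f => @MkAlgHom D (adj_monad adj) _ _ (fmap U f) _) _ _.
Next Obligation. by move=> *; rewrite /= adj_triangleU. Qed.
Next Obligation.
move=> C D F U adj c /=; rewrite -!fmap_comp; congr fmap.
exact: (nt_nat (adj_counit adj) (adj_counit adj c)).
Qed.
Next Obligation.
move=> C D F U adj x y f /=; rewrite -!fmap_comp; congr fmap.
exact/esym/(nt_nat (adj_counit adj)).
Qed.
Next Obligation. by move=> *; apply: alg_hom_ext; apply: fmap_id. Qed.
Next Obligation. by move=> *; apply: alg_hom_ext; apply: fmap_comp. Qed.

Definition monadic (C D : Category) (F : Functor D C) (U : Functor C D)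
  (adj : Adjunction F U) := invertible (comparison adj).

(** [SeqCat C], the category of finite sequences, is the disjoint union of the
    powers [C^n]; a functor [SeqCat C -> D] is a family of functors
    [C^n -> D], [n >= 0]. *)

Section Sequences.
Variable C : Category.
Implicit Types xs ys zs : seq C.

Fixpoint lhom xs ys : SmallType :=
  match xs, ys with
  | [::], [::] => unit
  | x :: xs', y :: ys' => (hom x y * lhom xs' ys')%type
  | _, _ => Empty_set
  end.

Fixpoint lid xs : lhom xs xs :=
  match xs with
  | [::] => tt
  | x :: xs' => (idm x, lid xs')
  end.

Fixpoint lcomp xs ys zs : lhom ys zs -> lhom xs ys -> lhom xs zs :=
  match xs, ys, zs return lhom ys zs -> lhom xs ys -> lhom xs zs with
  | [::], [::], _ => fun g _ => g
  | _ :: xs', _ :: ys', _ :: zs' => fun g f =>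
      (g.1 ∘ f.1, @lcomp xs' ys' zs' g.2 f.2)
  | _ :: _, _ :: _, [::] => fun g _ => match g with end
  | [::], _ :: _, _ => fun _ f => match f with end
  | _ :: _, [::], _ => fun _ f => match f with end
  end.

Lemma lcomp_idl xs ys (f : lhom xs ys) : lcomp (lid ys) f = f.
Proof.
elim: xs ys f => [|x xs IH] [|y ys] //=; first by case.
by case=> f fs /=; rewrite IH comp_idl.
Qed.

Lemma lcomp_idr xs ys (f : lhom xs ys) : lcomp f (lid xs) = f.
Proof.
elim: xs ys f => [|x xs IH] [|y ys] //=.
by case=> f fs /=; rewrite IH comp_idr.
Qed.

Lemma lcomp_assoc xs ys zs ws (h : lhom zs ws) (g : lhom ys zs)
    (f : lhom xs ys) : lcomp h (lcomp g f) = lcomp (lcomp h g) f.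
Proof.
elim: xs ys zs ws f g h => [|x xs IH] [|y ys] [|z zs] [|w ws] //=;
  try by move=> ? ? [].
all: try by move=> ? [].
all: try by case.
by move=> f g h; rewrite IH comp_assoc.
Qed.

Definition SeqCat : Category :=
  @MkCategory (seq C) (@IsCategory (seq C) lhom lid lcomp
    lcomp_idl lcomp_idr lcomp_assoc).

Fixpoint lcat xs ys xs' ys' : lhom xs ys -> lhom xs' ys' ->
    lhom (xs ++ xs') (ys ++ ys') :=
  match xs, ys return lhom xs ys -> lhom xs' ys' ->
    lhom (xs ++ xs') (ys ++ ys') with
  | [::], [::] => fun _ f' => f'
  | _ :: xs1, _ :: ys1 => fun f f' => (f.1, @lcat xs1 ys1 xs' ys' f.2 f')
  | [::], _ :: _ => fun f _ => match f with end
  | _ :: _, [::] => fun f _ => match f with end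
  end.

Lemma lcat_id xs ys : lcat (lid xs) (lid ys) = lid (xs ++ ys).
Proof. by elim: xs => //= x xs ->. Qed.

Lemma lcat_comp xs ys zs xs' ys' zs' (g : lhom ys zs) (f : lhom xs ys)
    (g' : lhom ys' zs') (f' : lhom xs' ys') :
  lcat (lcomp g f) (lcomp g' f') = lcomp (lcat g g') (lcat f f').
Proof.
elim: xs ys zs f g => [|x xs IH] [|y ys] [|z zs] //=.
all: try by move=> ? [].
all: try by case.
by move=> [f fs] [g gs] /=; rewrite IH.
Qed.

Program Definition singleton : Functor C SeqCat :=
  @MkFunctor C SeqCat (fun x => [:: x]) (fun _ _ f => (f, tt)) _ _.
Next Obligation. by []. Qed.
Next Obligation. by []. Qed.

(** [x |-> (l, x, r)]; precomposing with it fixes all variables but one. *)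
Program Definition slot (l r : seq C) : Functor C SeqCat :=
  @MkFunctor C SeqCat (fun x => l ++ x :: r)
    (fun x y f => @lcat l l (x :: r) (y :: r) (lid l) (f, lid r)) _ _.
Next Obligation. by move=> l r x; apply: (lcat_id l (x :: r)). Qed.
Next Obligation.
move=> l r x y z g f; rewrite /compm /= -lcat_comp /=.
by rewrite (lcomp_idl (lid l)) (lcomp_idl (lid r)).
Qed.

End Sequences.

Definition lcast (C : Category) (xs ys : seq C) (p : xs = ys) : lhom xs ys :=
  @eq_hom (SeqCat C) xs ys p.

Definition lfmap (C D : Category) (G : Functor (SeqCat C) D) (xs ys : seq C)
    (f : lhom xs ys) : hom (G xs) (G ys) :=
  @fmap (SeqCat C) D G xs ys f.

Lemma lcast_id (C : Category) (xs : seq C) (p : xs = xs) : lcast p = lid xs.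
Proof. exact: (@eq_hom_id (SeqCat C)). Qed.

Lemma lcast_comp (C : Category) (xs ys zs : seq C) (p : xs = ys) (q : ys = zs) :
  lcomp (lcast q) (lcast p) = lcast (etrans p q).
Proof. exact: (@eq_hom_comp (SeqCat C)). Qed.

Lemma lcast_cons (C : Category) (x y : C) (xs ys : seq C)
    (p : x :: xs = y :: ys) (q : x = y) (r : xs = ys) :
  lcast p = (eq_hom q, lcast r).
Proof. by subst y ys; rewrite !lcast_id eq_hom_id. Qed.

Lemma lcast_cat (C : Category) (xs xs' ys ys' : seq C)
    (p : xs ++ xs' = ys ++ ys') (q : xs = ys) (r : xs' = ys') :
  lcast p = lcat (lcast q) (lcast r).
Proof. by subst ys ys'; rewrite !lcast_id lcat_id. Qed.

Lemma lfmap_id (C D : Category) (G : Functor (SeqCat C) D) (xs : seq C) :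
  lfmap G (lid xs) = idm (G xs).
Proof. exact: (@fmap_id (SeqCat C)). Qed.

Lemma lfmap_comp (C D : Category) (G : Functor (SeqCat C) D)
    (xs ys zs : seq C) (g : lhom ys zs) (f : lhom xs ys) :
  lfmap G (lcomp g f) = lfmap G g ∘ lfmap G f.
Proof. exact: (@fmap_comp (SeqCat C)). Qed.

Section MapFunctor.
Variables (C D : Category) (F : Functor C D).

Fixpoint lmap (xs ys : seq C) : lhom xs ys -> lhom (map F xs) (map F ys) :=
  match xs, ys return lhom xs ys -> lhom (map F xs) (map F ys) with
  | [::], [::] => fun f => f
  | _ :: xs', _ :: ys' => fun f => (fmap F f.1, @lmap xs' ys' f.2)
  | [::], _ :: _ => fun f => match f with end
  | _ :: _, [::] => fun f => match f with end
  end.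

Lemma lmap_id xs : lmap (lid xs) = lid (map F xs).
Proof. by elim: xs => //= x xs ->; rewrite fmap_id. Qed.

Lemma lmap_comp xs ys zs (g : lhom ys zs) (f : lhom xs ys) :
  lmap (lcomp g f) = lcomp (lmap g) (lmap f).
Proof.
elim: xs ys zs f g => [|x xs IH] [|y ys] [|z zs] //=.
all: try by move=> ? [].
all: try by case.
by move=> [f fs] [g gs] /=; rewrite IH fmap_comp.
Qed.

Definition SeqFun : Functor (SeqCat C) (SeqCat D) :=
  @MkFunctor (SeqCat C) (SeqCat D) (map F) lmap lmap_id lmap_comp.

End MapFunctor.

Section Flatten.
Variable C : Category.

Fixpoint lflatten (xs ys : seq (seq C)) :
    @lhom (SeqCat C) xs ys -> lhom (flatten xs) (flatten ys) :=
  match xs, ys return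
    @lhom (SeqCat C) xs ys -> lhom (flatten xs) (flatten ys) with
  | [::], [::] => fun f => f
  | _ :: xs', _ :: ys' => fun f => lcat f.1 (@lflatten xs' ys' f.2)
  | [::], _ :: _ => fun f => match f with end
  | _ :: _, [::] => fun f => match f with end
  end.

Lemma lflatten_id xs : lflatten (@lid (SeqCat C) xs) = lid (flatten xs).
Proof. by elim: xs => //= x xs ->; apply: lcat_id. Qed.

Lemma lflatten_comp xs ys zs (g : @lhom (SeqCat C) ys zs)
    (f : @lhom (SeqCat C) xs ys) :
  lflatten (lcomp g f) = lcomp (lflatten g) (lflatten f).
Proof.
elim: xs ys zs f g => [|x xs IH] [|y ys] [|z zs] //=.
all: try by move=> ? [].
all: try by case.
by move=> [f fs] [g gs] /=; rewrite IH; apply: lcat_comp.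
Qed.

Definition flatten_functor : Functor (SeqCat (SeqCat C)) (SeqCat C) :=
  @MkFunctor (SeqCat (SeqCat C)) (SeqCat C) flatten lflatten
    lflatten_id lflatten_comp.

End Flatten.

Lemma flatten1 (T : Type) (s : seq T) : flatten [:: s] = s.
Proof. exact: cats0. Qed.

Lemma flatten_singletons (T : Type) (s : seq T) :
  flatten (map (fun x => [:: x]) s) = s.
Proof. by elim: s => //= x s ->. Qed.

Lemma flatten_map_map (S T : Type) (f : S -> T) (ss : seq (seq S)) :
  flatten (map (map f) ss) = map f (flatten ss).
Proof. by elim: ss => //= s ss ->; rewrite map_cat. Qed.

Lemma flatten_flatten (T : Type) (ss : seq (seq (seq T))) :
  flatten (flatten ss) = flatten (map flatten ss).
Proof. by elim: ss => //= s ss <-; rewrite flatten_cat. Qed.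

Fixpoint lunits (V : Category) (E : Functor (SeqCat V) V)
    (u : forall x : V, hom x (E [:: x])) (xs : seq V) :
    lhom xs (map E (map (fun x => [:: x]) xs)) :=
  match xs with
  | [::] => tt
  | x :: xs' => (u x, lunits u xs')
  end.

Fixpoint lsubs (V : Category) (E : Functor (SeqCat V) V)
    (sigma : forall xss : seq (seq V), hom (E (map E xss)) (E (flatten xss)))
    (xsss : seq (seq (seq V))) :
    lhom (map E (map (map E) xsss)) (map E (map flatten xsss)) :=
  match xsss with
  | [::] => tt
  | xss :: xsss' => (sigma xss, lsubs sigma xsss')
  end.

(** All casts are along equalities of sequences (or of endpoints of paths,
    below), which hold only propositionally for [flatten], [map] and [last]. *)
Record Multitensor (V : Category) := MkMultitensor {
  mt :> Functor (SeqCat V) V;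
  mt_unit : NatTrans (functor_id V) (mt ⊚ singleton V);
  mt_sub : NatTrans (mt ⊚ SeqFun mt) (mt ⊚ flatten_functor V);
  mt_unitl : forall xs : seq V,
    mt_sub [:: xs] ∘ mt_unit (mt xs) =
    lfmap mt (lcast (esym (flatten1 xs)));
  mt_unitr : forall xs : seq V,
    mt_sub (map (fun x => [:: x]) xs) ∘
      lfmap mt (lunits mt_unit xs) =
    lfmap mt (lcast (esym (flatten_singletons xs)));
  mt_assoc : forall xsss : seq (seq (seq V)),
    mt_sub (map flatten xsss) ∘
      lfmap mt (lsubs mt_sub xsss) =
    lfmap mt (lcast (flatten_flatten xsss)) ∘
      mt_sub (flatten xsss) ∘
      lfmap mt (lcast (flatten_map_map mt xsss)) ∘
      mt_sub (map (map mt) xsss)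
}.

Definition mt_distributive (V : Category) (E : Multitensor V) :=
  forall l r : seq V, preserves_coproducts (E ⊚ slot l r).

Definition mt_closed (V : Category) (E : Multitensor V) :=
  forall l r : seq V, preserves_colimits (E ⊚ slot l r).

(** [E_1 = id] as functors and, along that equality, [u = id]. *)
Definition mt_normal (V : Category) (E : Multitensor V) :=
  existT (fun T : Functor V V => NatTrans (functor_id V) T)
    (E ⊚ singleton V) (mt_unit E) =
  existT _ (functor_id V) (nt_id (functor_id V)).

Fixpoint lnats (V : Category) (E E' : Functor (SeqCat V) V)
    (phi : forall xs : seq V, hom (E xs) (E' xs)) (xss : seq (seq V)) :
    lhom (map E xss) (map E' xss) :=
  match xss with
  | [::] => tt
  | xs :: xss' => (phi xs, lnats phi xss')
  end.

Record MultitensorHom (V : Category) (E E' : Multitensor V) :=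
  MkMultitensorHom {
  mth :> NatTrans E E';
  mth_unit : forall x : V, mth [:: x] ∘ mt_unit E x = mt_unit E' x;
  mth_sub : forall xss : seq (seq V),
    mth (flatten xss) ∘ mt_sub E xss =
    mt_sub E' xss ∘ lfmap E' (lnats mth xss) ∘
      mth (map E xss)
}.

Definition multitensor_iso (V : Category) (E E' : Multitensor V) : Prop :=
  exists (f : MultitensorHom E E') (g : MultitensorHom E' E),
    forall xs : seq V, g xs ∘ f xs = idm (E xs) /\ f xs ∘ g xs = idm (E' xs).

Program Definition mt_monad (V : Category) (E : Multitensor V) : Monad V :=
  {| mnd := E ⊚ singleton V;
     mnd_eta := mt_unit E;
     mnd_mu := {| nt := fun x => mt_sub E [:: [:: x]] |} |}.
Next Obligation.
move=> V E x y f.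
exact: (@nt_nat _ _ _ _ (mt_sub E) [:: [:: x]] [:: [:: y]] ((f, tt), tt)).
Qed.
Next Obligation.
by move=> V E x; rewrite [LHS]mt_unitl lcast_id lfmap_id.
Qed.
Next Obligation.
by move=> V E x; rewrite [LHS](mt_unitr E [:: x]) lcast_id lfmap_id.
Qed.
Next Obligation.
move=> V E x; rewrite [LHS](mt_assoc E [:: [:: [:: x]]]) !lcast_id !lfmap_id.
by rewrite comp_idl comp_idr.
Qed.

Lemma lcat_map (C D : Category) (G : Functor C D) (xs ys xs' ys' : seq C)
    (f : lhom xs ys) (g : lhom xs' ys')
    (p : map G ys ++ map G ys' = map G (ys ++ ys'))
    (q : map G xs ++ map G xs' = map G (xs ++ xs')) :
  lcomp (lcast p) (lcat (lmap G f) (lmap G g)) =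
  lcomp (lmap G (lcat f g)) (lcast q).
Proof.
elim: xs ys f p q => [|x xs IH] [|y ys] f p q //=; try by case: f.
  by rewrite !lcast_id lcomp_idl lcomp_idr.
case: f => f fs.
have p' : map G ys ++ map G ys' = map G (ys ++ ys') by rewrite map_cat.
have q' : map G xs ++ map G xs' = map G (xs ++ xs') by rewrite map_cat.
rewrite (lcast_cons p erefl p') (lcast_cons q erefl q') /=.
by rewrite (IH _ _ p' q') comp_idl comp_idr.
Qed.

Definition lmap2 (C D : Category) (G : Functor C D) (xss yss : seq (seq C))
    (h : @lhom (SeqCat C) xss yss) :
    @lhom (SeqCat D) (map (map G) xss) (map (map G) yss) :=
  lmap (SeqFun G) h.

Lemma lflatten_map (C D : Category) (G : Functor C D) (xss yss : seq (seq C))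
    (h : @lhom (SeqCat C) xss yss)
    (p : flatten (map (map G) yss) = map G (flatten yss))
    (q : flatten (map (map G) xss) = map G (flatten xss)) :
  lcomp (lcast p) (lflatten (lmap2 G h)) =
  lcomp (lmap G (lflatten h)) (lcast q).
Proof.
elim: xss yss h p q => [|xs xss IH] [|ys yss] h p q //=; try by case: h.
  by case: h; rewrite lcast_id.
case: h => h hs /=.
have p1 : map G ys ++ flatten (map (map G) yss) =
          map G ys ++ map G (flatten yss) by rewrite flatten_map_map.
have p2 : map G ys ++ map G (flatten yss) = map G (ys ++ flatten yss)
  by rewrite map_cat.
have q1 : map G xs ++ flatten (map (map G) xss) =
          map G xs ++ map G (flatten xss) by rewrite flatten_map_map.
have q2 : map G xs ++ map G (flatten xss) = map G (xs ++ flatten xss)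
  by rewrite map_cat.
rewrite (proof_irrelevance _ p (etrans p1 p2)).
rewrite (proof_irrelevance _ q (etrans q1 q2)).
rewrite -!lcast_comp -lcomp_assoc.
rewrite (lcast_cat p1 erefl (flatten_map_map _ _)).
rewrite (lcast_cat q1 erefl (flatten_map_map _ _)) !lcast_id.
rewrite -lcat_comp (IH _ _ _ (flatten_map_map G xss)) (lcomp_idl (lmap G h)).
rewrite (lcomp_assoc (lmap G (lcat h (lflatten hs)))) -(lcat_map _ _ p2).
by rewrite -lcomp_assoc -lcat_comp (lcomp_idr (lmap G h)).
Qed.

Definition msub (V : Category) (E : Multitensor V) (xss : seq (seq V)) :
    hom (E (map E xss)) (E (flatten xss)) := mt_sub E xss.

Lemma msub_nat (V : Category) (E : Multitensor V) (xss yss : seq (seq V))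
    (h : @lhom (SeqCat V) xss yss) :
  msub E yss ∘ lfmap E (lmap E h) = lfmap E (lflatten h) ∘ msub E xss.
Proof. exact: (@nt_nat _ _ _ _ (mt_sub E) xss yss h). Qed.

Lemma lmap_cast (C D : Category) (G : Functor C D) (xs ys : seq C)
    (p : xs = ys) (q : map G xs = map G ys) : lmap G (lcast p) = lcast q.
Proof. by subst ys; rewrite !lcast_id lmap_id. Qed.

Lemma lfmap_cast (C D : Category) (G : Functor (SeqCat C) D) (xs ys : seq C)
    (p : xs = ys) (q : G xs = G ys) : lfmap G (lcast p) = eq_hom q.
Proof. by subst ys; rewrite lcast_id eq_hom_id lfmap_id. Qed.

Lemma msub_cast (V : Category) (E : Multitensor V) (xss yss : seq (seq V))
    (e : xss = yss) (p : map E xss = map E yss) (q : flatten xss = flatten yss) :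
  msub E yss ∘ lfmap E (lcast p) = lfmap E (lcast q) ∘ msub E xss.
Proof. by subst yss; rewrite !lcast_id !lfmap_id comp_idl comp_idr. Qed.

Lemma msub_assoc (V : Category) (E : Multitensor V) (xsss : seq (seq (seq V))) :
  msub E (map flatten xsss) ∘ lfmap E (lsubs (msub E) xsss) =
  lfmap E (lcast (flatten_flatten xsss)) ∘ msub E (flatten xsss) ∘
  lfmap E (lcast (flatten_map_map E xsss)) ∘ msub E (map (map E) xsss).
Proof. exact: mt_assoc. Qed.

Section UEF.
Variables (V W : Category) (F : Functor W V) (U : Functor V W).
Variables (adj : Adjunction F U) (E : Multitensor V).

Let UEFf : Functor (SeqCat W) W := U ⊚ E ⊚ SeqFun F.

Fixpoint lcounits (xss : seq (seq W)) :
    lhom (map F (map UEFf xss)) (map E (map (map F) xss)) :=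
  match xss with
  | [::] => tt
  | xs :: xss' => (adj_counit adj (E (map F xs)), lcounits xss')
  end.

Definition UEF_sub_E (xss : seq (seq W)) :
    hom (E (map F (map UEFf xss))) (E (map F (flatten xss))) :=
  lfmap E (lcast (flatten_map_map F xss)) ∘ msub E (map (map F) xss) ∘
    lfmap E (lcounits xss).

Lemma lcounits_nat xss yss (h : @lhom (SeqCat W) xss yss) :
  lcomp (lcounits yss) (lmap F (lmap UEFf h)) =
  lcomp (lmap E (lmap2 F h)) (lcounits xss).
Proof.
elim: xss yss h => [|xs xss IH] [|ys yss] //=; first by case.
case=> h hs /=; rewrite IH; congr pair.
exact: (nt_nat (adj_counit adj) (fmap E (lmap F h))).
Qed.

Lemma UEF_sub_nat xss yss (h : @lhom (SeqCat W) xss yss) :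
  UEF_sub_E yss ∘ lfmap E (lmap F (lmap UEFf h)) =
  lfmap E (lmap F (lflatten h)) ∘ UEF_sub_E xss.
Proof.
rewrite /UEF_sub_E -comp_assoc -lfmap_comp lcounits_nat lfmap_comp.
rewrite comp_assoc -(comp_assoc _ (msub E _)) msub_nat !comp_assoc.
congr (_ ∘ _ ∘ _); rewrite -!lfmap_comp; congr (lfmap E _).
exact: lflatten_map.
Qed.

Lemma lcounits_cat xss yss
    (p : map F (map UEFf xss) ++ map F (map UEFf yss) =
         map F (map UEFf (xss ++ yss)))
    (q : map E (map (map F) xss) ++ map E (map (map F) yss) =
         map E (map (map F) (xss ++ yss))) :
  lcomp (lcounits (xss ++ yss)) (lcast p) =
  lcomp (lcast q) (lcat (lcounits xss) (lcounits yss)).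
Proof.
elim: xss p q => [|xs xss IH] p q //=.
  by rewrite !lcast_id lcomp_idl lcomp_idr.
have p' : map F (map UEFf xss) ++ map F (map UEFf yss) =
         map F (map UEFf (xss ++ yss)) by rewrite !map_cat.
have q' : map E (map (map F) xss) ++ map E (map (map F) yss) =
         map E (map (map F) (xss ++ yss)) by rewrite !map_cat.
rewrite (lcast_cons p erefl p') (lcast_cons q erefl q') /=.
by rewrite (IH p' q') comp_idl comp_idr.
Qed.

Fixpoint lcounits2 (xsss : seq (seq (seq W))) :
    @lhom (SeqCat V) (map (map F) (map (map UEFf) xsss))
      (map (map E) (map (map (map F)) xsss)) :=
  match xsss with
  | [::] => tt
  | xss :: xsss' => (lcounits xss, lcounits2 xsss')
  end.

Lemma lcounits_flatten xsss
    (p : flatten (map (map F) (map (map UEFf) xsss)) =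
         map F (map UEFf (flatten xsss)))
    (q : flatten (map (map E) (map (map (map F)) xsss)) =
         map E (map (map F) (flatten xsss))) :
  lcomp (lcounits (flatten xsss)) (lcast p) =
  lcomp (lcast q) (lflatten (lcounits2 xsss)).
Proof.
elim: xsss p q => [|xss xsss IH] p q //=; first by rewrite lcast_id.
have p' : flatten (map (map F) (map (map UEFf) xsss)) =
         map F (map UEFf (flatten xsss)) by rewrite !flatten_map_map.
have q' : flatten (map (map E) (map (map (map F)) xsss)) =
         map E (map (map F) (flatten xsss)) by rewrite !flatten_map_map.
have p1 : map F (map UEFf xss) ++ flatten (map (map F) (map (map UEFf) xsss)) =
   map F (map UEFf xss) ++ map F (map UEFf (flatten xsss)) by rewrite p'.
have p2 : map F (map UEFf xss) ++ map F (map UEFf (flatten xsss)) =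
   map F (map UEFf (xss ++ flatten xsss)) by rewrite !map_cat.
have q1 : map E (map (map F) xss) ++
     flatten (map (map E) (map (map (map F)) xsss)) =
   map E (map (map F) xss) ++ map E (map (map F) (flatten xsss)) by rewrite q'.
have q2 : map E (map (map F) xss) ++ map E (map (map F) (flatten xsss)) =
   map E (map (map F) (xss ++ flatten xsss)) by rewrite !map_cat.
rewrite (proof_irrelevance _ p (etrans p1 p2)).
rewrite (proof_irrelevance _ q (etrans q1 q2)).
rewrite -!lcast_comp lcomp_assoc (lcounits_cat p2 q2) -!lcomp_assoc.
rewrite (lcast_cat p1 erefl p') (lcast_cat q1 erefl q') !lcast_id.
by rewrite -!lcat_comp (IH p' q') (lcomp_idl (lcounits xss)) lcomp_idr.
Qed.

Definition UEF_sub_ (xss : seq (seq W)) :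
    hom (UEFf (map UEFf xss)) (UEFf (flatten xss)) :=
  fmap U (UEF_sub_E xss).

Definition UEF_unit_ (x : W) : hom x (UEFf [:: x]) :=
  fmap U (mt_unit E (F x)) ∘ adj_unit adj x.

Lemma lfmap_UEFf (xs ys : seq W) (h : lhom xs ys) :
  lfmap UEFf h = fmap U (lfmap E (lmap F h)).
Proof. by []. Qed.

Lemma UEF_unit_nat x y (f : hom x y) :
  UEF_unit_ y ∘ f = @lfmap _ _ UEFf [:: x] [:: y] (f, tt) ∘ UEF_unit_ x.
Proof.
rewrite /UEF_unit_ -comp_assoc [adj_unit adj y ∘ f](nt_nat (adj_unit adj)) /=.
rewrite !comp_assoc -fmap_comp; congr (_ ∘ _).
rewrite [mt_unit E _ ∘ _](nt_nat (mt_unit E)) fmap_comp.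
by [].
Qed.

Lemma UEF_unitl (xs : seq W) :
  UEF_sub_ [:: xs] ∘ UEF_unit_ (UEFf xs) =
  lfmap UEFf (lcast (esym (flatten1 xs))).
Proof.
have pF : map F xs = map F (flatten [:: xs]) by rewrite flatten1.
rewrite /UEF_sub_ /UEF_unit_ /UEF_sub_E comp_assoc -fmap_comp /=.
have -> : lfmap E (lcast (flatten_map_map F [:: xs])) ∘
    msub E [:: map F xs] ∘
    @lfmap _ _ E [:: _] [:: _] (adj_counit adj (E (map F xs)), tt) ∘
    mt_unit E (F (UEFf xs)) =
    lfmap E (lcast pF) ∘ adj_counit adj (E (map F xs)).
  rewrite -[LHS]comp_assoc.
  have -> : @lfmap _ _ E [:: _] [:: _] (adj_counit adj (E (map F xs)), tt) ∘
     mt_unit E (F (UEFf xs)) =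
     mt_unit E (E (map F xs)) ∘ adj_counit adj (E (map F xs)).
    exact/esym/(nt_nat (mt_unit E)).
  rewrite comp_assoc; congr (_ ∘ _); rewrite -comp_assoc.
  rewrite [msub E _ ∘ _](mt_unitl E (map F xs)) -lfmap_comp lcast_comp.
  by congr (lfmap E (lcast _)); apply: proof_irrelevance.
rewrite fmap_comp -comp_assoc adj_triangleU comp_idr.
by rewrite -(lmap_cast (esym (flatten1 xs)) pF).
Qed.

Lemma lcounits_units (xs : seq W)
    (p : map E (map (fun x => [:: x]) (map F xs)) =
         map E (map (map F) (map (fun x => [:: x]) xs))) :
  lcomp (lcounits (map (fun x => [:: x]) xs)) (lmap F (lunits UEF_unit_ xs)) =
  lcomp (lcast p) (lunits (mt_unit E) (map F xs)).
Proof.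
elim: xs p => [|x xs IH] p /=; first by rewrite lcast_id.
have p' : map E (map (fun x => [:: x]) (map F xs)) =
         map E (map (map F) (map (fun x => [:: x]) xs)).
  by rewrite -!map_comp.
rewrite (lcast_cons p erefl p') /= IH comp_idl; congr pair.
rewrite /UEF_unit_ fmap_comp comp_assoc.
rewrite [_ ∘ fmap F (fmap U _)](nt_nat (adj_counit adj)) /=.
by rewrite -comp_assoc adj_triangleF comp_idr.
Qed.

Lemma UEF_unitr (xs : seq W) :
  UEF_sub_ (map (fun x => [:: x]) xs) ∘ lfmap UEFf (lunits UEF_unit_ xs) =
  lfmap UEFf (lcast (esym (flatten_singletons xs))).
Proof.
suff H : UEF_sub_E (map (fun x => [:: x]) xs) ∘
    lfmap E (lmap F (lunits UEF_unit_ xs)) =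
    lfmap E (lmap F (lcast (esym (flatten_singletons xs)))).
  exact: etrans (esym (fmap_comp U _ _)) (f_equal _ H).
rewrite /UEF_sub_E -comp_assoc -lfmap_comp.
have e : map (fun x => [:: x]) (map F xs) =
         map (map F) (map (fun x => [:: x]) xs) by rewrite -!map_comp.
rewrite (lcounits_units (f_equal (map E) e)) lfmap_comp comp_assoc.
rewrite -(comp_assoc _ (msub E _)) (msub_cast e _ (f_equal flatten e)).
rewrite comp_assoc -comp_assoc [msub E _ ∘ _](mt_unitr E (map F xs)).
rewrite -!lfmap_comp !lcast_comp; congr lfmap.
have p : map F xs = map F (flatten (map (fun x => [:: x]) xs)).
  by rewrite flatten_singletons.
rewrite (lmap_cast _ p); congr lcast; exact: proof_irrelevance.
Qed.

Lemma lcounits_subs (xsss : seq (seq (seq W)))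
    (p : map E (map flatten (map (map (map F)) xsss)) =
         map E (map (map F) (map flatten xsss))) :
  lcomp (lcounits (map flatten xsss)) (lmap F (lsubs UEF_sub_ xsss)) =
  lcomp (lcast p) (lcomp (lsubs (msub E) (map (map (map F)) xsss))
    (lcomp (lmap E (lcounits2 xsss)) (lcounits (map (map UEFf) xsss)))).
Proof.
elim: xsss p => [|xss xsss IH] p /=; first by rewrite lcast_id.
have p' : map E (map flatten (map (map (map F)) xsss)) =
         map E (map (map F) (map flatten xsss)).
  by case: p.
have q : E (flatten (map (map F) xss)) = E (map F (flatten xss)).
  by rewrite flatten_map_map.
rewrite (lcast_cons p q p') /= (IH p'); congr pair.
rewrite [LHS](nt_nat (adj_counit adj) (UEF_sub_E xss)) /=.
rewrite -(lfmap_cast (flatten_map_map F xss) q) /UEF_sub_E.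
by rewrite -!comp_assoc.
Qed.

Lemma UEF_assoc (xsss : seq (seq (seq W))) :
  UEF_sub_ (map flatten xsss) ∘ lfmap UEFf (lsubs UEF_sub_ xsss) =
  lfmap UEFf (lcast (flatten_flatten xsss)) ∘ UEF_sub_ (flatten xsss) ∘
  lfmap UEFf (lcast (flatten_map_map UEFf xsss)) ∘
  UEF_sub_ (map (map UEFf) xsss).
Proof.
suff H : UEF_sub_E (map flatten xsss) ∘
    lfmap E (lmap F (lsubs UEF_sub_ xsss)) =
    lfmap E (lmap F (lcast (flatten_flatten xsss))) ∘
    UEF_sub_E (flatten xsss) ∘
    lfmap E (lmap F (lcast (flatten_map_map UEFf xsss))) ∘
    UEF_sub_E (map (map UEFf) xsss).
  apply: etrans (esym (fmap_comp U _ _)) (etrans (f_equal _ H) _).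
  by apply: etrans (fmap_comp U _ _) _; congr (_ ∘ _);
    apply: etrans (fmap_comp U _ _) _; congr (_ ∘ _); apply: (fmap_comp U).
have pD : map F (flatten (map (map UEFf) xsss)) =
          map F (map UEFf (flatten xsss)) by rewrite flatten_map_map.
have pf : map F (flatten (flatten xsss)) = map F (flatten (map flatten xsss)).
  by rewrite flatten_flatten.
rewrite (lmap_cast _ pD) (lmap_cast _ pf).
set X' := map (map (map F)) xsss.
have e1 : map flatten X' = map (map F) (map flatten xsss).
  by rewrite /X' -!map_comp; apply: eq_map => xss /=; rewrite flatten_map_map.
have e2 : flatten X' = map (map F) (flatten xsss) by rewrite flatten_map_map.
have q2 : flatten (map (map E) X') = map E (map (map F) (flatten xsss)).
  by rewrite flatten_map_map e2.
have p2 : flatten (map (map F) (map (map UEFf) xsss)) =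
          map F (map UEFf (flatten xsss)) by rewrite !flatten_map_map.
rewrite /UEF_sub_E -[LHS]comp_assoc -lfmap_comp.
rewrite (lcounits_subs (f_equal (map E) e1)) !lfmap_comp !comp_assoc.
congr (_ ∘ _).
rewrite -[_ ∘ msub E _ ∘ lfmap E (lcast (f_equal _ _))]comp_assoc.
rewrite (msub_cast e1 _ (f_equal flatten e1)) !comp_assoc.
rewrite -[_ ∘ msub E _ ∘ lfmap E (lsubs _ _)]comp_assoc msub_assoc !comp_assoc.
rewrite -[_ ∘ msub E (map (map E) X') ∘ _]comp_assoc.
rewrite msub_nat !comp_assoc; congr (_ ∘ _).
rewrite -!lfmap_comp !lcast_comp -!comp_assoc -!lfmap_comp.
rewrite lcast_comp.
rewrite (proof_irrelevance _ (etrans _ pD) p2) (lcounits_flatten p2 q2).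
have -> : lcast q2 =
    lcomp (lcast (f_equal (map E) e2)) (lcast (flatten_map_map E X')).
  by rewrite lcast_comp; congr lcast; apply: proof_irrelevance.
rewrite -lcomp_assoc [in RHS]lfmap_comp !comp_assoc.
rewrite -[in RHS](comp_assoc _ (msub E _)) (msub_cast e2 _ (f_equal flatten e2)).
rewrite !comp_assoc -!lfmap_comp !lcast_comp.
congr (lfmap E (lcast _) ∘ _ ∘ _); exact: proof_irrelevance.
Qed.

Program Definition UEF : Multitensor W :=
  @MkMultitensor W UEFf
    (@MkNatTrans _ _ (functor_id W) (UEFf ⊚ singleton W) UEF_unit_ _)
    (@MkNatTrans _ _ (UEFf ⊚ SeqFun UEFf) (UEFf ⊚ flatten_functor W) UEF_sub_ _)
    UEF_unitl UEF_unitr UEF_assoc.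
Next Obligation. exact: UEF_unit_nat. Qed.
Next Obligation.
move=> xss yss h; rewrite /UEF_sub_ /= -!fmap_comp; congr fmap.
exact: UEF_sub_nat.
Qed.

End UEF.

Lemma monad_eq (C : Category) (M M' : Monad C) :
  mnd M = mnd M' ->
  (forall x (p : M x = M' x), eq_hom p ∘ mnd_eta M x = mnd_eta M' x) ->
  (forall x (p : M x = M' x) (q : M (M x) = M' (M' x)),
     eq_hom p ∘ mnd_mu M x = mnd_mu M' x ∘ eq_hom q) ->
  M = M'.
Proof.
case: M M' => [T h m l r a] [T' h' m' l' r' a'] /= e; subst T' => eh em.
have ? : h = h' by apply: nt_ext => x; rewrite -(eh x erefl) comp_idl.
have ? : m = m'.
  apply: nt_ext => x.
  by have := em x erefl erefl; rewrite /= comp_idl comp_idr.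
by subst; f_equal; apply: proof_irrelevance.
Qed.

Lemma normal_unit (V : Category) (E : Multitensor V) :
  mt_normal E -> forall x : V, exists p : x = E [:: x], mt_unit E x = eq_hom p.
Proof.
pose P (s : {T : Functor V V & NatTrans (functor_id V) T}) :=
  forall x : V, exists p : x = projT1 s x, projT2 s x = eq_hom p.
rewrite /mt_normal => e.
suff : P (existT _ (E ⊚ singleton V) (mt_unit E)) by [].
by rewrite e => x; exists erefl.
Qed.

Lemma UEF_monad (V W : Category) (F : Functor W V) (U : Functor V W)
    (adj : Adjunction F U) (E : Multitensor V) :
  mt_normal E -> mt_monad (UEF adj E) = adj_monad adj.
Proof.
move=> nE; have eu := normal_unit nE.
have e1 : E ⊚ singleton V = functor_id V by apply: (f_equal (@projT1 _ _) nE).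
have eT : mnd (mt_monad (UEF adj E)) = U ⊚ F.
  transitivity (U ⊚ (E ⊚ singleton V) ⊚ F); first exact: functor_ext.
  by rewrite e1; case: (U) (F) => ? ? ? ? [? ? ? ?]; apply: functor_ext.
apply: monad_eq => //= x p.
  rewrite /UEF_unit_; have [p0 ->] := eu (F x).
  rewrite (fmap_eq_hom _ (f_equal U p0)) comp_assoc eq_hom_comp eq_hom_id.
  by rewrite comp_idl.
move=> q; rewrite /UEF_sub_ /UEF_sub_E lcast_id lfmap_id comp_idl.
have [pb eb] := eu (F x).
have [pa ea] := eu (F (U (E [:: F x]))).
have [pe ee] := eu (E [:: F x]).
have e2 : @lfmap _ _ E [:: _] [:: _] (adj_counit adj (E [:: F x]), tt) =
    eq_hom pe ∘ adj_counit adj (E [:: F x]) ∘ eq_hom (esym pa).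
  have := nt_nat (mt_unit E) (adj_counit adj (E [:: F x])).
  rewrite /= ea ee => ->; rewrite -comp_assoc eq_hom_comp eq_hom_id.
  by rewrite comp_idr.
have e3 : msub E [:: [:: F x]] ∘ eq_hom pe = idm (E [:: F x]).
  by rewrite -ee [LHS]mt_unitl lcast_id lfmap_id.
have e4 : adj_counit adj (E [:: F x]) = eq_hom pb ∘ adj_counit adj (F x) ∘
    fmap F (fmap U (eq_hom (esym pb))).
  have := nt_nat (adj_counit adj) (eq_hom (esym pb)) => /=.
  rewrite -comp_assoc => ->; rewrite comp_assoc eq_hom_comp eq_hom_id.
  by rewrite comp_idl.
rewrite /= e2 !comp_assoc e3 comp_idl e4 !(fmap_comp U).
rewrite (fmap_eq_hom _ (f_equal U pb)) !comp_assoc eq_hom_comp eq_hom_id.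
rewrite comp_idl -!comp_assoc; congr (_ ∘ _).
rewrite (fmap_eq_hom (esym pb) (f_equal U (esym pb))).
rewrite (fmap_eq_hom _ (f_equal F (f_equal U (esym pb)))).
rewrite -(fmap_comp U) eq_hom_comp; set r := etrans _ _.
rewrite (fmap_eq_hom r (f_equal U r)).
by congr eq_hom; apply: proof_irrelevance.
Qed.

Record Graph (V : Category) := MkGraph {
  gr_ob : SmallType;
  gr_hom : gr_ob -> gr_ob -> V
}.
Arguments gr_hom {V} _ _ _.

Record GraphHom (V : Category) (X Y : Graph V) := MkGraphHom {
  gh_ob : gr_ob X -> gr_ob Y;
  gh_hom : forall a b, hom (gr_hom X a b) (gr_hom Y (gh_ob a) (gh_ob b))
}.

Lemma graph_hom_ext (V : Category) (X Y : Graph V) (f : gr_ob X -> gr_ob Y)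
    (g h : forall a b, hom (gr_hom X a b) (gr_hom Y (f a) (f b))) :
  (forall a b, g a b = h a b) -> MkGraphHom g = MkGraphHom h.
Proof.
by move=> e; congr MkGraphHom; do 2![apply: functional_extensionality_dep => ?].
Qed.

Definition graph_id (V : Category) (X : Graph V) : GraphHom X X :=
  {| gh_ob := fun a => a; gh_hom := fun a b => idm (gr_hom X a b) |}.

Definition graph_comp (V : Category) (X Y Z : Graph V) (g : GraphHom Y Z)
    (f : GraphHom X Y) : GraphHom X Z :=
  {| gh_ob := fun a => gh_ob g (gh_ob f a);
     gh_hom := fun a b => gh_hom g (gh_ob f a) (gh_ob f b) ∘ gh_hom f a b |}.

Lemma graph_comp_idl (V : Category) (X Y : Graph V) (f : GraphHom X Y) :
  graph_comp (graph_id Y) f = f.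
Proof. by case: f => f g; apply: graph_hom_ext => a b; apply: comp_idl. Qed.

Lemma graph_comp_idr (V : Category) (X Y : Graph V) (f : GraphHom X Y) :
  graph_comp f (graph_id X) = f.
Proof. by case: f => f g; apply: graph_hom_ext => a b; apply: comp_idr. Qed.

Lemma graph_comp_assoc (V : Category) (X Y Z T : Graph V) (h : GraphHom Z T)
    (g : GraphHom Y Z) (f : GraphHom X Y) :
  graph_comp h (graph_comp g f) = graph_comp (graph_comp h g) f.
Proof. by apply: graph_hom_ext => a b; apply: comp_assoc. Qed.

Definition GraphCat (V : Category) : Category :=
  @MkCategory (Graph V) (@IsCategory (Graph V) (@GraphHom V) (@graph_id V)
    (@graph_comp V) (@graph_comp_idl V) (@graph_comp_idr V)
    (@graph_comp_assoc V)).

(** A path [x_0, ..., x_n] is given by its source [a = x_0] and the sequence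
    [s = x_1, ..., x_n]; its target is [last a s], and
    [pairmap (gr_hom X) a s] is the sequence of the [X(x_{i-1}, x_i)]. *)
Section Paths.
Variables (V : Category) (X : Graph V).

Fixpoint path_targets (a : gr_ob X) (ss : seq (seq (gr_ob X))) :
    seq (gr_ob X) :=
  match ss with
  | [::] => [::]
  | s :: ss' => last a s :: path_targets (last a s) ss'
  end.

Fixpoint paths_homs (a : gr_ob X) (ss : seq (seq (gr_ob X))) : seq (seq V) :=
  match ss with
  | [::] => [::]
  | s :: ss' => pairmap (gr_hom X) a s :: paths_homs (last a s) ss'
  end.

Lemma flatten_paths_homs a ss :
  flatten (paths_homs a ss) = pairmap (gr_hom X) a (flatten ss).
Proof. by elim: ss a => //= s ss IH a; rewrite pairmap_cat IH. Qed.

Lemma last_path_targets a ss : last a (flatten ss) = last a (path_targets a ss).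
Proof. by elim: ss a => //= s ss IH a; rewrite last_cat IH. Qed.

Fixpoint lcompositions (E : Functor (SeqCat V) V)
    (comp : forall a s,
       hom (E (pairmap (gr_hom X) a s)) (gr_hom X a (last a s))) a ss :
    lhom (map E (paths_homs a ss)) (pairmap (gr_hom X) a (path_targets a ss)) :=
  match ss with
  | [::] => tt
  | s :: ss' => (comp a s, lcompositions comp (last a s) ss')
  end.

End Paths.

Fixpoint path_map (V : Category) (X Y : Graph V) (f : GraphHom X Y)
    (a : gr_ob X) (s : seq (gr_ob X)) :
    lhom (pairmap (gr_hom X) a s)
      (pairmap (gr_hom Y) (gh_ob f a) (map (gh_ob f) s)) :=
  match s with
  | [::] => tt
  | b :: s' => (gh_hom f a b, path_map f b s')
  end.

Record ECategory (V : Category) (E : Multitensor V) := MkECategory {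
  ec_graph :> Graph V;
  ec_comp : forall a s,
    hom (E (pairmap (gr_hom ec_graph) a s)) (gr_hom ec_graph a (last a s));
  ec_unit : forall a b,
    ec_comp a [:: b] ∘ mt_unit E (gr_hom ec_graph a b) =
    idm (gr_hom ec_graph a b);
  ec_assoc : forall a ss,
    ec_comp a (path_targets a ss) ∘ lfmap E (lcompositions ec_comp a ss) =
    eq_hom (f_equal (gr_hom ec_graph a) (last_path_targets a ss)) ∘
      ec_comp a (flatten ss) ∘
      lfmap E (lcast (flatten_paths_homs a ss)) ∘
      mt_sub E (paths_homs a ss)
}.
Arguments ec_comp {V E} _ _ _.
Arguments ec_unit {V E} _ _ _.
Arguments ec_assoc {V E} _ _ _.

Record EFunctor (V : Category) (E : Multitensor V) (X Y : ECategory E) :=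
  MkEFunctor {
  ef_graph :> GraphHom X Y;
  ef_comp : forall a s,
    gh_hom ef_graph a (last a s) ∘ ec_comp X a s =
    eq_hom (f_equal (gr_hom Y (gh_ob ef_graph a))
      (last_map (gh_ob ef_graph) s a)) ∘
      ec_comp Y (gh_ob ef_graph a) (map (gh_ob ef_graph) s) ∘
      lfmap E (path_map ef_graph a s)
}.

Lemma efunctor_ext (V : Category) (E : Multitensor V) (X Y : ECategory E)
    (f g : EFunctor X Y) : ef_graph f = ef_graph g -> f = g.
Proof.
by case: f g => [f hf] [g hg] /= e; subst g; f_equal; apply: proof_irrelevance.
Qed.

Lemma ec_comp_cast (V : Category) (E : Multitensor V) (X : ECategory E)
    a s s' (e : s = s') p q :
  ec_comp X a s' ∘ lfmap E (lcast p) = eq_hom q ∘ ec_comp X a s.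
Proof. by subst s'; rewrite lcast_id lfmap_id eq_hom_id comp_idl comp_idr. Qed.

Lemma path_map_id (V : Category) (X : Graph V) a s
    (p : pairmap (gr_hom X) a s = pairmap (gr_hom X) a (map id s)) :
  path_map (graph_id X) a s = lcast p.
Proof.
elim: s a p => [|b s IH] a p /=; first by rewrite lcast_id.
have p' : pairmap (gr_hom X) b s = pairmap (gr_hom X) b (map id s)
  by rewrite map_id.
by rewrite (IH b p') (lcast_cons p erefl p').
Qed.

Lemma path_map_comp (V : Category) (X Y Z : Graph V) (g : GraphHom Y Z)
    (f : GraphHom X Y) a s
    (p : pairmap (gr_hom Z) (gh_ob g (gh_ob f a))
           (map (gh_ob g) (map (gh_ob f) s)) =
         pairmap (gr_hom Z) (gh_ob g (gh_ob f a))
           (map (fun x => gh_ob g (gh_ob f x)) s)) :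
  path_map (graph_comp g f) a s =
  lcomp (lcast p) (lcomp (path_map g (gh_ob f a) (map (gh_ob f) s))
    (path_map f a s)).
Proof.
elim: s a p => [|b s IH] a p /=; first by rewrite lcast_id.
have p' : pairmap (gr_hom Z) (gh_ob g (gh_ob f b))
           (map (gh_ob g) (map (gh_ob f) s)) =
         pairmap (gr_hom Z) (gh_ob g (gh_ob f b))
           (map (fun x => gh_ob g (gh_ob f x)) s) by rewrite -map_comp.
by rewrite (IH b p') (lcast_cons p erefl p') /= comp_idl.
Qed.

Program Definition efunctor_id (V : Category) (E : Multitensor V)
  (X : ECategory E) : EFunctor X X := {| ef_graph := graph_id X |}.
Next Obligation.
move=> V E X a s.
have e : s = map id s by rewrite map_id.
have p : pairmap (gr_hom X) a s = pairmap (gr_hom X) a (map id s) by rewrite -e.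
have q : gr_hom X a (last a s) = gr_hom X a (last a (map id s)) by rewrite -e.
rewrite (path_map_id p) -comp_assoc.
rewrite [ec_comp X _ _ ∘ _](ec_comp_cast e p q) comp_assoc eq_hom_comp.
by rewrite eq_hom_id.
Qed.

Program Definition efunctor_comp (V : Category) (E : Multitensor V)
  (X Y Z : ECategory E) (g : EFunctor Y Z) (f : EFunctor X Y) :
  EFunctor X Z := {| ef_graph := graph_comp g f |}.
Next Obligation.
move=> V E X Y Z g f a s /=.
set s' := map _ s.
have e : map (gh_ob g) (map (gh_ob f) s) = s' by rewrite -map_comp.
have p : pairmap (gr_hom Z) (gh_ob g (gh_ob f a))
           (map (gh_ob g) (map (gh_ob f) s)) =
         pairmap (gr_hom Z) (gh_ob g (gh_ob f a)) s' by rewrite e.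
have q : gr_hom Z (gh_ob g (gh_ob f a))
           (last (gh_ob g (gh_ob f a)) (map (gh_ob g) (map (gh_ob f) s))) =
         gr_hom Z (gh_ob g (gh_ob f a)) (last (gh_ob g (gh_ob f a)) s')
  by rewrite e.
rewrite (path_map_comp p) !lfmap_comp !comp_assoc.
rewrite -[_ ∘ ec_comp Z _ _ ∘ _]comp_assoc (ec_comp_cast e p q).
rewrite !comp_assoc eq_hom_comp -comp_assoc ef_comp !comp_assoc.
congr (_ ∘ _).
have nat b c (r : b = c) (t : gr_hom Z _ (gh_ob g b) = gr_hom Z _ (gh_ob g c)) :
    gh_hom g (gh_ob f a) c ∘ eq_hom (f_equal (gr_hom Y (gh_ob f a)) r) =
    eq_hom t ∘ gh_hom g (gh_ob f a) b.
  by case: c / r t => t; rewrite !eq_hom_id comp_idr comp_idl.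
have t : gr_hom Z (gh_ob g (gh_ob f a))
           (gh_ob g (last (gh_ob f a) (map (gh_ob f) s))) =
         gr_hom Z (gh_ob g (gh_ob f a)) (gh_ob g (gh_ob f (last a s))).
  by rewrite last_map.
rewrite (nat _ _ _ t) -comp_assoc ef_comp !comp_assoc eq_hom_comp.
congr (_ ∘ _ ∘ _); congr eq_hom; exact: proof_irrelevance.
Qed.

Program Definition ECat (V : Category) (E : Multitensor V) : Category :=
  @MkCategory (ECategory E) (@IsCategory (ECategory E) (@EFunctor V E)
    (@efunctor_id V E) (@efunctor_comp V E) _ _ _).
Next Obligation. by move=> *; apply: efunctor_ext; apply: graph_comp_idl. Qed.
Next Obligation. by move=> *; apply: efunctor_ext; apply: graph_comp_idr. Qed.
Next Obligation. by move=> *; apply: efunctor_ext; apply: graph_comp_assoc. Qed.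

Definition ecat_graph (V : Category) (E : Multitensor V) :
    Functor (ECat E) (GraphCat V) :=
  @MkFunctor (ECat E) (GraphCat V) (fun X => ec_graph X)
    (fun X Y f => ef_graph f) (fun _ => erefl) (fun _ _ _ _ _ => erefl).

(** The homs of an [E]-category are algebras for the monad [E_1] under unary
    composition. *)
Program Definition ecat_algebra_graph (V : Category) (E : Multitensor V)
    (X : ECategory E) : Graph (EM (mt_monad E)) :=
  @MkGraph (EM (mt_monad E)) (gr_ob X) (fun a b =>
    @MkAlgebra V (mt_monad E) (gr_hom X a b) (ec_comp X a [:: b]) _ _).
Next Obligation. by move=> V E X a b; apply: ec_unit. Qed.
Next Obligation.
move=> V E X a b; rewrite [LHS](ec_assoc X a [:: [:: b]]).
by rewrite eq_hom_id lcast_id lfmap_id comp_idl comp_idr.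
Qed.

Program Definition ecat_algebras (V : Category) (E : Multitensor V) :
    Functor (ECat E) (GraphCat (EM (mt_monad E))) :=
  @MkFunctor (ECat E) (GraphCat (EM (mt_monad E))) (@ecat_algebra_graph V E)
    (fun X Y f => @MkGraphHom _ (ecat_algebra_graph X) (ecat_algebra_graph Y)
       (gh_ob f) (fun a b => @MkAlgHom _ _ _ _ (gh_hom f a b) _)) _ _.
Next Obligation.
by move=> V E X Y f a b; rewrite [LHS](ef_comp f a [:: b]) eq_hom_id comp_idl.
Qed.
Next Obligation.
by move=> V E X; apply: graph_hom_ext => a b; apply: alg_hom_ext.
Qed.
Next Obligation.
by move=> V E X Y Z g f; apply: graph_hom_ext => a b; apply: alg_hom_ext.
Qed.

Definition is_lifted (W : Category) (D : Multitensor W)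
    (D' : Multitensor (EM (mt_monad D))) : Prop :=
  [/\ mt_normal D', mt_distributive D'
    & exists Phi : CatIso (ECat D') (ECat D),
        ecat_algebras D ⊚ Phi = ecat_graph D'].
Arguments is_lifted {W} D D'.

Program Definition eq_nt (C D : Category) (F G : Functor C D) (p : F = G) :
    NatTrans F G :=
  {| nt := fun x => eq_hom (f_equal (fun H : Functor C D => H x) p) |}.
Next Obligation.
by move=> C D F G p x y f; case: G / p; rewrite comp_idl comp_idr.
Qed.

(** The inverse of an isomorphism of categories is left adjoint to it, with
    identities as unit and counit. *)
Program Definition iso_adjunction (C D : Category) (K : CatIso C D) :
    Adjunction (inverse (iso_inv K)) K :=
  {| adj_unit := eq_nt (esym (Kinverse (iso_inv K)));
     adj_counit := eq_nt (inverseK (iso_inv K)) |}.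
Next Obligation.
move=> C D K d /=; set p := f_equal _ (esym _).
rewrite (fmap_eq_hom p (f_equal _ p)) eq_hom_comp; exact: eq_hom_id.
Qed.
Next Obligation.
move=> C D K d /=; set p := f_equal _ (inverseK _).
rewrite (fmap_eq_hom p (f_equal _ p)) eq_hom_comp; exact: eq_hom_id.
Qed.

(** The multitensor on [D] corresponding to [E] under [K : C ≅ D], namely
    [K E K^-1]. *)
Definition transport (C D : Category) (K : CatIso C D) (E : Multitensor C) :
  Multitensor D := UEF (iso_adjunction K) E.

(** [V ≅ W^{UF} = W^{(UEF)_1}]: the comparison isomorphism, followed by the
    equality of monads [UF = (UEF)_1]. *)
Definition comparison_iso (V W : Category) (F : Functor W V) (U : Functor V W)
    (adj : Adjunction F U) (hU : monadic adj) (E : Multitensor V)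
    (hE : mt_normal E) : CatIso V (EM (mt_monad (UEF adj E))) :=
  eq_rect_r (fun T : Monad W => CatIso V (EM T))
    (MkCatIso hU) (UEF_monad adj hE).

(* Main.v *)
From Stdlib Require Import FunctionalExtensionality ProofIrrelevance.
From Stdlib Require Import IndefiniteDescription.
From mathcomp Require Import all_boot.
Require Import Defs.

(** The transport [T] of [E] along [V ≅ W^{UF}] is a lifted multitensor of
    [D = UEF], and lifted multitensors are unique.

    Existence.  Write [G] for the forgetful functor of [W^{UF}] and [L] for the
    isomorphism to [V].  The counit gives maps [F G x -> L x], which are
    reflexive coequalizers because [U] is monadic; since [E] is closed, it
    preserves them one variable at a time, hence also in all variables jointly.
    So in [theta : D (G x_i) = U E (F G x_i) -> U E (L x_i) ≅ G T (x_i)] the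
    object [T (x_i)] is the universal way to make a composition map of a
    [D]-category out of a map of algebras, and [D]-categories are the same as
    [T]-categories.

    Uniqueness.  If [P], [Q] are distributive and [P-Cat ≅ Q-Cat] over graphs,
    let [X] be the free [Q]-category on the graph [0 -> 1 -> ... -> n] with homs
    [x_1, ..., x_n] and all other homs initial.  By distributivity
    [X(0, n) = Q (x_1, ..., x_n)], so the [P]-structure that corresponds to [X]
    gives a map [P (x_1, ..., x_n) -> Q (x_1, ..., x_n)], and freeness of [X]
    makes these maps the components of an isomorphism of multitensors. *)

Set Implicit Arguments.
Unset Strict Implicit.
Unset Printing Implicit Defensive.
Local Open Scope cat_scope.

(** * Morphisms between propositionally equal objects *)

(** Reflexivity is what turns preservation in each variable into joint preservation: the common
    sections freeze all variables but one. Associativity of the [T]-composition obtained from a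
    [D]-category is an equation between maps out of a twice iterated [T], so being epic for [theta]
    alone does not settle it; one needs the same for [theta] after a second layer of [theta]. This
    holds because the counits at the objects [E (F G x_i)] are reflexive coequalizers too, and so
    are the maps [E (nu x_i)]. In the uniqueness argument the line has all natural numbers as
    vertices. A finite sequence is continued by an initial object, so that a functor out of the free
    category needs no data beyond the sequence. The formal obstacle is that [flatten], [map] and
    [last] satisfy their identities only propositionally, and so do graphs and homs under strict
    isomorphisms of categories. Identities are therefore proved modulo casts, by [heq]; between
    parallel maps it is equality, by proof irrelevance. *)

Definition heq (C : Category) (x y x' y' : C) (f : hom x y) (g : hom x' y') :=
  exists (p : x = x') (q : y = y'), eq_hom q ∘ f = g ∘ eq_hom p.

Section Heq.
Variable C : Category.

Lemma heq_refl (x y : C) (f : hom x y) : heq f f.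
Proof. by exists erefl, erefl; rewrite comp_idl comp_idr. Qed.

Lemma eq_heq (x y : C) (f g : hom x y) : f = g -> heq f g.
Proof. by move=> ->; apply: heq_refl. Qed.

Lemma heq_eq (x y : C) (f g : hom x y) : heq f g -> f = g.
Proof. by case=> p [q]; rewrite !eq_hom_id comp_idl comp_idr. Qed.

Lemma heq_sym (x y x' y' : C) (f : hom x y) (g : hom x' y') :
  heq f g -> heq g f.
Proof.
by case=> p [q]; case: x' / p g => g; case: y' / q g => g /=;
  rewrite comp_idl comp_idr => ->; apply: heq_refl.
Qed.

Lemma heq_trans (x y x' y' x'' y'' : C) (f : hom x y) (g : hom x' y')
    (h : hom x'' y'') : heq f g -> heq g h -> heq f h.
Proof.
by case=> p [q]; case: x' / p g => g; case: y' / q g => g /=;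
  rewrite comp_idl comp_idr => ->.
Qed.

Lemma heq_comp (x y z x' y' z' : C) (g : hom y z) (f : hom x y)
    (g' : hom y' z') (f' : hom x' y') :
  heq g g' -> heq f f' -> heq (g ∘ f) (g' ∘ f').
Proof.
case=> p [q] e [r [s]]; move: e; subst x' y' z'.
rewrite !eq_hom_id !comp_idl !comp_idr => -> ->; exact: heq_refl.
Qed.

Lemma heq_idl (x y z : C) (p : y = z) (f : hom x y) : heq (eq_hom p ∘ f) f.
Proof. by subst z; rewrite comp_idl; apply: heq_refl. Qed.

Lemma heq_idr (x y z : C) (p : x = y) (f : hom y z) : heq (f ∘ eq_hom p) f.
Proof. by subst y; rewrite comp_idr; apply: heq_refl. Qed.

Lemma heq_id (x x' : C) : x = x' -> heq (idm x) (idm x').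
Proof. by move=> ->; apply: heq_refl. Qed.

Lemma heq_eq_hom (x y z : C) (p : x = y) : x = z -> heq (eq_hom p) (idm z).
Proof. by move=> <-; subst y; apply: heq_refl. Qed.

End Heq.

Lemma heq_fmap (C D : Category) (G : Functor C D) (x y x' y' : C)
    (f : hom x y) (g : hom x' y') : heq f g -> heq (fmap G f) (fmap G g).
Proof.
by case=> p [q]; subst x' y'; rewrite /= comp_idl comp_idr => ->;
  apply: heq_refl.
Qed.

Lemma eq_hom_mono (C : Category) (x y z : C) (p : y = z) (f g : hom x y) :
  eq_hom p ∘ f = eq_hom p ∘ g -> f = g.
Proof. by subst z; rewrite !comp_idl. Qed.

(** Serves to cancel the composite of the generators of a free category, which is an identity only
    up to casts. *)
Lemma heq_id_mono (C : Category) (x y z t : C) (c : hom y z) (f g : hom x y) :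
  heq c (idm t) -> c ∘ f = c ∘ g -> f = g.
Proof.
move=> hc; case: (hc) => p [q _]; subst y z; rewrite (heq_eq hc).
by rewrite !comp_idl.
Qed.

Lemma heq_fmap_id (C C' : Category) (H : Functor C C') (x y z : C) (f : hom x y) :
  heq f (idm z) -> heq (fmap H f) (idm (H z)).
Proof. by move=> /(heq_fmap H); rewrite fmap_id. Qed.

Lemma heq_compl_id (C : Category) (x y z t : C) (g : hom y z) (f : hom x y) :
  heq g (idm t) -> heq (g ∘ f) f.
Proof.
move=> hg; case: (hg) => p [q _]; subst y z; rewrite (heq_eq hg) comp_idl.
exact: heq_refl.
Qed.

Lemma heq_compr_id (C : Category) (x y z t : C) (g : hom y z) (f : hom x y) :
  heq f (idm t) -> heq (g ∘ f) g.
Proof.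
move=> hg; case: (hg) => p [q _]; subst x y; rewrite (heq_eq hg) comp_idr.
exact: heq_refl.
Qed.

Lemma heq_epi (V : Category) (x y x' y' : V) (f : hom x y) (f' : hom x' y') :
  heq f f' -> (forall z (g g' : hom y' z), g ∘ f' = g' ∘ f' -> g = g') ->
  forall z (g g' : hom y z), g ∘ f = g' ∘ f -> g = g'.
Proof.
move=> h epi; case: (h) => p [q _]; subst x' y'; rewrite (heq_eq h).
exact: epi.
Qed.

(** * Comparison modulo casts for sequences of morphisms *)

Section ListHeq.
Variable C : Category.
Implicit Types xs ys : seq C.

Definition lheq xs ys xs' ys' (f : lhom xs ys) (g : lhom xs' ys') :=
  @heq (SeqCat C) xs ys xs' ys' f g.

Lemma lheq_refl xs ys (f : lhom xs ys) : lheq f f.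
Proof. exact: (@heq_refl (SeqCat C)). Qed.

Lemma lheq_eq xs ys (f g : lhom xs ys) : lheq f g -> f = g.
Proof. exact: (@heq_eq (SeqCat C)). Qed.

Lemma lheq_sym xs ys xs' ys' (f : lhom xs ys) (g : lhom xs' ys') :
  lheq f g -> lheq g f.
Proof. exact: (@heq_sym (SeqCat C)). Qed.

Lemma lheq_trans xs ys xs' ys' xs'' ys'' (f : lhom xs ys) (g : lhom xs' ys')
    (h : lhom xs'' ys'') : lheq f g -> lheq g h -> lheq f h.
Proof. exact: (@heq_trans (SeqCat C)). Qed.

Lemma lheq_castl xs ys zs (p : ys = zs) (f : lhom xs ys) :
  lheq (lcomp (lcast p) f) f.
Proof. exact: (@heq_idl (SeqCat C)). Qed.

Lemma lheq_castr xs ys zs (p : xs = ys) (f : lhom ys zs) :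
  lheq (lcomp f (lcast p)) f.
Proof. exact: (@heq_idr (SeqCat C)). Qed.

Lemma lheq_cast xs ys zs (p : xs = ys) : xs = zs -> lheq (lcast p) (lid zs).
Proof. exact: (@heq_eq_hom (SeqCat C)). Qed.

Lemma lheq_cons (x y x' y' : C) xs ys xs' ys' (f : hom x y) (fs : lhom xs ys)
    (g : hom x' y') (gs : lhom xs' ys') :
  heq f g -> lheq fs gs ->
  @lheq (x :: xs) (y :: ys) (x' :: xs') (y' :: ys') (f, fs) (g, gs).
Proof.
move=> hf hfs; case: (hf) => p [q _]; case: (hfs) => ps [qs _]; subst.
rewrite (heq_eq hf) (lheq_eq hfs); exact: lheq_refl.
Qed.

Lemma lheq_cat xs ys xs' ys' zs ts zs' ts' (f : lhom xs ys) (g : lhom xs' ys')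
    (f' : lhom zs ts) (g' : lhom zs' ts') :
  lheq f g -> lheq f' g' -> lheq (lcat f f') (lcat g g').
Proof.
move=> hf hf'; case: (hf) => p [q _]; case: (hf') => ps [qs _]; subst.
rewrite (lheq_eq hf) (lheq_eq hf'); exact: lheq_refl.
Qed.

Lemma lheq_lfmap (D : Category) (G : Functor (SeqCat C) D) xs ys xs' ys'
    (f : lhom xs ys) (g : lhom xs' ys') :
  lheq f g -> heq (lfmap G f) (lfmap G g).
Proof. exact: heq_fmap. Qed.

(** The shape is that of the right-hand side of [ec_assoc] without its outer cast: composition,
    cast, substitution. The outer factors are compared separately, whatever cast joins them. *)
Lemma heq_lmid (D : Category) (G : Functor (SeqCat C) D) (x t x' t' : D)
    xs ys xs' ys' (g : hom (G ys) t) (p : xs = ys) (f : hom x (G xs))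
    (g' : hom (G ys') t') (p' : xs' = ys') (f' : hom x' (G xs')) :
  heq g g' -> heq f f' ->
  heq (g ∘ lfmap G (lcast p) ∘ f) (g' ∘ lfmap G (lcast p') ∘ f').
Proof.
move=> hg hf; subst ys ys'; rewrite !lcast_id !lfmap_id !comp_idr.
exact: heq_comp.
Qed.

Lemma heq_lmidl (D : Category) (G : Functor (SeqCat C) D) (x t x' t' z : D)
    xs ys (g : hom (G ys) t) (p : xs = ys) (f : hom x (G xs))
    (g' : hom z t') (f' : hom x' z) :
  heq g g' -> heq f f' -> heq (g ∘ lfmap G (lcast p) ∘ f) (g' ∘ f').
Proof.
move=> hg hf; subst ys; rewrite !lcast_id !lfmap_id !comp_idr.
exact: heq_comp.
Qed.

Lemma heq_lcastl (D : Category) (G : Functor (SeqCat C) D) (x : D)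
    xs ys (p : xs = ys) (f : hom x (G xs)) : heq (lfmap G (lcast p) ∘ f) f.
Proof.
by subst ys; rewrite lcast_id lfmap_id comp_idl; apply: heq_refl.
Qed.

Lemma heq_lcastr (D : Category) (G : Functor (SeqCat C) D) (x : D)
    xs ys (p : xs = ys) (f : hom (G ys) x) : heq (f ∘ lfmap G (lcast p)) f.
Proof.
by subst ys; rewrite lcast_id lfmap_id comp_idr; apply: heq_refl.
Qed.

End ListHeq.

Lemma heq_msub (V : Category) (E : Multitensor V) (xss yss : seq (seq V)) :
  xss = yss -> heq (msub E xss) (msub E yss).
Proof. by move=> ->; apply: heq_refl. Qed.

Lemma heq_ec_comp (V : Category) (E : Multitensor V) (X : ECategory E) a b s t :
  a = b -> s = t -> heq (ec_comp X a s) (ec_comp X b t).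
Proof. by move=> -> ->; apply: heq_refl. Qed.

(** * Initial objects *)

Definition initial (C : Category) (x : C) :=
  forall y, exists h : hom x y, forall h', h' = h.

Lemma initial_eq (C : Category) (x y : C) (f g : hom x y) : initial x -> f = g.
Proof. by move=> /(_ y) [h u]; rewrite (u f) (u g). Qed.

Fixpoint has_initial (C : Category) (xs : seq C) : Prop :=
  if xs is x :: xs' then initial x \/ has_initial xs' else False.

Lemma has_initial_cat (C : Category) (xs ys : seq C) :
  has_initial (xs ++ ys) <-> has_initial xs \/ has_initial ys.
Proof.
elim: xs => [|x xs IH] /=; first by split; [right | case].
rewrite IH; tauto.
Qed.

Lemma has_initialP (C : Category) (xs : seq C) : has_initial xs ->
  exists l x r, initial x /\ xs = l ++ x :: r.
Proof.
elim: xs => //= x xs IH [i|/IH [l [y [r [i ->]]]]]; first by exists [::], x, xs.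
by exists (x :: l), y, r.
Qed.

Definition empty_functor (C : Category) : Functor (discrete Empty_set) C.
Proof.
refine (@MkFunctor (discrete Empty_set) C
  (fun i : Empty_set => match i with end)
  (fun i : Empty_set => match i with end) _ _); by case.
Defined.

Definition empty_cocone (J C : Category) (D : Functor J C) (hJ : J -> False)
    (x : C) : Cocone D.
Proof.
refine (@MkCocone J C D x (fun j => match hJ j with end) _).
by move=> i; case: (hJ i).
Defined.

Lemma initial_colimit (J C : Category) (D : Functor J C) (hJ : J -> False)
    (c : Cocone D) : initial (apex c) <-> is_colimit c.
Proof.
split=> [h c' | h y].
  have [f u] := h (apex c'); exists f; split=> [j|g _]; first by case: (hJ j).
  exact/esym/u.
have [f [_ u]] := h (empty_cocone D hJ y).
by exists f => g; apply/esym/u => j; case: (hJ j).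
Qed.

Lemma preserves_initial (C D : Category) (G : Functor C D) (x : C) :
  preserves_coproducts G -> initial x -> initial (G x).
Proof.
move=> hG hx; have hJ : discrete Empty_set -> False by case.
have /(hG _ _ _) h := (initial_colimit hJ (empty_cocone (empty_functor C) hJ x)).1 hx.
exact: ((initial_colimit hJ _).2 h).
Qed.

Lemma distributive_initial (V : Category) (E : Multitensor V) (xs : seq V) :
  mt_distributive E -> has_initial xs -> initial (E xs).
Proof.
move=> hE /has_initialP [l [x [r [i ->]]]].
exact: (preserves_initial (hE l r) i).
Qed.

(** * The free category on a line *)

Section Free.
Variables (A : Category) (Q : Multitensor A) (hQ : mt_distributive Q).
Variables (zero : A) (h0 : initial zero) (x : nat -> A).

(** For [j < i] the value is a sequence that [Q] sends to an initial object. *)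
Definition seg (i j : nat) : seq A :=
  if i <= j then map x (iota i (j - i)) else [:: zero].

Lemma segD i k : seg i (i + k) = map x (iota i k).
Proof. by rewrite /seg leq_addr addKn. Qed.

Lemma seg_cat i j k : i <= j -> j <= k -> seg i j ++ seg j k = seg i k.
Proof.
move=> /subnKC <- /subnKC <-; set p := j - i; set q := k - _.
by rewrite !segD -addnA segD iotaD map_cat.
Qed.

Definition free_graph : Graph A := MkGraph (fun i j => Q (seg i j)).

Lemma pairmap_free_graph a s :
  pairmap (gr_hom free_graph) a s = map Q (pairmap seg a s).
Proof. by elim: s a => //= b s IH a; rewrite IH. Qed.

Lemma path_le_last a s : path leq a s -> a <= last a s.
Proof. by elim: s a => //= b s IH a /andP [ab /IH]; apply: leq_trans. Qed.

Lemma flatten_seg a s : path leq a s ->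
  flatten (pairmap seg a s) = seg a (last a s).
Proof.
elim: s a => [|b s IH] a /=; first by rewrite /seg leqnn subnn.
case/andP=> ab hs; rewrite IH // seg_cat //; exact: path_le_last.
Qed.

Lemma free_hom_initial i j : j < i -> initial (gr_hom free_graph i j).
Proof.
rewrite ltnNge /= /seg => /negbTE ->; apply: distributive_initial => //.
by left.
Qed.

Lemma free_path_initial a s : ~~ path leq a s ->
  has_initial (pairmap (gr_hom free_graph) a s).
Proof.
elim: s a => //= b s IH a; rewrite negb_and -ltnNge => /orP [ab|/IH]; last by right.
by left; apply: free_hom_initial.
Qed.

(** On a monotone path, composition is substitution in [Q] up to casts, since the segments
    concatenate to [seg a (last a s)]. A descent in the path makes the source initial, so that the
    value there is forced and every law holds trivially. *)
Lemma free_comp_exists a s :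
  exists c : hom (Q (pairmap (gr_hom free_graph) a s)) (Q (seg a (last a s))),
    path leq a s -> heq c (msub Q (pairmap seg a s)).
Proof.
have [h|/free_path_initial h] := boolP (path leq a s); last first.
  by have [c _] := distributive_initial hQ h (Q (seg a (last a s))); exists c.
exists (lfmap Q (lcast (flatten_seg h)) ∘ msub Q _ ∘
  lfmap Q (lcast (pairmap_free_graph a s))) => _.
rewrite -comp_assoc; apply: heq_trans (heq_lcastl _ _) _; exact: heq_lcastr.
Qed.

Definition free_comp a s :=
  proj1_sig (constructive_indefinite_description _ (free_comp_exists a s)).

Lemma free_compE a s : path leq a s ->
  heq (free_comp a s) (msub Q (pairmap seg a s)).
Proof. by rewrite /free_comp; case: constructive_indefinite_description. Qed.

Lemma free_unit a b :
  free_comp a [:: b] ∘ mt_unit Q (Q (seg a b)) = idm (Q (seg a b)).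
Proof.
case: (leqP a b) => [ab|/free_hom_initial]; last exact: initial_eq.
have h : heq (free_comp a [:: b]) (msub Q [:: seg a b]).
  by apply: (@free_compE a [:: b]); rewrite /= ab.
have hu := heq_refl (mt_unit Q (Q (seg a b))).
apply: heq_eq; apply: heq_trans (heq_comp h hu) _.
rewrite /msub mt_unitl.
apply: heq_trans (lheq_lfmap Q (lheq_cast _ (erefl _))) _.
by rewrite lfmap_id; apply: heq_refl.
Qed.

Fixpoint path_segs a (ss : seq (seq nat)) : seq (seq (seq A)) :=
  if ss is s :: ss' then pairmap seg a s :: path_segs (last a s) ss' else [::].

Lemma flatten_path_segs a ss : 
  flatten (path_segs a ss) = pairmap seg a (flatten ss).
Proof. by elim: ss a => //= s ss IH a; rewrite IH pairmap_cat. Qed.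

Lemma paths_homs_free a ss :
  paths_homs (X := free_graph) a ss = map (map Q) (path_segs a ss).
Proof.
by elim: ss a => //= s ss IH a; rewrite IH (pairmap_free_graph a s).
Qed.

Lemma flatten_segs a ss : path leq a (flatten ss) ->
  map flatten (path_segs a ss) =
  pairmap seg a (path_targets (X := free_graph) a ss).
Proof.
elim: ss a => //= s ss IH a; rewrite cat_path => /andP [h1 h2].
by rewrite flatten_seg // IH.
Qed.

Lemma path_targets_le a ss : path leq a (flatten ss) ->
  path leq a (path_targets (X := free_graph) a ss).
Proof.
elim: ss a => //= s ss IH a; rewrite cat_path => /andP [h1 h2].
by rewrite path_le_last //= IH.
Qed.

Lemma free_compositions a ss : path leq a (flatten ss) ->
  lheq (lcompositions (X := free_graph) free_comp a ss)
       (lsubs (msub Q) (path_segs a ss)).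
Proof.
elim: ss a => [|s ss IH] a /=; first by move=> _; apply: lheq_refl.
rewrite cat_path => /andP [h1 h2]; apply: lheq_cons; last exact: IH.
exact: free_compE.
Qed.

Lemma has_initial_flatten (yss : seq (seq A)) :
  has_initial (flatten yss) -> has_initial (map Q yss).
Proof.
elim: yss => //= ys yss IH /has_initial_cat [h|/IH]; last by right.
by left; apply: distributive_initial.
Qed.

Lemma free_assoc a ss :
  free_comp a (path_targets (X := free_graph) a ss) ∘
    lfmap Q (lcompositions (X := free_graph) free_comp a ss) =
  eq_hom (f_equal (gr_hom free_graph a) (last_path_targets (X:=free_graph) a ss)) ∘
    free_comp a (flatten ss) ∘
    lfmap Q (lcast (flatten_paths_homs (X := free_graph) a ss)) ∘
    mt_sub Q (paths_homs (X := free_graph) a ss).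
Proof.
have [h|h] := boolP (path leq a (flatten ss)); last first.
  (* A descent in the concatenated path gives an initial entry in some block; [Q] of that block is
     initial, hence so is the common source of the two sides. *)
  apply/initial_eq/distributive_initial => //; apply: has_initial_flatten.
  rewrite flatten_paths_homs; exact: free_path_initial.
apply: heq_eq.
have hL : heq (free_comp a (path_targets (X := free_graph) a ss))
              (msub Q (map flatten (path_segs a ss))).
  rewrite flatten_segs //; apply: free_compE; exact: path_targets_le.
apply: heq_trans (heq_comp hL (lheq_lfmap Q (free_compositions h))) _.
rewrite msub_assoc -[X in heq _ X]comp_assoc -comp_assoc.
rewrite -![X in heq X _]comp_assoc -![X in heq _ X]comp_assoc.
apply: heq_trans (heq_lcastl _ _) (heq_sym _); apply: heq_trans (heq_idl _ _) _.
rewrite !comp_assoc; apply: heq_lmid.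
  apply: heq_trans (free_compE h) _; apply: heq_msub.
  by rewrite flatten_path_segs.
by apply: heq_msub; apply: paths_homs_free.
Qed.

Definition free_ecat : ECategory Q :=
  @MkECategory A Q free_graph free_comp free_unit free_assoc.

Section Extend.
Variables (Y : ECategory Q) (y : nat -> gr_ob Y).
Variable h : forall i, hom (x i) (gr_hom Y (y i) (y i.+1)).

Fixpoint hseg i k : lhom (map x (iota i k))
    (pairmap (gr_hom Y) (y i) (map y (iota i.+1 k))) :=
  if k is k'.+1 then (h i, hseg i.+1 k') else tt.

Lemma last_iota i k : last (y i) (map y (iota i.+1 k)) = y (i + k).
Proof. by elim: k i => [|k IH] i /=; rewrite ?addn0 // IH addnS. Qed.

Lemma hseg_cat i k l :
  lheq (hseg i (k + l)) (lcat (hseg i k) (hseg (i + k) l)).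
Proof.
elim: k i => [|k IH] i /=; first by rewrite addn0; apply: lheq_refl.
apply: lheq_cons; first exact: heq_refl.
by rewrite -addSnnS; apply: IH.
Qed.

(** Quantifying over [k] with [j = i + k] keeps subtraction out of the types. For [j < i] the
    condition is vacuous and the source initial. *)
Lemma free_ext_exists i j :
  exists r : hom (Q (seg i j)) (gr_hom Y (y i) (y j)),
    forall k, j = i + k ->
      heq r (ec_comp Y (y i) (map y (iota i.+1 k)) ∘ lfmap Q (hseg i k)).
Proof.
case: (leqP i j) => [ij|ij]; last first.
  have [r _] := free_hom_initial ij (gr_hom Y (y i) (y j)).
  by exists r => k e; exfalso; move: ij; rewrite e ltnNge leq_addr.
have [k ->] : exists k, j = i + k by exists (j - i); rewrite subnKC.
exists (eq_hom (f_equal (gr_hom Y (y i)) (last_iota i k)) ∘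
  ec_comp Y (y i) (map y (iota i.+1 k)) ∘ lfmap Q (hseg i k) ∘
  lfmap Q (lcast (segD i k))) => k' /addnI <-.
rewrite -!comp_assoc; apply: heq_trans (heq_idl _ _) _.
apply: heq_comp; [exact: heq_refl | exact: heq_lcastr].
Qed.

Definition free_ext_hom i j :=
  proj1_sig (constructive_indefinite_description _ (free_ext_exists i j)).

Lemma free_ext_homE i k :
  heq (free_ext_hom i (i + k))
    (ec_comp Y (y i) (map y (iota i.+1 k)) ∘ lfmap Q (hseg i k)).
Proof.
by rewrite /free_ext_hom; case: constructive_indefinite_description => r /=; apply.
Qed.

Definition free_ext_graph : GraphHom free_graph Y :=
  @MkGraphHom A free_graph Y y free_ext_hom.

(** Monotone paths are encoded by their step lengths, so that the blocks [xsteps] and [ysteps] below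
    can be defined by recursion without a proof of monotonicity. *)
Fixpoint steps a (ks : seq nat) : seq nat :=
  if ks is k :: ks' then a + k :: steps (a + k) ks' else [::].

Lemma stepsP a s : path leq a s -> exists ks, s = steps a ks.
Proof.
elim: s a => [|b s IH] a /=; first by exists [::].
case/andP=> ab /IH [ks e]; exists (b - a :: ks) => /=; by rewrite subnKC // -e.
Qed.

Lemma steps_path a ks : path leq a (steps a ks).
Proof. by elim: ks a => //= k ks IH a; rewrite leq_addr IH. Qed.

Lemma last_steps a ks : last a (steps a ks) = a + sumn ks.
Proof. by elim: ks a => [|k ks IH] a /=; rewrite ?addn0 // IH addnA. Qed.

Fixpoint ysteps a (ks : seq nat) : seq (seq (gr_ob Y)) :=
  if ks is k :: ks' then map y (iota a.+1 k) :: ysteps (a + k) ks' else [::].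

Fixpoint xsteps a (ks : seq nat) : seq (seq A) :=
  if ks is k :: ks' then map x (iota a k) :: xsteps (a + k) ks' else [::].

Lemma pairmap_steps a ks : pairmap seg a (steps a ks) = xsteps a ks.
Proof. by elim: ks a => //= k ks IH a; rewrite IH segD. Qed.

Lemma path_targets_ysteps a ks :
  path_targets (y a) (ysteps a ks) = map y (steps a ks).
Proof. by elim: ks a => //= k ks IH a; rewrite last_iota IH. Qed.

Lemma flatten_ysteps a ks :
  flatten (ysteps a ks) = map y (iota a.+1 (sumn ks)).
Proof. by elim: ks a => //= k ks IH a; rewrite IH iotaD map_cat. Qed.

(** Groups the maps [h] by the steps of the path. The extension sends each step to a composite in
    [Y], hence a path to a list of composites, which is what associativity in [Y] takes as input. *)
Lemma hsegs_exists a ks : exists hs : @lhom (SeqCat A) (xsteps a ks)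
     (paths_homs (y a) (ysteps a ks)),
   lheq (lflatten hs) (hseg a (sumn ks)) /\
   lheq (path_map free_ext_graph a (steps a ks))
     (lcomp (lcompositions (ec_comp Y) (y a) (ysteps a ks)) (lmap Q hs)).
Proof.
elim: ks a => [|k ks IH] a /=; first by exists tt; split; apply: lheq_refl.
set b := last _ _.
(* The first block ends at [b], which equals [y (a + k)] only propositionally; the induction
   hypothesis is restated at [b] to match the dependent types. *)
have [hs [e1 e2]] : exists hs : @lhom (SeqCat A) (xsteps (a + k) ks)
     (paths_homs b (ysteps (a + k) ks)),
   lheq (lflatten hs) (hseg (a + k) (sumn ks)) /\
   lheq (path_map free_ext_graph (a + k) (steps (a + k) ks))
     (lcomp (lcompositions (ec_comp Y) b (ysteps (a + k) ks)) (lmap Q hs)).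
  by rewrite /b last_iota; apply: IH.
exists (hseg a k, hs) => /=; split.
  apply: lheq_trans (lheq_sym (hseg_cat _ _ _)).
  by apply: lheq_cat => //; apply: lheq_refl.
by apply: lheq_cons => //; apply: free_ext_homE.
Qed.

Lemma free_ext_comp a s :
  free_ext_hom a (last a s) ∘ free_comp a s =
  eq_hom (f_equal (gr_hom Y (y a)) (last_map y s a)) ∘
    ec_comp Y (y a) (map y s) ∘ lfmap Q (path_map free_ext_graph a s).
Proof.
have [/stepsP [ks ->]|hs] := boolP (path leq a s); last first.
  by apply/initial_eq/distributive_initial => //; apply: free_path_initial.
have [hs [e1 e2]] := hsegs_exists a ks.
apply: heq_eq.
have hR : heq (ec_comp Y (y a) (map y (steps a ks)))
    (ec_comp Y (y a) (path_targets (y a) (ysteps a ks))).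
  by apply: heq_ec_comp => //; rewrite path_targets_ysteps.
rewrite -[X in heq _ X]comp_assoc; apply: heq_sym.
apply: heq_trans (heq_idl _ _) _.
apply: heq_trans (heq_comp hR (lheq_lfmap Q e2)) _.
(* Associativity in [Y] flattens the composite of composites; naturality then moves the substitution
   of [Q] past [hs], where it is the composition of the free category. *)
rewrite lfmap_comp comp_assoc ec_assoc -!comp_assoc [mt_sub Q _ ∘ _](msub_nat Q hs).
apply: heq_trans (heq_idl _ _) _; rewrite !comp_assoc.
apply: heq_comp; last first.
  apply: heq_sym; apply: heq_trans (free_compE (steps_path _ _)) _.
  by apply: heq_msub; apply: pairmap_steps.
rewrite last_steps; apply: heq_sym; apply: heq_trans (free_ext_homE _ _) _.
apply: heq_sym; apply: heq_lmidl; last exact: lheq_lfmap.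
by apply: heq_ec_comp => //; rewrite flatten_ysteps.
Qed.

Definition free_ext : EFunctor free_ecat Y :=
  @MkEFunctor A Q free_ecat Y free_ext_graph free_ext_comp.

End Extend.
End Free.

(** * The universal arrow from a finite sequence *)

Section FreeList.
Variables (A : Category) (Q : Multitensor A) (hQ : mt_distributive Q).
Variables (zero : A) (h0 : initial zero).

Lemma hseg_shift (Y : ECategory Q) (x x' : nat -> A) (y y' : nat -> gr_ob Y)
    (h : forall i, hom (x i) (gr_hom Y (y i) (y i.+1)))
    (h' : forall i, hom (x' i) (gr_hom Y (y' i) (y' i.+1))) :
  (forall i, x i.+1 = x' i) -> (forall i, y i.+1 = y' i) ->
  (forall i, heq (h i.+1) (h' i)) ->
  forall i k, lheq (hseg h i.+1 k) (hseg h' i k).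
Proof.
move=> ex ey eh i k; elim: k i => [|k IH] i /=; first exact: lheq_refl.
by apply: lheq_cons.
Qed.

(** Past the end of [xs] the source is [zero], so the maps there are forced and the default vertex
    [d] is arbitrary. *)
Lemma lhom_nth (Y : ECategory Q) (d b : gr_ob Y) (t : seq (gr_ob Y)) (xs : seq A)
    (h : lhom xs (pairmap (gr_hom Y) b t)) :
  exists hh : forall i, hom (nth zero xs i)
                  (gr_hom Y (nth d (b :: t) i) (nth d (b :: t) i.+1)),
    map (nth d (b :: t)) (iota 1 (size xs)) = t /\
    lheq (hseg hh 0 (size xs)) h.
Proof.
elim: xs b t h => [|x1 xs IH] b [|b' t] //=.
  case.
  have hi i : initial (nth zero [::] i) by rewrite nth_nil.
  exists (fun i => proj1_sig (constructive_indefinite_description _ (hi i _))).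
  by split=> //; apply: lheq_refl.
case=> h1 hs; have [hh [e1 e2]] := IH b' t hs.
exists (fun i => match i return hom (nth zero (x1 :: xs) i)
  (gr_hom Y (nth d [:: b, b' & t] i) (nth d [:: b, b' & t] i.+1)) with
  | 0 => h1 | i'.+1 => hh i' end); split.
  by congr cons; rewrite -[in RHS]e1 (iotaDl 1 1) -map_comp.
apply: lheq_cons; first exact: heq_refl.
by apply: lheq_trans e2; apply: hseg_shift => // i; apply: heq_refl.
Qed.

Section Generators.
Variable x : nat -> A.
Let X := free_ecat hQ h0 x.

Lemma seg1 i : [:: x i] = seg zero x i i.+1.
Proof. by rewrite -addn1 segD. Qed.

Fixpoint free_gens i k : lhom (map x (iota i k)) (pairmap (gr_hom X) i (iota i.+1 k)) :=
  if k is k'.+1 then (lfmap Q (lcast (seg1 i)) ∘ mt_unit Q (x i), free_gens i.+1 k')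
  else tt.

Lemma free_gensE i k : lheq (free_gens i k) (lunits (mt_unit Q) (map x (iota i k))).
Proof.
elim: k i => [|k IH] i /=; first exact: lheq_refl.
by apply: lheq_cons (IH _); apply: heq_lcastl.
Qed.

Lemma iota_path i k : path leq i (iota i.+1 k).
Proof. by elim: k i => //= k IH i; rewrite leqnSn IH. Qed.

Lemma pairmap_seg_iota i k :
  pairmap (seg zero x) i (iota i.+1 k) = map (fun z => [:: z]) (map x (iota i k)).
Proof. by elim: k i => //= k IH i; rewrite IH -seg1. Qed.

(** Along unit steps, composition is substitution into singletons and the generators are units, so
    this is the right unit law of [Q]. *)
Lemma free_gens_comp i k :
  heq (ec_comp X i (iota i.+1 k) ∘ lfmap Q (free_gens i k))
      (idm (Q (map x (iota i k)))).
Proof.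
have h : heq (ec_comp X i (iota i.+1 k))
    (msub Q (map (fun z => [:: z]) (map x (iota i k)))).
  by rewrite -pairmap_seg_iota; apply: free_compE; apply: iota_path.
apply: heq_trans (heq_comp h (lheq_lfmap Q (free_gensE i k))) _.
rewrite [msub _ _ ∘ _]mt_unitr.
by apply: heq_trans (lheq_lfmap Q (lheq_cast _ (erefl _))) _; rewrite lfmap_id;
  apply: heq_refl.
Qed.

Lemma free_ext_gens (Y : ECategory Q) (y : nat -> gr_ob Y)
    (h : forall i, hom (x i) (gr_hom Y (y i) (y i.+1))) i k :
  lheq (lcomp (path_map (free_ext hQ h0 h) i (iota i.+1 k)) (free_gens i k))
       (hseg h i k).
Proof.
elim: k i => [|k IH] i /=; first exact: lheq_refl.
apply: lheq_cons (IH _); rewrite comp_assoc.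
have e : heq (free_ext_hom hQ h0 h i i.+1) (free_ext_hom hQ h0 h i (i + 1)).
  by rewrite addn1; apply: heq_refl.
have e1 := heq_trans e (free_ext_homE hQ h0 h i 1).
have e2 := heq_trans (heq_lcastr (seg1 i) (free_ext_hom hQ h0 h i i.+1)) e1.
apply: heq_trans (heq_comp e2 (heq_refl (mt_unit Q (x i)))) _.
have := nt_nat (mt_unit Q) (h i); rewrite /= => en.
rewrite -comp_assoc /lfmap -en comp_assoc ec_unit comp_idl.
exact: heq_refl.
Qed.

End Generators.

(** The interface to the free category for the uniqueness argument: the first clause makes
    composition with the generators cancellable, the second provides functors carrying the
    generators to any given maps. *)
Lemma free_exists (xs : seq A) : exists (X : ECategory Q) a s
    (eta : lhom xs (pairmap (gr_hom X) a s)),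
  heq (ec_comp X a s ∘ lfmap Q eta) (idm (Q xs)) /\
  forall (Y : ECategory Q) b t (h : lhom xs (pairmap (gr_hom Y) b t)),
  exists R : EFunctor X Y, [/\ gh_ob R a = b, map (gh_ob R) s = t
    & lheq (lcomp (path_map R a s) eta) h].
Proof.
pose x := nth zero xs.
have ex : xs = map x (iota 0 (size xs)) by rewrite -[LHS](mkseq_nth zero).
exists (free_ecat hQ h0 x), 0, (iota 1 (size xs)).
exists (lcomp (free_gens x 0 (size xs)) (lcast ex)); split.
  rewrite lfmap_comp comp_assoc; apply: heq_trans (heq_lcastr _ _) _.
  apply: heq_trans (@free_gens_comp x 0 (size xs)) _.
  by apply: heq_id; rewrite -ex.
move=> Y b t h; have [hh [e1 e2]] := lhom_nth b h.
exists (free_ext hQ h0 hh); split=> //.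
apply: lheq_trans e2; rewrite lcomp_assoc.
apply: lheq_trans (lheq_castr _ _) _; exact: free_ext_gens.
Qed.

End FreeList.

(** * Uniqueness of lifted multitensors *)

Section Restriction.
Variables (A : Category) (P Q : Multitensor A).

(** A [P]-category structure on the graph of every [Q]-category, such that
    [Q]-functors are [P]-functors. *)
Record restriction := Restriction {
  rc : forall (Y : ECategory Q) a s,
    hom (P (pairmap (gr_hom Y) a s)) (gr_hom Y a (last a s));
  rc_unit : forall (Y : ECategory Q) a b,
    rc (Y := Y) a [:: b] ∘ mt_unit P (gr_hom Y a b) = idm (gr_hom Y a b);
  rc_assoc : forall (Y : ECategory Q) a ss,
    rc a (path_targets a ss) ∘ lfmap P (lcompositions (@rc Y) a ss) =
    eq_hom (f_equal (gr_hom Y a) (last_path_targets a ss)) ∘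
      rc a (flatten ss) ∘
      lfmap P (lcast (flatten_paths_homs a ss)) ∘
      mt_sub P (paths_homs a ss);
  rc_fun : forall (Y Y' : ECategory Q) (f : EFunctor Y Y') a s,
    gh_hom f a (last a s) ∘ rc a s =
    eq_hom (f_equal (gr_hom Y' (gh_ob f a)) (last_map (gh_ob f) s a)) ∘
      rc (gh_ob f a) (map (gh_ob f) s) ∘ lfmap P (path_map f a s)
}.

Variables (hQ : mt_distributive Q) (zero : A) (h0 : initial zero).
Variable r : restriction.

(** A Yoneda argument: [phi] is the [P]-composite of the generators of the free [Q]-category on
    [xs]. Any [h] is the image of the generators under a [Q]-functor [R], and [R] respects both
    compositions. *)
Lemma restriction_map (xs : seq A) : exists phi : hom (P xs) (Q xs),
  forall (Y : ECategory Q) a s (h : lhom xs (pairmap (gr_hom Y) a s)),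
    rc r a s ∘ lfmap P h = ec_comp Y a s ∘ lfmap Q h ∘ phi.
Proof.
have [X [a0 [s0 [eta [hX uX]]]]] := free_exists hQ h0 xs.
have [p [q _]] := hX.
exists (eq_hom q ∘ rc r a0 s0 ∘ lfmap P eta) => Y b t h.
have [R [eb et eh]] := uX Y b t h; subst b t; rewrite -(lheq_eq eh).
apply: (@eq_hom_mono _ _ _ _
  (f_equal (gr_hom Y (gh_ob R a0)) (last_map (gh_ob R) s0 a0))).
rewrite !lfmap_comp !comp_assoc -rc_fun -ef_comp.
have e : ec_comp X a0 s0 ∘ lfmap Q eta ∘ eq_hom q = idm _.
  by apply: heq_eq; apply: heq_trans (heq_idr _ _) _;
    apply: heq_trans hX _; apply: heq_id.
by rewrite -(comp_assoc _ (ec_comp X a0 s0)) -(comp_assoc _ (ec_comp X a0 s0 ∘ _))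
  e comp_idr.
Qed.

Definition restriction_phi xs :=
  proj1_sig (constructive_indefinite_description _ (restriction_map xs)).

Lemma restriction_phiE (Y : ECategory Q) a s xs
    (h : lhom xs (pairmap (gr_hom Y) a s)) :
  rc r a s ∘ lfmap P h = ec_comp Y a s ∘ lfmap Q h ∘ restriction_phi xs.
Proof.
rewrite /restriction_phi; case: constructive_indefinite_description => phi /=.
exact.
Qed.

(** Equations between maps into [Q ys] are tested by composing with the generators of the free
    category on [ys]: [restriction_phiE] then trades [restriction_phi] for a [P]-composite. The unit
    and substitution laws below are tested in the same way. *)
Lemma restriction_nat xs ys (f : lhom xs ys) :
  restriction_phi ys ∘ lfmap P f = lfmap Q f ∘ restriction_phi xs.
Proof.
have [X [a [s [eta [hX _]]]]] := free_exists hQ h0 ys.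
apply: (heq_id_mono hX); rewrite !comp_assoc -restriction_phiE.
by rewrite -comp_assoc -lfmap_comp restriction_phiE lfmap_comp comp_assoc.
Qed.

Lemma restriction_unit x :
  restriction_phi [:: x] ∘ mt_unit P x = mt_unit Q x.
Proof.
(* A [lhom] exists only between sequences of equal length, so the path has exactly one edge and the
   unit laws of both structures apply. *)
have [X [a [[|b [|c s]] [eta [hX _]]]]] := free_exists hQ h0 [:: x];
  try by case: eta {hX} => // ? [].
apply: (heq_id_mono hX); rewrite comp_assoc -restriction_phiE.
case: eta {hX} => eta []; rewrite -!comp_assoc.
have := nt_nat (mt_unit P) eta; rewrite /= /lfmap => <-.
have := nt_nat (mt_unit Q) eta; rewrite /= /lfmap => <-.
by rewrite !comp_assoc rc_unit ec_unit.
Qed.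

Lemma lhom_split (X : Graph A) xs zs a s (h : lhom (xs ++ zs) (pairmap (gr_hom X) a s)) :
  exists s1 s2 (h1 : lhom xs (pairmap (gr_hom X) a s1))
     (h2 : lhom zs (pairmap (gr_hom X) (last a s1) s2)),
     s = s1 ++ s2 /\ lheq (lcat h1 h2) h.
Proof.
elim: xs a s h => [|x xs IH] a s h /=.
  by exists [::], s, tt, h; split=> //; apply: lheq_refl.
case: s h => [|b s] //= [h hs]; have [s1 [s2 [h1 [h2 [es e]]]]] := IH _ _ hs.
exists (b :: s1), s2, (h, h1), h2; split; first by rewrite es.
apply: lheq_cons => //.
exact: heq_refl.
Qed.

Lemma lhom_splits (X : Graph A) xss a s
    (h : lhom (flatten xss) (pairmap (gr_hom X) a s)) :
  exists ss (hs : @lhom (SeqCat A) xss (paths_homs a ss)),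
     s = flatten ss /\ lheq (lflatten hs) h.
Proof.
elim: xss a s h => [|xs xss IH] a s h /=.
  case: s h => //= h; exists [::], tt; split=> //; case: h; exact: lheq_refl.
have [s1 [s2 [h1 [h2 [es e]]]]] := lhom_split h.
have [ss [hs [e1 e2]]] := IH _ _ h2.
exists (s1 :: ss), (h1, hs); split; first by rewrite es /= e1.
by apply: lheq_trans e; apply: lheq_cat => //; apply: lheq_refl.
Qed.

Lemma restriction_compositions (X : ECategory Q) a ss xss
    (hs : @lhom (SeqCat A) xss (paths_homs a ss)) :
  lcomp (lcompositions (rc r (Y := X)) a ss) (lmap P hs) =
  lcomp (lcomp (lcompositions (ec_comp X) a ss) (lmap Q hs))
    (lnats restriction_phi xss).
Proof.
elim: ss a xss hs => [|s ss IH] a [|xs xss] //= [h hs] /=.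
by rewrite IH; congr pair; apply: restriction_phiE.
Qed.

Lemma restriction_sub xss :
  restriction_phi (flatten xss) ∘ mt_sub P xss =
  mt_sub Q xss ∘ lfmap Q (lnats restriction_phi xss) ∘ restriction_phi (map P xss).
Proof.
have [X [a [s [eta [hX _]]]]] := free_exists hQ h0 (flatten xss).
(* Cutting the path of generators along the blocks of [xss] brings both sides into the form required
   by associativity, once for [P] and once for [Q]. *)
have [ss [hs [es eh]]] := lhom_splits eta; subst s.
apply: (heq_id_mono hX); rewrite !comp_assoc -restriction_phiE.
have {eh} -> : eta = lcomp (lcast (flatten_paths_homs a ss)) (lflatten hs).
  apply: lheq_eq; apply: lheq_trans (lheq_sym eh) _.
  exact/lheq_sym/lheq_castl.
apply: (@eq_hom_mono _ _ _ _ (f_equal (gr_hom X a) (last_path_targets a ss))).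
rewrite !lfmap_comp -!comp_assoc.
rewrite [X in _ ∘ (_ ∘ (_ ∘ X))](esym (msub_nat P hs)).
have nQ := msub_nat Q hs; rewrite /msub in nQ.
rewrite [lfmap Q (lflatten hs) ∘ (_ ∘ _)]comp_assoc -nQ.
have eP := rc_assoc r a ss; have eQ := ec_assoc X a ss.
rewrite !comp_assoc in eP eQ *.
rewrite /msub -eP -eQ.
rewrite -!comp_assoc.
have e3 := esym (lfmap_comp P (lcompositions (rc r (Y := X)) a ss) (lmap P hs)).
apply: etrans (f_equal (compm (rc r a (path_targets a ss))) e3) _.
by rewrite restriction_compositions restriction_phiE !lfmap_comp !comp_assoc.
Qed.

Definition restriction_hom : MultitensorHom P Q :=
  @MkMultitensorHom A P Q
    (@MkNatTrans _ _ P Q restriction_phi restriction_nat)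
    restriction_unit restriction_sub.

End Restriction.

(** * Moving a category structure along an equality of graphs *)

Section CastComp.
Variables (A : Category) (P : Multitensor A).

(** A functor over graphs preserves the graph only up to a propositional equality, whereas a
    [restriction] lives on the given graph itself. *)
Definition cast_comp (Z : ECategory P) (g : Graph A) (e : ec_graph Z = g) :=
  eq_rect _ (fun g : Graph A => forall a s,
    hom (P (pairmap (gr_hom g) a s)) (gr_hom g a (last a s))) (ec_comp Z) _ e.

Lemma cast_comp_unit (Z : ECategory P) g (e : ec_graph Z = g) a b :
  cast_comp e a [:: b] ∘ mt_unit P (gr_hom g a b) = idm (gr_hom g a b).
Proof. by case: g / e a b; apply: ec_unit. Qed.

Lemma cast_comp_assoc (Z : ECategory P) g (e : ec_graph Z = g) a ss :
  cast_comp e a (path_targets a ss) ∘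
    lfmap P (lcompositions (cast_comp e) a ss) =
  eq_hom (f_equal (gr_hom g a) (last_path_targets a ss)) ∘
    cast_comp e a (flatten ss) ∘
    lfmap P (lcast (flatten_paths_homs a ss)) ∘ mt_sub P (paths_homs a ss).
Proof. by case: g / e a ss; apply: ec_assoc. Qed.

Definition cast_ecat (Z : ECategory P) g (e : ec_graph Z = g) : ECategory P :=
  @MkECategory A P g (cast_comp e) (cast_comp_unit e) (cast_comp_assoc e).

Lemma cast_ecat_eq (Z : ECategory P) g (e : ec_graph Z = g) : cast_ecat e = Z.
Proof.
case: g / e; rewrite /cast_ecat; case: Z => g c u h /=.
by f_equal; apply: proof_irrelevance.
Qed.

Lemma cast_comp_id (Z Y : ECategory P) (e : ec_graph Z = ec_graph Y) :
  Z = Y -> cast_comp e = ec_comp Y.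
Proof. by move=> eZ; subst Y; rewrite (proof_irrelevance _ e erefl). Qed.

Lemma cast_comp_fun (Z Z' : ECategory P) g g' (e : ec_graph Z = g)
    (e' : ec_graph Z' = g') (R : EFunctor Z Z') (f : GraphHom g g') :
  @heq (GraphCat A) _ _ _ _ (ef_graph R) f -> forall a s,
  gh_hom f a (last a s) ∘ cast_comp e a s =
  eq_hom (f_equal (gr_hom g' (gh_ob f a)) (last_map (gh_ob f) s a)) ∘
    cast_comp e' (gh_ob f a) (map (gh_ob f) s) ∘ lfmap P (path_map f a s).
Proof.
case: g / e f; case: g' / e' => f /(@heq_eq (GraphCat A)) <- a s.
exact: ef_comp.
Qed.

End CastComp.

Lemma functor_eq_heq (C D : Category) (F G : Functor C D) (x y : C) (f : hom x y) :
  F = G -> heq (fmap F f) (fmap G f).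
Proof. by move=> ->; apply: heq_refl. Qed.

Section FunctorRestriction.
Variables (A : Category) (P Q : Multitensor A).
Variables (Psi : Functor (ECat Q) (ECat P)).
Hypothesis hPsi : ecat_graph P ⊚ Psi = ecat_graph Q.

Lemma graph_over (Y : ECategory Q) : ec_graph (Psi Y) = ec_graph Y.
Proof. exact: (f_equal (fun G : Functor (ECat Q) (GraphCat A) => G Y) hPsi). Qed.

Definition functor_restriction : restriction P Q.
Proof.
refine (@Restriction A P Q (fun Y => cast_comp (graph_over Y)) _ _ _).
- by move=> Y a b; apply: cast_comp_unit.
- by move=> Y a ss; apply: cast_comp_assoc.
- move=> Y Y' f a s; apply: (@cast_comp_fun A P _ _ _ _ _ _ (fmap Psi f)).
  exact: (@functor_eq_heq (ECat Q) (GraphCat A) _ _ Y Y' f hPsi).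
Defined.

End FunctorRestriction.

Lemma restriction_inverse (A : Category) (P Q : Multitensor A) (zero : A)
    (h0 : initial zero) (hP : mt_distributive P) (hQ : mt_distributive Q)
    (Psi : Functor (ECat Q) (ECat P)) (Phi : Functor (ECat P) (ECat Q))
    (hPsi : ecat_graph P ⊚ Psi = ecat_graph Q)
    (hPhi : ecat_graph Q ⊚ Phi = ecat_graph P) xs :
  Phi ⊚ Psi = functor_id _ ->
  restriction_hom hQ h0 (functor_restriction hPsi) xs ∘
    restriction_hom hP h0 (functor_restriction hPhi) xs = idm (Q xs).
Proof.
move=> hK; rewrite /=.
have [X [a [s [eta [hX _]]]]] := free_exists hQ h0 xs.
apply: (heq_id_mono hX); rewrite comp_idr comp_assoc -restriction_phiE /=.
(* [X'] is [Psi X] placed on the graph of [X], so that [eta] is literally a map into its homs.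
   Applying [Phi] to it gives [X] back, so the second restriction recovers the original
   [Q]-composition. *)
pose X' := cast_ecat (graph_over hPsi X).
have /= e := @restriction_phiE A Q P hP zero h0 (functor_restriction hPhi) X' a s xs eta.
rewrite -e; congr (_ ∘ _).
have hX' : Phi X' = X.
  rewrite /X' cast_ecat_eq.
  exact: (f_equal (fun G : Functor (ECat Q) (ECat Q) => G X) hK).
by rewrite (@cast_comp_id A Q (Phi X') X (graph_over hPhi X') hX').
Qed.

Theorem multitensor_iso_of_ecat (A : Category) (P Q : Multitensor A) (zero : A) :
  initial zero -> mt_distributive P -> mt_distributive Q ->
  (exists Phi : CatIso (ECat P) (ECat Q), ecat_graph Q ⊚ Phi = ecat_graph P) ->
  multitensor_iso P Q.
Proof.
move=> h0 hP hQ [[Phi [Psi hK hK']] /= hPhi].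
have hPsi : ecat_graph P ⊚ Psi = ecat_graph Q.
  rewrite -hPhi; transitivity (ecat_graph Q ⊚ (Phi ⊚ Psi)).
    exact: functor_ext.
  by rewrite hK'; apply: functor_ext.
exists (restriction_hom hQ h0 (functor_restriction hPsi)).
exists (restriction_hom hP h0 (functor_restriction hPhi)) => xs.
by split; apply: restriction_inverse.
Qed.

(** * Categories over the algebras of the unary part *)

Lemma functor_eq (C D : Category) (F G : Functor C D) :
  (forall x, F x = G x) -> (forall x y (f : hom x y), heq (fmap F f) (fmap G f)) ->
  F = G.
Proof.
case: F G => [f m i c] [f' m' i' c'] /= eo em.
have e : f = f' by apply: functional_extensionality.
subst f'; apply: functor_ext => x y h; exact: heq_eq.
Qed.

Section Invertible.
Variables (C D : Category) (K : Functor C D).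

Lemma invertible_ob (hK : invertible K) x : inverse hK (K x) = x.
Proof. exact: (f_equal (fun G : Functor C C => G x) (inverseK hK)). Qed.

Lemma invertible_inv_ob (hK : invertible K) y : K (inverse hK y) = y.
Proof. exact: (f_equal (fun G : Functor D D => G y) (Kinverse hK)). Qed.

Lemma invertible_map (hK : invertible K) x y (f : hom x y) :
  heq (fmap (inverse hK) (fmap K f)) f.
Proof. exact: (functor_eq_heq f (inverseK hK)). Qed.

Lemma invertible_inv_map (hK : invertible K) x y (f : hom x y) :
  heq (fmap K (fmap (inverse hK) f)) f.
Proof. exact: (functor_eq_heq f (Kinverse hK)). Qed.

Lemma invertible_faithful (hK : invertible K) x y (f g : hom x y) :
  fmap K f = fmap K g -> f = g.
Proof.
move=> e; apply: heq_eq; apply: heq_trans (heq_sym (invertible_map hK f)) _.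
by rewrite e; apply: invertible_map.
Qed.

Lemma invertible_full (hK : invertible K) x y (g : hom (K x) (K y)) :
  exists f, fmap K f = g.
Proof.
exists (eq_hom (invertible_ob hK y) ∘ fmap (inverse hK) g ∘
        eq_hom (esym (invertible_ob hK x))).
apply: heq_eq; apply: heq_trans (invertible_inv_map hK g).
apply: heq_fmap; apply: heq_trans (heq_idr _ _) _; exact: heq_idl.
Qed.

Hypothesis faithful : forall x y (f g : hom x y), fmap K f = fmap K g -> f = g.
Hypothesis full : forall x y (g : hom (K x) (K y)), exists f, fmap K f = g.
Hypothesis inj : forall x y, K x = K y -> x = y.
Hypothesis surj : forall y, exists x, K x = y.

Let inv_ob y := proj1_sig (constructive_indefinite_description _ (surj y)).
Let inv_obK y : K (inv_ob y) = y.
Proof. by rewrite /inv_ob; case: constructive_indefinite_description. Qed.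

Let inv_hom x y (f : hom x y) := proj1_sig (constructive_indefinite_description _
  (full (eq_hom (esym (inv_obK y)) ∘ f ∘ eq_hom (inv_obK x)))).
Let inv_homK x y (f : hom x y) : heq (fmap K (inv_hom f)) f.
Proof.
rewrite /inv_hom; case: constructive_indefinite_description => g /= ->.
apply: heq_trans (heq_idr _ _) _; exact: heq_idl.
Qed.

Let inv_id x : inv_hom (idm x) = idm (inv_ob x).
Proof.
apply: faithful; apply: heq_eq; apply: heq_trans (inv_homK _) _.
by rewrite fmap_id; apply: heq_id; rewrite inv_obK.
Qed.

Let inv_comp x y z (g : hom y z) (f : hom x y) :
  inv_hom (g ∘ f) = inv_hom g ∘ inv_hom f.
Proof.
apply: faithful; apply: heq_eq; apply: heq_trans (inv_homK _) _.
by rewrite fmap_comp; apply: heq_sym; apply: heq_comp.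
Qed.

(** Isomorphisms of categories are strict here, hence bijectivity on objects besides full
    faithfulness. The preimages are chosen; faithfulness makes the choice functorial. *)
Lemma bijective_ff_invertible : invertible K.
Proof.
pose G := @MkFunctor D C inv_ob inv_hom inv_id inv_comp.
have e x : G (K x) = x by apply: inj; apply: inv_obK.
apply: (@Invertible C D K G); apply: functor_eq => //=.
move=> x y f.
have ef : eq_hom (e y) ∘ fmap G (fmap K f) ∘ eq_hom (esym (e x)) = f.
  apply: faithful; apply: heq_eq; apply: heq_trans (inv_homK _).
  by apply: heq_fmap; apply: heq_trans (heq_idr _ _) (heq_idl _ _).
rewrite -[X in heq _ X]ef.
by apply: heq_sym; apply: heq_trans (heq_idr _ _) (heq_idl _ _).
Qed.

End Invertible.

Definition forget (W : Category) (M : Monad W) : Functor (EM M) W :=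
  @MkFunctor (EM M) W (@alg_ob W M) (fun _ _ f => alg_hom f)
    (fun _ => erefl) (fun _ _ _ _ _ => erefl).

Lemma algebra_eq (W : Category) (M : Monad W) (x : Algebra M)
    (a : hom (M (alg_ob x)) (alg_ob x)) u h :
  a = alg_act x -> @MkAlgebra W M (alg_ob x) a u h = x.
Proof.
case: x a u h => w b u' h' /= a u h e; subst a.
by f_equal; apply: proof_irrelevance.
Qed.

Lemma alg_hom_heq (W : Category) (M : Monad W) (a b a' b' : EM M)
    (f : hom a b) (f' : hom a' b') :
  a = a' -> b = b' -> heq (alg_hom f) (alg_hom f') -> heq f f'.
Proof.
move=> ea eb; subst a' b' => /heq_eq e; apply: eq_heq; exact: alg_hom_ext.
Qed.

Lemma graph_hom_heq (A : Category) (o o' : SmallType) (h k : o -> o -> A)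
    (h' k' : o' -> o' -> A) (f : o -> o')
    (g : forall a b, hom (h a b) (h' (f a) (f b)))
    (g' : forall a b, hom (k a b) (k' (f a) (f b))) :
  (forall a b, h a b = k a b) -> (forall a b, h' a b = k' a b) ->
  (forall a b, heq (g a b) (g' a b)) ->
  @heq (GraphCat A) (MkGraph h) (MkGraph h') (MkGraph k) (MkGraph k')
    (@MkGraphHom A (MkGraph h) (MkGraph h') f g)
    (@MkGraphHom A (MkGraph k) (MkGraph k') f g').
Proof.
move=> e e'.
have ? : h = k by do 2![apply: functional_extensionality => ?].
have ? : h' = k' by do 2![apply: functional_extensionality => ?].
subst k k' => eg; apply: eq_heq; apply: graph_hom_ext => a b; exact: heq_eq.
Qed.

Lemma ecategory_eq (V : Category) (E : Multitensor V) (g : Graph V) c c' u u' h h' :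
  (forall a s, c a s = c' a s) ->
  @MkECategory V E g c u h = @MkECategory V E g c' u' h'.
Proof.
move=> e; have ? : c = c' by do 2![apply: functional_extensionality_dep => ?].
by subst c'; f_equal; apply: proof_irrelevance.
Qed.

(** * Identifying [T]-categories with [D]-categories by a universal family [theta] *)

Section Lift.
Variables (W : Category) (D : Multitensor W).
Let M := mt_monad D.
Let A := EM M.
Let G : Functor A W := forget M.
Variable T : Multitensor A.

Variable theta : forall xs : seq A, hom (D (map G xs)) (G (T xs)).

Fixpoint lthetas (xss : seq (seq A)) :
    lhom (map D (map (map G) xss)) (map G (map T xss)) :=
  if xss is xs :: xss' then (theta xs, lthetas xss') else tt.

Fixpoint lacts (xs : seq A) :
    lhom (map D (map (fun x => [:: x]) (map G xs))) (map G xs) :=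
  if xs is x :: xs' then (alg_act x, lacts xs') else tt.

Hypothesis theta_nat : forall xs ys (f : lhom xs ys),
  theta ys ∘ lfmap D (lmap G f) = fmap G (lfmap T f) ∘ theta xs.
Hypothesis theta_sub : forall xss : seq (seq A),
  fmap G (msub T xss) ∘ theta (map T xss) ∘ lfmap D (lthetas xss) =
  theta (flatten xss) ∘ lfmap D (lcast (flatten_map_map G xss)) ∘
    msub D (map (map G) xss).
Hypothesis theta_act : forall x : A,
  theta [:: x] = fmap G (mt_unit T x) ∘ alg_act x.
(** [c] has the two properties of a composition map that involve unary
    compositions: it is a map of algebras, and it is insensitive to acting on
    its arguments or substituting into them. *)
Hypothesis theta_fact : forall xs (y : A) (c : hom (D (map G xs)) (G y)),
  c ∘ lfmap D (lcast (flatten1 (map G xs))) ∘ msub D [:: map G xs] =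
    alg_act y ∘ @lfmap _ _ D [:: _] [:: _] (c, tt) ->
  c ∘ lfmap D (lacts xs) =
    c ∘ lfmap D (lcast (flatten_singletons (map G xs))) ∘
      msub D (map (fun x => [:: x]) (map G xs)) ->
  exists c' : hom (T xs) y, fmap G c' ∘ theta xs = c.
Hypothesis theta_epi : forall xs (y : A) (c c' : hom (T xs) y),
  fmap G c ∘ theta xs = fmap G c' ∘ theta xs -> c = c'.
(** Needed to bring associativity back from [D] to [T]: in [D] the law is an equation on nested
    sequences of underlying objects. *)
Hypothesis theta_epi2 : forall xss (y : A) (c c' : hom (T (map T xss)) y),
  fmap G c ∘ theta (map T xss) ∘ lfmap D (lthetas xss) =
  fmap G c' ∘ theta (map T xss) ∘ lfmap D (lthetas xss) -> c = c'.

Definition under_graph (X : Graph A) : Graph W :=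
  MkGraph (fun a b => G (gr_hom X a b)).

Lemma pairmap_under (X : Graph A) a s :
  pairmap (gr_hom (under_graph X)) a s = map G (pairmap (gr_hom X) a s).
Proof. by elim: s a => //= b s IH a; rewrite IH. Qed.

Lemma paths_homs_under (X : Graph A) a ss :
  paths_homs (X := under_graph X) a ss = map (map G) (paths_homs (X := X) a ss).
Proof. by elim: ss a => //= s ss IH a; rewrite IH (pairmap_under a s). Qed.

Lemma path_targets_under (X : Graph A) a ss :
  path_targets (X := under_graph X) a ss = path_targets (X := X) a ss.
Proof. by elim: ss a => //= s ss IH a; rewrite IH. Qed.

Section UnderComp.
Variables (X : Graph A).
Variable c : forall a s, hom (T (pairmap (gr_hom X) a s)) (gr_hom X a (last a s)).

Definition under_comp a s : hom (D (pairmap (gr_hom (under_graph X)) a s))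
    (gr_hom (under_graph X) a (last a s)) :=
  fmap G (c a s) ∘ theta _ ∘ lfmap D (lcast (pairmap_under a s)).

Lemma under_compE a s : heq (under_comp a s) (fmap G (c a s) ∘ theta _).
Proof. exact: heq_lcastr. Qed.

Lemma under_compositions (a : gr_ob X) (ss : seq (seq (gr_ob X))) :
  lheq (lcompositions (X := under_graph X) under_comp a ss)
    (lcomp (lmap G (lcompositions (X := X) c a ss)) (lthetas (paths_homs (X := X) a ss))).
Proof.
elim: ss a => [|s ss IH] a /=; first exact: lheq_refl.
apply: lheq_cons (IH _); exact: under_compE.
Qed.

(** Unary composition in the underlying [D]-category is the action on the hom, so that passing to
    algebras recovers the original graph over [A]. *)
Lemma under_comp1 a b : 
  c a [:: b] ∘ mt_unit T (gr_hom X a b) = idm (gr_hom X a b) ->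
  under_comp a [:: b] = alg_act (gr_hom X a b).
Proof.
move=> hc; rewrite /under_comp lcast_id lfmap_id comp_idr theta_act.
rewrite comp_assoc -[_ ∘ fmap G _](fmap_comp G (c a [:: b]) (mt_unit T _)).
by rewrite hc fmap_id comp_idl.
Qed.

(** Together with [under_comp_sub], this writes the two sides of associativity in [D] as those of
    associativity in [T], preceded by two layers of [theta]. The law thus passes from [T] to [D],
    and from [D] to [T] by [theta_epi2]. *)
Lemma under_compositions_theta (a : gr_ob X) (ss : seq (seq (gr_ob X))) :
  heq (under_comp a (path_targets (X := X) a ss) ∘
        lfmap D (lcompositions (X := under_graph X) under_comp a ss))
      (fmap G (c a (path_targets (X := X) a ss) ∘ lfmap T (lcompositions (X := X) c a ss)) ∘
        theta (map T (paths_homs (X := X) a ss)) ∘ lfmap D (lthetas (paths_homs (X := X) a ss))).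
Proof.
have e1 : heq (under_comp a (path_targets (X := under_graph X) a ss))
              (fmap G (c a (path_targets (X := X) a ss)) ∘ theta _).
  rewrite path_targets_under; exact: under_compE.
apply: heq_trans (heq_comp e1 (lheq_lfmap D (under_compositions a ss))) _.
rewrite lfmap_comp comp_assoc -[_ ∘ theta _ ∘ lfmap D (lmap _ _)]comp_assoc.
by rewrite theta_nat fmap_comp !comp_assoc; apply: heq_refl.
Qed.

Lemma under_comp_sub (a : gr_ob X) (ss : seq (seq (gr_ob X))) :
  heq (eq_hom (f_equal (gr_hom (under_graph X) a)
         (last_path_targets (X := under_graph X) a ss)) ∘
       under_comp a (flatten ss) ∘
       lfmap D (lcast (flatten_paths_homs (X := under_graph X) a ss)) ∘
       mt_sub D (paths_homs (X := under_graph X) a ss))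
      (fmap G (eq_hom (f_equal (gr_hom X a) (last_path_targets (X := X) a ss)) ∘
          c a (flatten ss) ∘ lfmap T (lcast (flatten_paths_homs (X := X) a ss)) ∘
          mt_sub T (paths_homs (X := X) a ss)) ∘
        theta (map T (paths_homs (X := X) a ss)) ∘ lfmap D (lthetas (paths_homs (X := X) a ss))).
Proof.
rewrite -[X in heq X _]comp_assoc -[X in heq X _]comp_assoc.
apply: heq_trans (heq_idl _ _) _.
rewrite fmap_comp -[X in heq _ (X ∘ _)]comp_assoc -[X in heq _ X]comp_assoc theta_sub.
rewrite -comp_assoc [in X in heq _ X]fmap_comp.
have hL : heq (fmap G (eq_hom (f_equal (gr_hom X a) (last_path_targets (X := X) a ss)) ∘
          c a (flatten ss))) (fmap G (c a (flatten ss))).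
  by apply: heq_fmap; apply: heq_idl.
have hT : heq (fmap G (lfmap T (lcast (flatten_paths_homs (X := X) a ss))) ∘
    theta (flatten (paths_homs (X := X) a ss))) (theta (pairmap (gr_hom X) a (flatten ss))).
  rewrite -theta_nat.
  have p := f_equal (map G) (flatten_paths_homs (X := X) a ss).
  by rewrite (lmap_cast _ p); apply: heq_lcastr.
rewrite !comp_assoc -[X in heq _ (X ∘ _ ∘ _)]comp_assoc.
apply: heq_lmid; last by rewrite paths_homs_under; apply: heq_refl.
apply: heq_trans (under_compE _ _) _; apply: heq_sym.
exact: heq_comp hL hT.
Qed.

End UnderComp.
Lemma under_unit (X : ECategory T) a b :
  under_comp (ec_comp X) a [:: b] ∘ mt_unit D (G (gr_hom X a b)) =
  idm (G (gr_hom X a b)).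
Proof. rewrite under_comp1 ?ec_unit //; exact: (alg_unit (gr_hom X a b)). Qed.

Lemma under_assoc (X : ECategory T) (a : gr_ob X) ss :
  under_comp (ec_comp X) a (path_targets (X := under_graph X) a ss) ∘
    lfmap D (lcompositions (X := under_graph X) (under_comp (ec_comp X)) a ss) =
  eq_hom (f_equal (gr_hom (under_graph X) a)
      (last_path_targets (X := under_graph X) a ss)) ∘
    under_comp (ec_comp X) a (flatten ss) ∘
    lfmap D (lcast (flatten_paths_homs (X := under_graph X) a ss)) ∘
    mt_sub D (paths_homs (X := under_graph X) a ss).
Proof.
apply: heq_eq; apply: heq_trans (under_compositions_theta _ _ _) _.
apply: heq_trans (heq_sym (under_comp_sub (ec_comp X) a ss)).
by rewrite ec_assoc; apply: heq_refl.
Qed.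

Definition under (X : ECategory T) : ECategory D :=
  @MkECategory W D (under_graph X) (under_comp (ec_comp X))
    (@under_unit X) (@under_assoc X).

Definition under_graph_hom (X Y : Graph A) (f : GraphHom X Y) :
    GraphHom (under_graph X) (under_graph Y) :=
  @MkGraphHom W (under_graph X) (under_graph Y) (gh_ob f)
    (fun a b => fmap G (gh_hom f a b)).

Lemma path_map_under (X Y : Graph A) (f : GraphHom X Y) a s :
  lheq (path_map (under_graph_hom f) a s) (lmap G (path_map f a s)).
Proof.
elim: s a => [|b s IH] a /=; first exact: lheq_refl.
by apply: lheq_cons (IH _); apply: heq_refl.
Qed.

(** The functor law is handled like associativity: here and in [under_comp_mapr] its two sides in
    [D] are those in [T] preceded by [theta]. This gives functoriality of [under], and fullness by
    [theta_epi]. *)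
Lemma under_comp_mapl (X Y : ECategory T) (f : GraphHom X Y) (a : gr_ob X) s :
  heq (gh_hom (under_graph_hom f) a (last a s) ∘ under_comp (ec_comp X) a s)
      (fmap G (gh_hom f a (last a s) ∘ ec_comp X a s) ∘
        theta (pairmap (gr_hom X) a s)).
Proof.
rewrite fmap_comp -comp_assoc; apply: heq_comp; first exact: heq_refl.
exact: under_compE.
Qed.

Lemma under_comp_mapr (X Y : ECategory T) (f : GraphHom X Y) (a : gr_ob X) s :
  heq (eq_hom (f_equal (gr_hom (under_graph Y) (gh_ob f a))
        (last_map (gh_ob f) s a)) ∘
       under_comp (ec_comp Y) (gh_ob f a) (map (gh_ob f) s) ∘
       lfmap D (path_map (under_graph_hom f) a s))
      (fmap G (eq_hom (f_equal (gr_hom Y (gh_ob f a)) (last_map (gh_ob f) s a)) ∘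
         ec_comp Y (gh_ob f a) (map (gh_ob f) s) ∘ lfmap T (path_map f a s)) ∘
        theta (pairmap (gr_hom X) a s)).
Proof.
rewrite -[X in heq X _]comp_assoc; apply: heq_trans (heq_idl _ _) _.
rewrite fmap_comp -[X in heq _ X]comp_assoc -theta_nat comp_assoc.
apply: heq_comp; last exact/lheq_lfmap/path_map_under.
apply: heq_trans (under_compE _ _ _) _; apply: heq_comp; last exact: heq_refl.
by apply: heq_fmap; apply/heq_sym/heq_idl.
Qed.

Lemma under_graph_hom_comp (X Y : ECategory T) (f : EFunctor X Y) a s :
  gh_hom (under_graph_hom f) a (last a s) ∘ under_comp (ec_comp X) a s =
  eq_hom (f_equal (gr_hom (under_graph Y) (gh_ob f a)) (last_map (gh_ob f) s a)) ∘
    under_comp (ec_comp Y) (gh_ob f a) (map (gh_ob f) s) ∘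
    lfmap D (path_map (under_graph_hom f) a s).
Proof.
apply: heq_eq; apply: heq_trans (under_comp_mapl _ _ _) _.
apply: heq_trans (heq_sym (under_comp_mapr f a s)).
by rewrite ef_comp; apply: heq_refl.
Qed.

Definition under_map (X Y : ECategory T) (f : EFunctor X Y) :
    EFunctor (under X) (under Y) :=
  @MkEFunctor W D (under X) (under Y) (under_graph_hom f)
    (@under_graph_hom_comp X Y f).

Definition under_functor : Functor (ECat T) (ECat D).
Proof.
refine (@MkFunctor (ECat T) (ECat D) under under_map _ _).
- by move=> X; apply: efunctor_ext; apply: graph_hom_ext.
- by move=> X Y Z g f; apply: efunctor_ext; apply: graph_hom_ext.
Defined.

Lemma under_algebra (X : ECategory T) a b :
  gr_hom (ecat_algebra_graph (under X)) a b = gr_hom X a b.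
Proof.
apply: algebra_eq; exact: under_comp1 (ec_unit X a b).
Qed.

Lemma under_functor_over : ecat_algebras D ⊚ under_functor = ecat_graph T.
Proof.
apply: functor_eq => [X|X Y f] /=.
  have e := @under_algebra X; case: X e => [[o h] c u l] /= e.
  by congr MkGraph; do 2![apply: functional_extensionality => ?]; apply: e.
have e := @under_algebra X; have e' := @under_algebra Y.
rewrite /ecat_algebra_graph.
case: f => [[f g] h]; case: X e f g h => [[o k] c u l] /= e.
case: Y e' => [[o' k'] c' u' l'] /= e' f g h.
apply: graph_hom_heq => // a b.
by apply: alg_hom_heq => //; apply: heq_refl.
Qed.

Lemma under_graph_heq (X Y : ECat T) (f : hom X Y) :
  @heq (GraphCat A) _ _ _ _ (fmap (ecat_algebras D) (fmap under_functor f))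
    (ef_graph f).
Proof. exact: (functor_eq_heq f under_functor_over). Qed.

Lemma under_faithful (X Y : ECat T) (f g : hom X Y) :
  fmap under_functor f = fmap under_functor g -> f = g.
Proof.
move=> e; apply: efunctor_ext; apply: (@heq_eq (GraphCat A)).
apply: (@heq_trans (GraphCat A)) (@heq_sym (GraphCat A) _ _ _ _ _ _ (under_graph_heq f)) _.
rewrite e; exact: under_graph_heq.
Qed.

Lemma under_inj (X Y : ECat T) : under_functor X = under_functor Y -> X = Y.
Proof.
move=> e.
have eg : ec_graph X = ec_graph Y.
  have eo (Z : ECat T) := f_equal (fun H : Functor (ECat T) (GraphCat A) => H Z)
    under_functor_over.
  exact: etrans (esym (eo X)) (etrans (f_equal (ecat_algebras D) e) (eo Y)).
case: X Y e eg => [g c u l] [g' c' u' l'] /= e eg; subst g'.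
apply: ecategory_eq => a s; apply: theta_epi.
(* The two [D]-categories share their graph, so their equality yields equality of composition maps
   by a transport along [erefl]. *)
have := @cast_comp_id W D (under (MkECategory u l)) (under (MkECategory u' l'))
  erefl e; rewrite /cast_comp /=.
move/(f_equal (fun k => k a s)); rewrite /under_comp => /(f_equal (fun k => k ∘
  lfmap D (lcast (esym (pairmap_under (X := g) a s))))).
rewrite -!comp_assoc -!lfmap_comp lcast_comp lcast_id lfmap_id !comp_idr.
exact.
Qed.

Lemma under_full (X Y : ECat T) (g : hom (under_functor X) (under_functor Y)) :
  exists f, fmap under_functor f = g.
Proof.
case: g => [[go g] /= gP].
(* At a path of length one, the law of a [D]-functor says that the map on homs is a map of
   algebras. *)
have hg a b : g a b ∘ alg_act (gr_hom X a b) =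
    alg_act (gr_hom Y (go a) (go b)) ∘ fmap M (g a b).
  have := gP a [:: b]; rewrite eq_hom_id comp_idl /=.
  by rewrite !under_comp1 ?ec_unit.
pose f : GraphHom (ec_graph X) (ec_graph Y) :=
  @MkGraphHom A _ _ go (fun a b => MkAlgHom (hg a b)).
have hf a s : gh_hom f a (last a s) ∘ ec_comp X a s =
    eq_hom (f_equal (gr_hom Y (gh_ob f a)) (last_map (gh_ob f) s a)) ∘
    ec_comp Y (gh_ob f a) (map (gh_ob f) s) ∘ lfmap T (path_map f a s).
  apply: theta_epi; apply: heq_eq.
  apply: heq_trans (heq_sym (under_comp_mapl f a s)) _.
  apply: heq_trans (under_comp_mapr f a s); apply: eq_heq.
  exact: gP.
exists (@MkEFunctor A T X Y f hf); exact: efunctor_ext.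
Qed.

Section Descend.
Variable Y : ECategory D.
Let X : Graph A := ecat_algebra_graph Y.

Lemma pairmap_algebras a s :
  map G (pairmap (gr_hom X) a s) = pairmap (gr_hom Y) a s.
Proof. by elim: s a => //= b s IH a; rewrite -IH. Qed.

Lemma path_targets_singletons (a : gr_ob Y) s :
  path_targets a (map (fun b => [:: b]) s) = s.
Proof. by elim: s a => //= b s IH a; rewrite IH. Qed.

Lemma paths_homs_singletons a s :
  paths_homs a (map (fun b => [:: b]) s) =
  map (fun x => [:: x]) (pairmap (gr_hom Y) a s).
Proof. by elim: s a => //= b s IH a; rewrite IH. Qed.

Lemma lcompositions_singletons a s :
  lheq (lacts (pairmap (gr_hom X) a s))
    (lcompositions (ec_comp Y) a (map (fun b => [:: b]) s)).
Proof.
elim: s a => [|b s IH] a /=; first exact: lheq_refl.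
by apply: lheq_cons (IH _); apply: heq_refl.
Qed.

(** The two conditions of [theta_fact] are associativity in [Y] for two ways of cutting the path
    [s]: into the single block [[:: s]], and into blocks of length one. *)
Lemma descend_exists a s :
  exists c : hom (T (pairmap (gr_hom X) a s)) (gr_hom X a (last a s)),
    heq (fmap G c ∘ theta _) (ec_comp Y a s).
Proof.
pose c := ec_comp Y a s ∘ lfmap D (lcast (pairmap_algebras a s)).
have hc : heq c (ec_comp Y a s) by apply: heq_lcastr.
have [||c' e] := @theta_fact (pairmap (gr_hom X) a s) (gr_hom X a (last a s)) c;
    last by exists c'; rewrite e.
- apply: heq_eq; apply: heq_sym.
  have h1 : @lheq W [:: _] [:: _] [:: _] [:: _] (c, tt)
      (lcompositions (ec_comp Y) a [:: s]).
    by apply: lheq_cons => //; apply: lheq_refl.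
  apply: heq_trans (heq_comp (heq_refl (ec_comp Y a [:: last a s])) (lheq_lfmap D h1)) _.
  rewrite [_ ∘ _](ec_assoc Y a [:: s]) -!comp_assoc.
  apply: heq_trans (heq_idl _ _) _; rewrite !comp_assoc.
  apply: heq_lmid.
    by apply: heq_trans (heq_sym hc); apply: heq_ec_comp; rewrite // flatten1.
  have -> : [:: map G (pairmap (gr_hom X) a s)] =
      paths_homs (X := Y) a [:: s].
    by rewrite pairmap_algebras.
  exact: heq_refl.
- apply: heq_eq.
  have hc2 : heq c (ec_comp Y a (path_targets (X := Y) a (map (fun b => [:: b]) s))).
    by apply: heq_trans hc _; apply: heq_ec_comp; rewrite // path_targets_singletons.
  apply: heq_trans (heq_comp hc2 (lheq_lfmap D (lcompositions_singletons a s))) _.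
  rewrite ec_assoc -[X in heq X _]comp_assoc -[X in heq X _]comp_assoc.
  apply: heq_trans (heq_idl _ _) _; rewrite !comp_assoc.
  apply: heq_lmid.
    apply: heq_trans (heq_sym hc); apply: heq_ec_comp => //.
    exact: flatten_singletons.
  rewrite pairmap_algebras -paths_homs_singletons; exact: heq_refl.
Qed.

Definition descend_comp a s :=
  proj1_sig (constructive_indefinite_description _ (descend_exists a s)).

Lemma descend_compE a s : heq (fmap G (descend_comp a s) ∘ theta _) (ec_comp Y a s).
Proof. by rewrite /descend_comp; case: constructive_indefinite_description. Qed.

Lemma under_descend (a : gr_ob X) s :
  heq (under_comp descend_comp a s) (ec_comp Y a s).
Proof. apply: heq_trans (under_compE _ _ _) _; exact: descend_compE. Qed.

Lemma descend_unit a b :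
  descend_comp a [:: b] ∘ mt_unit T (gr_hom X a b) = idm (gr_hom X a b).
Proof.
apply: alg_hom_ext.
have h := heq_eq (@descend_compE a [:: b]).
rewrite theta_act in h.
transitivity (ec_comp Y a [:: b] ∘ mt_unit D (gr_hom Y a b)); last exact: ec_unit.
rewrite -h -!comp_assoc.
have e : alg_act (gr_hom X a b) ∘ mt_unit D (gr_hom Y a b) = idm _.
  exact: (alg_unit (gr_hom X a b)).
by rewrite e comp_idr.
Qed.

Lemma descend_assoc (a : gr_ob X) (ss : seq (seq (gr_ob X))) :
  descend_comp a (path_targets a ss) ∘
    lfmap T (lcompositions (X := X) descend_comp a ss) =
  eq_hom (f_equal (gr_hom X a) (last_path_targets (X := X) a ss)) ∘
    descend_comp a (flatten ss) ∘
    lfmap T (lcast (flatten_paths_homs (X := X) a ss)) ∘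
    mt_sub T (paths_homs (X := X) a ss).
Proof.
apply: theta_epi2; apply: heq_eq.
apply: heq_trans (heq_sym (under_compositions_theta descend_comp a ss)) _.
apply: heq_trans (under_comp_sub descend_comp a ss).
(* Once [Y] is destructed, the underlying graph of its algebra graph is convertible to its own
   graph, so the two composition maps can be identified and the law is that of [Y]. *)
apply: eq_heq; move: (@under_descend); move: (under_comp _) a ss; rewrite /X.
case: Y => [[o k] c u l] /= d a ss e.
have -> : d = c.
  do 2![apply: functional_extensionality_dep => ?]; apply: heq_eq; exact: e.
exact: l.
Qed.

Definition descend : ECategory T :=
  @MkECategory A T X descend_comp descend_unit descend_assoc.

End Descend.

Lemma under_surj (Y : ECat D) : exists X, under_functor X = Y.
Proof.
exists (descend Y).
rewrite /= /under; move: (@under_unit (descend Y)) (@under_assoc (descend Y)).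
rewrite /=; move: (under_comp _) (@under_descend Y).
case: Y => [[o k] c u l] /= d e u' l'.
by apply: ecategory_eq => a s; apply: heq_eq; apply: e.
Qed.

Lemma lift_iso : exists Phi : CatIso (ECat T) (ECat D),
  ecat_algebras D ⊚ Phi = ecat_graph T.
Proof.
exists (MkCatIso (bijective_ff_invertible under_faithful under_full under_inj
  under_surj)).
exact: under_functor_over.
Qed.

End Lift.

(** * Reflexive coequalizers *)

Section Coequalizers.
Variable V : Category.

Definition refl_coeq (a b c : V) (p q : hom a b) (e : hom b c) : Prop :=
  [/\ exists s, p ∘ s = idm b /\ q ∘ s = idm b,
      e ∘ p = e ∘ q,
      forall z (f : hom b z), f ∘ p = f ∘ q -> exists g, g ∘ e = f
    & forall z (g g' : hom c z), g ∘ e = g' ∘ e -> g = g'].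

(** The shape of a parallel pair: [false] is the source, [true] the target, and the two arrows
    between them are the booleans, [true] standing for the first one. *)
Definition pair_hom (i j : bool) : SmallType :=
  match i, j with
  | false, true => bool
  | true, false => Empty_set
  | _, _ => unit
  end.

Definition pair_id (i : bool) : pair_hom i i :=
  match i with true => tt | false => tt end.

Definition pair_comp (i j k : bool) : pair_hom j k -> pair_hom i j -> pair_hom i k :=
  match i, j, k return pair_hom j k -> pair_hom i j -> pair_hom i k with
  | false, false, false => fun _ _ => tt
  | false, false, true => fun g _ => g
  | false, true, true => fun _ f => f
  | true, true, true => fun _ _ => tt
  | false, true, false => fun g _ => match g with end
  | true, true, false => fun g _ => g
  | true, false, _ => fun _ f => match f with end
  end.

Definition pair_cat : SmallCategory.
Proof.
refine (@MkSmallCategory bool (@IsCategory bool pair_hom pair_id pair_comp _ _ _)).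
- by case=> [] [] [].
- by case=> [] [] [].
- by case=> [] [] [] [] // [] [] [].
Defined.

Definition pair_ob (a b : V) (i : bool) : V := if i then b else a.

Definition pair_map (a b : V) (p q : hom a b) (i j : bool) :
    pair_hom i j -> hom (pair_ob a b i) (pair_ob a b j) :=
  match i, j return pair_hom i j -> hom (pair_ob a b i) (pair_ob a b j) with
  | false, false => fun _ => idm a
  | true, true => fun _ => idm b
  | false, true => fun k => if k then p else q
  | true, false => fun k => match k with end
  end.

Definition pair_functor (a b : V) (p q : hom a b) : Functor pair_cat V.
Proof.
refine (@MkFunctor pair_cat V (pair_ob a b) (@pair_map a b p q) _ _).
- by case.
- by case=> [] [] [] // [] [] //=; rewrite ?comp_idl ?comp_idr.
Defined.

Lemma pair_functor_map (a b : V) (p q : hom a b) (k : bool) :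
  @fmap pair_cat V (pair_functor p q) false true k = if k then p else q.
Proof. by []. Qed.

Definition pair_cocone (a b c : V) (p q : hom a b) (e : hom b c)
  (h : e ∘ p = e ∘ q) : Cocone (pair_functor p q).
Proof.
refine (@MkCocone pair_cat V (pair_functor p q) c
  (fun i : bool => match i return hom (pair_ob a b i) c with
    true => e | false => e ∘ p end) _).
by case=> [] [] // [] //=; rewrite ?comp_idr.
Defined.

End Coequalizers.

Lemma preserves_refl_coeq (V V' : Category) (H : Functor V V') (a b c : V)
    (p q : hom a b) (e : hom b c) :
  preserves_colimits H -> refl_coeq p q e ->
  refl_coeq (fmap H p) (fmap H q) (fmap H e).
Proof.
move=> hH [[s [ps qs]] epq fact epi].
have hc : is_colimit (pair_cocone epq).
  move=> c'.
  have lp := @leg_nat _ _ _ c' false true true.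
  have lq := @leg_nat _ _ _ c' false true false.
  rewrite pair_functor_map in lp; rewrite pair_functor_map in lq.
  have [g hg] := fact _ (leg c' true) (etrans lp (esym lq)).
  exists g; split.
    by case=> /=; [exact: hg | rewrite -lp -hg comp_assoc].
  by move=> g' /(_ true) /= hg'; apply: epi; rewrite hg hg'.
have {}hc := hH _ _ _ hc.
have hcc z (f : hom (H b) z) : f ∘ fmap H p = f ∘ fmap H q ->
    exists! g : hom (H c) z, g ∘ fmap H e = f.
  move=> hf.
  have l i j (k : hom (i : pair_cat) j) : 
     (match j return hom (H (pair_ob a b j)) z with
      true => f | false => f ∘ fmap H p end) ∘ fmap (H ⊚ pair_functor p q) k =
     (match i return hom (H (pair_ob a b i)) z with
      true => f | false => f ∘ fmap H p end).
    by case: i j k => [] [] // [] //=; rewrite ?fmap_id ?comp_idr.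
  have [g [hg u]] := hc (MkCocone l).
  exists g; split; first exact: (hg true).
  move=> g' hg'; apply: u => -[] //=.
  by rewrite fmap_comp comp_assoc hg'.
split.
- by exists (fmap H s); rewrite -!fmap_comp ps qs fmap_id.
- by rewrite -!fmap_comp epq.
- by move=> z f /hcc [g [hg _]]; exists g.
- move=> z g g' hg.
  have [|k [_ u]] := hcc z (g ∘ fmap H e).
    by rewrite -!comp_assoc -!fmap_comp epq.
  by rewrite -(u g erefl) (u g' (esym hg)).
Qed.

Inductive lcoeq (V : Category) : forall (xs ys zs : seq V),
    lhom xs ys -> lhom xs ys -> lhom ys zs -> Prop :=
| lcoeq_nil : @lcoeq V [::] [::] [::] tt tt tt
| lcoeq_cons : forall (x y z : V) (p q : hom x y) (e : hom y z) xs ys zs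
    (ps qs : lhom xs ys) (es : lhom ys zs),
    refl_coeq p q e -> lcoeq ps qs es ->
    @lcoeq V (x :: xs) (y :: ys) (z :: zs) (p, ps) (q, qs) (e, es).

Definition cons_functor (V : Category) (x : V) : Functor (SeqCat V) (SeqCat V).
Proof.
refine (@MkFunctor (SeqCat V) (SeqCat V) (cons x)
  (fun xs ys f => (idm x, f) : lhom (x :: xs) (x :: ys)) _ _) => //.
by move=> xs ys zs g f; rewrite /compm /= -/(compm _ _) comp_idl.
Defined.

Lemma lcoeq_section (V : Category) (xs ys zs : seq V) (ps qs : lhom xs ys)
    (es : lhom ys zs) : lcoeq ps qs es ->
  exists ss : lhom ys xs, lcomp ps ss = lid ys /\ lcomp qs ss = lid ys.
Proof.
elim=> [|x y z p q e {}xs {}ys {}zs {}ps {}qs {}es [[s [hp hq]] _ _ _] _ [ss [hps hqs]]].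
  by exists tt.
by exists (s, ss); rewrite /= hp hq hps hqs.
Qed.

Lemma lcoeq_eq (V : Category) (xs ys zs : seq V) (ps qs : lhom xs ys)
    (es : lhom ys zs) : lcoeq ps qs es -> lcomp es ps = lcomp es qs.
Proof. by elim=> //= x y z p q e > [_ -> _ _] _ ->. Qed.

(** Head and tail are coequalized in turn. [H] is quantified after the sequences because the
    induction hypothesis is used for [H] with its head variable fixed at [z]. *)
Lemma preserves_lcoeq (V : Category) (xs ys zs : seq V) (ps qs : lhom xs ys)
    (es : lhom ys zs) : lcoeq ps qs es ->
  forall H : Functor (SeqCat V) V,
  (forall l r, preserves_colimits (H ⊚ slot l r)) ->
  refl_coeq (lfmap H ps) (lfmap H qs) (lfmap H es).
Proof.
elim=> [|x y z p q e {}xs {}ys {}zs {}ps {}qs {}es hp hps IH] H hH.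
  have -> : lfmap H (tt : @lhom V [::] [::]) = idm (H [::]) by exact: (lfmap_id H [::]).
  split=> //.
  - by exists (idm _); rewrite comp_idl.
  - by move=> t f _; exists f; rewrite comp_idr.
  - by move=> t g g'; rewrite !comp_idr.
have hcons l r : preserves_colimits (H ⊚ cons_functor z ⊚ slot l r).
  have -> : H ⊚ cons_functor z ⊚ slot l r = H ⊚ slot (z :: l) r by exact: functor_ext.
  exact: hH.
have {IH} [_ _ fact2 epi2] := IH _ hcons.
have h1 ts := preserves_refl_coeq (hH [::] ts) hp.
have [ss [hpss hqss]] := lcoeq_section hps; have epqs := lcoeq_eq hps.
have [[s [hs hs']] epq _ _] := hp.
have HC us vs ws (g : lhom vs ws) (f : lhom us vs) := esym (lfmap_comp H g f).
split.
- exists (@lfmap _ _ H (y :: ys) (x :: xs) (s, ss)); rewrite !HC /= hs hs' hpss hqss.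
  by split; apply: (lfmap_id H (y :: ys)).
- by rewrite !HC /= epq epqs.
- move=> t f hf.
  have [_ _ /(_ t f) fact1 _] := h1 ys.
  (* Restricting [hf] along the section [ss] of the tail leaves an equation in the head variable
     alone. *)
  have [f1 hf1] : exists g, g ∘ @lfmap _ _ H (y :: ys) (z :: ys) (e, lid ys) = f.
    apply: fact1; change (f ∘ @lfmap _ _ H (x :: ys) (y :: ys) (p, lid ys) =
                          f ∘ @lfmap _ _ H (x :: ys) (y :: ys) (q, lid ys)).
    move: (f_equal (fun k => k ∘ @lfmap _ _ H (x :: ys) (x :: xs) (idm x, ss)) hf).
    by rewrite -!comp_assoc !HC /= !comp_idr hpss hqss.
  (* That [f1] coequalizes the tail may be checked after the epimorphism induced by [e]; there it
     becomes an equation about [f], and the section [s] of the head derives it from [hf]. *)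
  have [f2 hf2] : exists g, g ∘ @lfmap _ _ H (z :: ys) (z :: zs) (idm z, es) = f1.
    apply: fact2.
    have [_ _ _ epi1] := h1 xs.
    apply: epi1.
    change (f1 ∘ @lfmap _ _ H (z :: xs) (z :: ys) (idm z, ps) ∘
      @lfmap _ _ H (y :: xs) (z :: xs) (e, lid xs) =
      f1 ∘ @lfmap _ _ H (z :: xs) (z :: ys) (idm z, qs) ∘
      @lfmap _ _ H (y :: xs) (z :: xs) (e, lid xs)).
    have sw (ks : lhom xs ys) : 
        f1 ∘ @lfmap _ _ H (z :: xs) (z :: ys) (idm z, ks) ∘
        @lfmap _ _ H (y :: xs) (z :: xs) (e, lid xs) =
        f ∘ @lfmap _ _ H (y :: xs) (y :: ys) (idm y, ks).
      rewrite -hf1 -!comp_assoc !HC /= comp_idl comp_idr.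
      by rewrite (lcomp_idr ks) (lcomp_idl ks).
    rewrite !sw.
    move: (f_equal (fun k => k ∘ @lfmap _ _ H (y :: xs) (x :: xs) (s, lid xs)) hf).
    by rewrite -!comp_assoc !HC /= hs hs' (lcomp_idr ps) (lcomp_idr qs).
  exists f2; rewrite -hf1 -hf2 -comp_assoc HC /= comp_idl.
  by rewrite (lcomp_idr es).
- move=> t g g' hg.
  have [_ _ _ epi1] := h1 ys.
  apply: epi2; apply: epi1.
  change (g ∘ @lfmap _ _ H (z :: ys) (z :: zs) (idm z, es) ∘
     @lfmap _ _ H (y :: ys) (z :: ys) (e, lid ys) =
     g' ∘ @lfmap _ _ H (z :: ys) (z :: zs) (idm z, es) ∘
     @lfmap _ _ H (y :: ys) (z :: ys) (e, lid ys)).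
  by rewrite -!comp_assoc !HC /= comp_idl (lcomp_idr es).
Qed.

(** * The canonical presentation of an algebra by free ones *)

Section Counit.
Variables (V W : Category) (F : Functor W V) (U : Functor V W).
Variables (adj : Adjunction F U) (hmon : monadic adj).
Let eta := adj_unit adj.
Let eps := adj_counit adj.

Lemma eps_nat (x y : V) (f : hom x y) : eps y ∘ fmap F (fmap U f) = f ∘ eps x.
Proof. exact: (nt_nat eps). Qed.

Lemma eta_nat (x y : W) (f : hom x y) : eta y ∘ f = fmap U (fmap F f) ∘ eta x.
Proof. exact: (nt_nat eta). Qed.

Let triF (w : W) : eps (F w) ∘ fmap F (eta w) = idm (F w).
Proof. exact: adj_triangleF. Qed.

Let triU (v : V) : fmap U (eps v) ∘ eta (U v) = idm (U v).
Proof. exact: adj_triangleU. Qed.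

Lemma monadic_faithful (x y : V) (f g : hom x y) : fmap U f = fmap U g -> f = g.
Proof.
by move=> e; apply: (invertible_faithful hmon); apply: alg_hom_ext.
Qed.

Lemma monadic_full (x y : V) (c : hom (U x) (U y)) :
  c ∘ fmap U (eps x) = fmap U (eps y) ∘ fmap U (fmap F c) ->
  exists g : hom x y, fmap U g = c.
Proof.
move=> hc.
pose k : hom (comparison adj x) (comparison adj y) :=
  @MkAlgHom W (adj_monad adj) (comparison adj x) (comparison adj y) c hc.
have [g hg] := invertible_full hmon k.
by exists g; have := f_equal (fun h => @alg_hom _ _ _ _ h) hg.
Qed.

(** Maps [f] out of [F w] that coequalize the pair are the transposes of algebra maps out of
    [(w, a)], and these lift to [V] by monadicity. The inverse maps [i] and [j] replace an equality
    [w = U v], so that no cast enters the argument. The common section is [fmap F (eta w)]. *)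
Lemma counit_coeq (w : W) (a : hom (U (F w)) w) (v : V) (i : hom w (U v))
    (j : hom (U v) w) :
  j ∘ i = idm w -> i ∘ j = idm (U v) ->
  i ∘ a = fmap U (eps v) ∘ fmap U (fmap F i) ->
  refl_coeq (fmap F a) (eps (F w)) (eps v ∘ fmap F i).
Proof.
move=> ji ij ia.
have aj : a ∘ fmap U (fmap F j) = j ∘ fmap U (eps v).
  rewrite -[LHS]comp_idl -ji -comp_assoc (comp_assoc i) ia.
  by rewrite -(comp_assoc _ _ (fmap U (fmap F j))) -!fmap_comp ij !fmap_id comp_idr.
have aeta : a ∘ eta w = idm w.
  rewrite -[LHS]comp_idl -ji -comp_assoc (comp_assoc i) ia -comp_assoc -eta_nat.
  by rewrite (comp_assoc _ (eta _) i) triU comp_idl.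
have ffac z (f : hom (F w) z) : fmap U (eps z) ∘ fmap U (fmap F (fmap U f ∘ eta w)) = fmap U f.
  rewrite -(fmap_comp U) (fmap_comp F) comp_assoc eps_nat -comp_assoc.
  by rewrite triF comp_idr.
have cond z (f : hom (F w) z) : f ∘ fmap F a = f ∘ eps (F w) ->
    fmap U f ∘ eta w ∘ a = fmap U f.
  move=> hf; rewrite -comp_assoc eta_nat comp_assoc -fmap_comp hf fmap_comp.
  by rewrite -comp_assoc triU comp_idr.
split.
- exists (fmap F (eta w)); rewrite -fmap_comp aeta fmap_id; split=> //.
  exact: triF.
- rewrite -comp_assoc -fmap_comp ia -fmap_comp fmap_comp.
  rewrite fmap_comp !comp_assoc eps_nat.
  by rewrite -!comp_assoc eps_nat.
(* [c] is the transpose of [f], read on [U v] along [j]; [cUeps] amounts to its being a map of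
   algebras. *)
- move=> z f hf; pose c := fmap U f ∘ eta w ∘ j.
  have cUeps : c ∘ fmap U (eps v) = fmap U f ∘ fmap U (fmap F j).
    by rewrite /c -comp_assoc -aj comp_assoc (cond _ _ hf).
  have [|g hg] := @monadic_full v z c.
    by rewrite cUeps /c (fmap_comp F _ j) (fmap_comp U) comp_assoc ffac.
  exists g; apply: monadic_faithful; rewrite !fmap_comp hg comp_assoc cUeps.
  by rewrite -comp_assoc -!fmap_comp ji !fmap_id comp_idr.
- move=> z g g' hg; apply: monadic_faithful.
  have st (k : hom v z) : fmap U k = fmap U (k ∘ (eps v ∘ fmap F i)) ∘ eta w ∘ j.
    rewrite !fmap_comp -!comp_assoc (comp_assoc _ (eta w)) -eta_nat -comp_assoc ij comp_idr.
    by rewrite triU comp_idr.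
  by rewrite st hg -st.
Qed.

Lemma counit_coeq1 (v : V) :
  refl_coeq (fmap F (fmap U (eps v))) (eps (F (U v))) (eps v).
Proof.
have := @counit_coeq (U v) (fmap U (eps v)) v (idm _) (idm _).
rewrite !comp_idl !fmap_id !comp_idr; exact.
Qed.

End Counit.

(** * The multitensor [E] transported along the comparison *)

Section NormalMultitensor.
Variables (V : Category) (E : Multitensor V) (nE : mt_normal E).

Lemma normal_unit_heq (x : V) : heq (mt_unit E x) (idm x).
Proof. by have [p ->] := normal_unit nE x; apply: heq_eq_hom. Qed.

Lemma normal_functor : E ⊚ singleton V = functor_id V.
Proof. exact: (f_equal (@projT1 _ _) nE). Qed.

Lemma normal_map_heq (x y : V) (f : hom x y) :
  heq (@lfmap _ _ E [:: x] [:: y] (f, tt)) f.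
Proof. exact: (functor_eq_heq f normal_functor). Qed.

Lemma normal_msub1 (xs : seq V) : heq (msub E [:: xs]) (idm (E xs)).
Proof.
have [p hp] := normal_unit nE (E xs).
apply: heq_trans (heq_sym (heq_idr p (msub E [:: xs]))) _.
rewrite -hp /msub mt_unitl.
apply: heq_trans (lheq_lfmap E (lheq_cast _ (erefl _))) _.
by rewrite lfmap_id; apply: heq_refl.
Qed.

End NormalMultitensor.

(** [comparison_iso] carries a transport along an equality of monads. With an arbitrary [M] in place
    of the unary monad, that equality can be substituted away; the three facts describe the
    isomorphism from then on. *)
Lemma comparison_iso_heq (V W : Category) (F : Functor W V) (U : Functor V W)
    (adj : Adjunction F U) (hmon : monadic adj) (M : Monad W)
    (e : M = adj_monad adj) :
  let K := eq_rect_r (fun T : Monad W => CatIso V (EM T)) (MkCatIso hmon) e in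
  [/\ forall v, U v = alg_ob (K v),
      forall v v' (f : hom v v'), heq (fmap U f) (alg_hom (fmap K f))
    & forall v, heq (alg_act (K v)) (fmap U (adj_counit adj v))].
Proof. by subst M; split=> //= *; apply: heq_refl. Qed.

Section Concrete.
Variables (V W : Category) (F : Functor W V) (U : Functor V W).
Variables (adj : Adjunction F U) (hmon : monadic adj).
Variables (E : Multitensor V) (clE : mt_closed E) (nE : mt_normal E).
Let D := UEF adj E.
Let M := mt_monad D.
Let A := EM M.
Let G : Functor A W := forget M.
Let eps := adj_counit adj.

Variable K : CatIso V A.
Hypothesis kappa_ob : forall v, U v = alg_ob (K v).
Hypothesis kappa_map :
  forall v v' (f : hom v v'), heq (fmap U f) (alg_hom (fmap K f)).
Hypothesis kappa_act : forall v, heq (alg_act (K v)) (fmap U (eps v)).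

Let L : Functor A V := inverse (iso_inv K).
Let T := transport K E.

Lemma LK v : L (K v) = v. Proof. exact: invertible_ob. Qed.
Lemma KL x : K (L x) = x. Proof. exact: invertible_inv_ob. Qed.

Lemma iota_ob x : alg_ob x = U (L x).
Proof. by rewrite kappa_ob KL. Qed.

Definition kappa v : hom (U v) (G (K v)) := eq_hom (kappa_ob v).
Definition iota (x : A) : hom (G x) (U (L x)) := eq_hom (iota_ob x).

Lemma kappa_nat v v' (f : hom v v') :
  fmap G (fmap K f) ∘ kappa v = kappa v' ∘ fmap U f.
Proof.
apply: heq_eq; apply: heq_trans (heq_idr _ _) _.
apply: heq_trans (heq_sym (kappa_map f)) _; exact/heq_sym/heq_idl.
Qed.

Lemma iota_map (x y : A) (f : hom x y) : heq (alg_hom f) (fmap U (fmap L f)).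
Proof.
apply: heq_trans (heq_sym (kappa_map _)).
exact: (heq_fmap G (heq_sym (invertible_inv_map (iso_inv K) f))).
Qed.

Lemma iota_nat (x y : A) (f : hom x y) : iota y ∘ fmap G f = fmap U (fmap L f) ∘ iota x.
Proof.
apply: heq_eq; apply: heq_trans (heq_idl _ _) _.
apply: heq_trans (iota_map f) _; exact/heq_sym/heq_idr.
Qed.

Lemma iota_act0 x : heq (alg_act x) (fmap U (eps (L x))).
Proof.
apply: heq_trans (kappa_act (L x)); rewrite KL; exact: heq_refl.
Qed.

Lemma heq_iota x : heq (iota x) (idm (G x)).
Proof. exact: heq_eq_hom. Qed.

(** The action of [x] for the monad [UF]; [alg_act] is an action of [U E_1 F], and normality makes
    the unit in between a cast. *)
Definition alpha (x : A) : hom (U (F (G x))) (G x) :=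
  alg_act x ∘ fmap U (mt_unit E (F (G x))).

Lemma iota_act x :
  iota x ∘ alpha x = fmap U (eps (L x)) ∘ fmap U (fmap F (iota x)).
Proof.
apply: heq_eq; apply: heq_trans (heq_idl _ _) _.
apply: heq_trans (heq_compr_id _ (heq_fmap_id U (normal_unit_heq nE _))) _.
apply: heq_trans (iota_act0 x) _; apply: heq_sym.
by apply: heq_compr_id; do 2!apply: heq_fmap_id; apply: heq_iota.
Qed.

(** The transpose of the identification [iota x]; by [iota_act], applying [U] gives the action of
    [x]. *)
Definition nu (x : A) : hom (F (G x)) (L x) := eps (L x) ∘ fmap F (iota x).

Lemma nu_nat (x y : A) (f : hom x y) : nu y ∘ fmap F (fmap G f) = fmap L f ∘ nu x.
Proof.
rewrite /nu -comp_assoc -fmap_comp iota_nat fmap_comp !comp_assoc.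
by rewrite [eps _ ∘ _](eps_nat adj).
Qed.

Lemma nu_coeq x : refl_coeq (fmap F (alpha x)) (eps (F (G x))) (nu x).
Proof.
apply: (@counit_coeq _ _ _ _ adj hmon (G x) (alpha x) (L x) (iota x)
  (eq_hom (esym (iota_ob x)))); last exact: iota_act.
- by rewrite /iota eq_hom_comp eq_hom_id.
- by rewrite /iota eq_hom_comp eq_hom_id.
Qed.

Fixpoint lnu (xs : seq A) : lhom (map F (map G xs)) (map L xs) :=
  if xs is x :: xs' then (nu x, lnu xs') else tt.

Fixpoint lalpha (xs : seq A) :
    lhom (map (fun x => F (U (F (G x)))) xs) (map F (map G xs)) :=
  if xs is x :: xs' then (fmap F (alpha x), lalpha xs') else tt.

Fixpoint leps (xs : seq A) :
    lhom (map (fun x => F (U (F (G x)))) xs) (map F (map G xs)) :=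
  if xs is x :: xs' then (eps (F (G x)), leps xs') else tt.

Lemma lnu_lcoeq xs : lcoeq (lalpha xs) (leps xs) (lnu xs).
Proof.
elim: xs => [|x xs IH]; first exact: lcoeq_nil.
by apply: lcoeq_cons => //; apply: nu_coeq.
Qed.

Lemma lnu_nat xs ys (f : lhom xs ys) :
  lcomp (lnu ys) (lmap F (lmap G f)) = lcomp (lmap L f) (lnu xs).
Proof.
elim: xs ys f => [|x xs IH] [|y ys] //=; first by case.
case=> f fs; rewrite /= IH; congr pair.
exact: nu_nat.
Qed.

Lemma lnu_cat xs ys : lheq (lcat (lnu xs) (lnu ys)) (lnu (xs ++ ys)).
Proof.
elim: xs => [|x xs IH] /=; first exact: lheq_refl.
by apply: lheq_cons => //; apply: heq_refl.
Qed.

Fixpoint lnus (xss : seq (seq A)) :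
    @lhom (SeqCat V) (map (map F) (map (map G) xss)) (map (map L) xss) :=
  if xss is xs :: xss' then (lnu xs, lnus xss') else tt.

Lemma lflatten_lnus xss : lheq (lflatten (lnus xss)) (lnu (flatten xss)).
Proof.
elim: xss => [|xs xss IH] /=; first exact: lheq_refl.
apply: lheq_trans (lnu_cat _ _); apply: lheq_cat => //; exact: lheq_refl.
Qed.

Definition ctheta (xs : seq A) : hom (D (map G xs)) (G (T xs)) :=
  kappa (E (map L xs)) ∘ fmap U (lfmap E (lnu xs)).

Lemma ctheta_nat xs ys (f : lhom xs ys) :
  ctheta ys ∘ lfmap D (lmap G f) = fmap G (lfmap T f) ∘ ctheta xs.
Proof.
transitivity (kappa (E (map L ys)) ∘ (fmap U (lfmap E (lnu ys)) ∘
  fmap U (lfmap E (lmap F (lmap G f))))); first exact/esym/comp_assoc.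
rewrite -fmap_comp -lfmap_comp lnu_nat lfmap_comp fmap_comp !comp_assoc.
by rewrite -kappa_nat.
Qed.

Lemma ctheta_act x : ctheta [:: x] = fmap G (mt_unit T x) ∘ alg_act x.
Proof.
apply: heq_eq; apply: heq_trans (heq_idl _ _) _.
apply: heq_trans (heq_fmap U (normal_map_heq nE (nu x))) _.
rewrite /nu fmap_comp.
apply: heq_trans.
  by apply: heq_compr_id; do 2!apply: heq_fmap_id; apply: heq_iota.
apply: heq_trans (heq_sym (iota_act0 x)) (heq_sym _).
apply: heq_compl_id.
have h : heq (mt_unit T x) (idm x).
  apply: heq_trans (heq_idr _ _) _.
  apply: heq_trans (heq_fmap_id K (normal_unit_heq nE _)) _.
  by apply: heq_id; apply: KL.
exact: (heq_fmap_id G h).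
Qed.

(** Up to casts, [ctheta xs] is [U] applied to a map of [V], so naturality of the counit applies. *)
Lemma nu_ctheta xs :
  heq (nu (T xs) ∘ fmap F (ctheta xs))
      (lfmap E (lnu xs) ∘ eps (E (map F (map G xs)))).
Proof.
pose p : E (map L xs) = L (T xs) := esym (LK _).
have e : iota (T xs) ∘ ctheta xs = fmap U (eq_hom p ∘ lfmap E (lnu xs)).
  rewrite /ctheta comp_assoc fmap_comp; congr (_ ∘ _).
  by rewrite (fmap_eq_hom p (f_equal U p)) eq_hom_comp; congr eq_hom;
    apply: proof_irrelevance.
rewrite /nu -comp_assoc -fmap_comp e [eps _ ∘ _](eps_nat adj) -comp_assoc.
exact: heq_idl.
Qed.

Lemma lnu_lthetas xss :
  lheq (lcomp (lnu (map T xss)) (lmap F (lthetas ctheta xss)))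
       (lcomp (lmap E (lnus xss)) (lcounits adj E (map (map G) xss))).
Proof.
elim: xss => [|xs xss IH]; first exact: lheq_refl.
apply: lheq_cons => //; exact: nu_ctheta.
Qed.

Lemma lcounits_iso_id xss : 
  lheq (lcounits (iso_adjunction K) E xss) (lid (map E (map (map L) xss))).
Proof.
elim: xss => [|xs xss IH]; first exact: lheq_refl.
apply: lheq_cons => //; apply: heq_eq_hom; exact: LK.
Qed.

Lemma ctheta_sub xss :
  fmap G (msub T xss) ∘ ctheta (map T xss) ∘ lfmap D (lthetas ctheta xss) =
  ctheta (flatten xss) ∘ lfmap D (lcast (flatten_map_map G xss)) ∘
    msub D (map (map G) xss).
Proof.
(* Both substitutions come from maps of [V]: that of [T] is [K] of [sL], that of [D] is [U] of [sF].
   The identity [h] between them is naturality of the substitution of [E] at [lnus]; [kappa_nat]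
   carries it to [W]. *)
pose sL := UEF_sub_E (iso_adjunction K) E xss.
pose sF := UEF_sub_E adj E (map (map G) xss).
have h : sL ∘ lfmap E (lnu (map T xss)) ∘ lfmap E (lmap F (lthetas ctheta xss)) =
    lfmap E (lnu (flatten xss)) ∘ lfmap E (lmap F (lcast (flatten_map_map G xss))) ∘ sF.
  have h1 : heq (lfmap E (lcounits (iso_adjunction K) E xss) ∘
       (lfmap E (lnu (map T xss)) ∘ lfmap E (lmap F (lthetas ctheta xss))))
     (lfmap E (lmap E (lnus xss)) ∘ lfmap E (lcounits adj E (map (map G) xss))).
    apply: heq_trans.
      apply: heq_compl_id.
      by have := lheq_lfmap E (lcounits_iso_id xss); rewrite lfmap_id; apply.
    by have := lheq_lfmap E (lnu_lthetas xss); rewrite !lfmap_comp; apply.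
  rewrite /sL /sF /UEF_sub_E -[LHS]comp_assoc.
  apply: heq_eq; rewrite -[X in heq X _]comp_assoc -[X in heq X _]comp_assoc.
  apply: heq_trans (heq_lcastl _ _) _.
  apply: heq_trans (heq_comp (heq_refl _) h1) _.
  apply: heq_trans (eq_heq (comp_assoc _ _ _)) _.
  apply: heq_trans (heq_comp (eq_heq (msub_nat E (lnus xss))) (heq_refl _)) _.
  have p := f_equal (map F) (flatten_map_map G xss).
  rewrite (lmap_cast _ p); apply: heq_sym; rewrite !comp_assoc.
  apply: heq_comp; last exact: heq_refl.
  apply: heq_comp; last exact: heq_refl.
  rewrite -!lfmap_comp; apply: lheq_lfmap.
  apply: lheq_trans (lheq_castr _ _) _; apply: lheq_trans (lheq_castr _ _) _.
  exact/lheq_sym/lflatten_lnus.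
have eT : msub T xss = fmap K sL by [].
have eD : msub D (map (map G) xss) = fmap U sF by [].
rewrite eT eD; move: sL sF h {eT eD} => sL sF h.
transitivity (kappa _ ∘ fmap U (sL ∘ lfmap E (lnu (map T xss)) ∘
    lfmap E (lmap F (lthetas ctheta xss)))).
  by rewrite !(fmap_comp U) !comp_assoc -kappa_nat.
by rewrite h !(fmap_comp U) !comp_assoc.
Qed.

(** The transpose of [c] under the isomorphism [K]; it turns questions about maps out of [T xs] into
    questions about maps out of [E (map L xs)] in [V]. *)
Definition hat (v : V) (y : A) (c : hom (K v) y) : hom v (L y) :=
  fmap L c ∘ eq_hom (esym (LK v)).

Lemma hatE (v : V) (y : A) (c : hom (K v) y) :
  fmap U (hat c) = iota y ∘ fmap G c ∘ kappa v.
Proof.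
apply: heq_eq; rewrite fmap_comp -comp_assoc; apply: heq_sym.
apply: heq_trans (heq_idl _ _) _; apply: heq_trans (heq_idr _ _) _.
apply: heq_trans (iota_map c) (heq_sym _); apply: heq_compr_id.
apply: (heq_fmap_id U); exact: heq_eq_hom.
Qed.

Lemma hat_inj (v : V) (y : A) (c c' : hom (K v) y) : hat c = hat c' -> c = c'.
Proof.
move=> e; have eL : fmap L c = fmap L c'.
  have h (k : hom (K v) y) : heq (fmap L k) (hat k) by apply/heq_sym/heq_idr.
  by apply: heq_eq; apply: heq_trans (h c) _; rewrite e; apply: heq_sym.
apply: heq_eq; apply: heq_trans (heq_sym (invertible_inv_map (iso_inv K) c)) _.
by rewrite -/L eL; apply: invertible_inv_map.
Qed.

Lemma lnu_coeq xs :
  refl_coeq (lfmap E (lalpha xs)) (lfmap E (leps xs)) (lfmap E (lnu xs)).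
Proof. exact: preserves_lcoeq (lnu_lcoeq xs) _ clE. Qed.

Lemma hat_ctheta xs (y : A) (c : hom (T xs) y) :
  iota y ∘ (fmap G c ∘ ctheta xs) =
  fmap U (hat (v := E (map L xs)) c ∘ lfmap E (lnu xs)).
Proof. by rewrite fmap_comp hatE -!comp_assoc. Qed.

Lemma ctheta_epi xs (y : A) (c c' : hom (T xs) y) :
  fmap G c ∘ ctheta xs = fmap G c' ∘ ctheta xs -> c = c'.
Proof.
move=> /(f_equal (compm (iota y))); rewrite !hat_ctheta.
move=> /(monadic_faithful hmon) e; apply: (@hat_inj (E (map L xs))).
have [_ _ _ epi] := lnu_coeq xs; exact: epi e.
Qed.

Lemma lcounits_coeq yss : exists xs (ps qs : lhom xs _),
  lcoeq ps qs (lcounits adj E yss).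
Proof.
elim: yss => [|ys yss [xs [ps [qs IH]]]]; first by exists [::], tt, tt; apply: lcoeq_nil.
have h := counit_coeq1 hmon (E (map F ys)).
by do 3!eexists; apply: lcoeq_cons h IH.
Qed.

Lemma lnus_coeq xss : exists zs (ps qs : lhom zs _),
  lcoeq ps qs (lmap E (lnus xss)).
Proof.
elim: xss => [|xs xss [zs [ps [qs IH]]]]; first by exists [::], tt, tt; apply: lcoeq_nil.
by do 3!eexists; apply: lcoeq_cons (lnu_coeq xs) IH.
Qed.

(** In [V], two layers of [ctheta] become [E] of counits followed by [E] of the maps
    [lfmap E (lnu xs)]. Both families consist of reflexive coequalizers, so both maps are epic. *)
Lemma ctheta_epi2 xss (y : A) (c c' : hom (T (map T xss)) y) :
  fmap G c ∘ ctheta (map T xss) ∘ lfmap D (lthetas ctheta xss) =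
  fmap G c' ∘ ctheta (map T xss) ∘ lfmap D (lthetas ctheta xss) -> c = c'.
Proof.
have st (k : hom (T (map T xss)) y) :
    iota y ∘ (fmap G k ∘ ctheta (map T xss) ∘ lfmap D (lthetas ctheta xss)) =
    fmap U (hat (v := E (map L (map T xss))) k ∘
      (lfmap E (lnu (map T xss)) ∘ lfmap E (lmap F (lthetas ctheta xss)))).
  by rewrite comp_assoc hat_ctheta !(fmap_comp U) !comp_assoc.
move=> /(f_equal (compm (iota y))); rewrite !st => /(monadic_faithful hmon) e.
apply: (@hat_inj (E (map L (map T xss)))).
have h : heq (lfmap E (lnu (map T xss)) ∘ lfmap E (lmap F (lthetas ctheta xss)))
   (lfmap E (lmap E (lnus xss)) ∘ lfmap E (lcounits adj E (map (map G) xss))).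
  by have := lheq_lfmap E (lnu_lthetas xss); rewrite !lfmap_comp; apply.
apply: (heq_epi h) e => z g g'; rewrite !comp_assoc => e.
have [zs [ps [qs h1]]] := lnus_coeq xss.
have [ws [ps' [qs' h2]]] := lcounits_coeq (map (map G) xss).
have [_ _ _ epi1] := preserves_lcoeq h1 clE.
have [_ _ _ epi2] := preserves_lcoeq h2 clE.
by apply: epi1; apply: epi2.
Qed.

Fixpoint lUunits (xs : seq A) : lhom (map (fun x => F (U (F (G x)))) xs)
    (map F (map D (map (fun w => [:: w]) (map G xs)))) :=
  if xs is x :: xs' then (fmap F (fmap U (mt_unit E (F (G x)))), lUunits xs')
  else tt.

Lemma lalphaE xs : lalpha xs = lcomp (lmap F (lacts xs)) (lUunits xs).
Proof.
elim: xs => //= x xs ->; congr pair; rewrite /alpha fmap_comp; exact: erefl.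
Qed.

Lemma lcounits_Uunits xs :
  lheq (lcomp (lcounits adj E (map (fun w => [:: w]) (map G xs))) (lUunits xs))
       (lcomp (lunits (mt_unit E) (map F (map G xs))) (leps xs)).
Proof.
elim: xs => [|x xs IH]; first exact: lheq_refl.
apply: lheq_cons => //; apply: eq_heq.
exact: (eps_nat adj (mt_unit E (F (G x)))).
Qed.

Lemma ctheta_fact xs (y : A) (c : hom (D (map G xs)) (G y)) :
  c ∘ lfmap D (lcast (flatten1 (map G xs))) ∘ msub D [:: map G xs] =
    alg_act y ∘ @lfmap _ _ D [:: _] [:: _] (c, tt) ->
  c ∘ lfmap D (lacts xs) =
    c ∘ lfmap D (lcast (flatten_singletons (map G xs))) ∘
      msub D (map (fun x => [:: x]) (map G xs)) ->
  exists c' : hom (T xs) y, fmap G c' ∘ ctheta xs = c.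
Proof.
move=> hi hii; pose v := E (map F (map G xs)).
(* By normality, substitution for a single block is [fmap U (eps v)] up to casts, so [hi] says that
   [c] is a map of algebras; hence [iota y ∘ c] lifts to a map [k] of [V]. *)
have ci : c ∘ fmap U (eps v) = alpha y ∘ fmap U (fmap F c).
  apply: heq_eq.
  have hl : heq (c ∘ lfmap D (lcast (flatten1 (map G xs))) ∘ msub D [:: map G xs])
      (c ∘ fmap U (eps v)).
    apply: heq_comp; first exact: heq_lcastr.
    apply: (@heq_fmap _ _ U _ _ _ _ (UEF_sub_E adj E [:: map G xs]) (eps v)).
    rewrite /UEF_sub_E -comp_assoc.
    apply: heq_trans (heq_lcastl _ _) _.
    apply: heq_trans (heq_compl_id _ (normal_msub1 nE _)) _.
    exact: normal_map_heq.
  apply: heq_trans (heq_sym hl) _; rewrite hi /alpha -comp_assoc.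
  apply: heq_comp; first exact: heq_refl.
  rewrite -fmap_comp.
  apply: (@heq_fmap _ _ U _ _ _ _ (@lfmap _ _ E [:: _] [:: _] (fmap F c, tt))).
  apply: heq_trans (normal_map_heq nE (fmap F c)) (heq_sym _).
  apply: heq_compl_id; exact: normal_unit_heq.
have [|k hk] := @monadic_full _ _ _ _ adj hmon v (L y) (iota y ∘ c).
  by rewrite -comp_assoc ci comp_assoc iota_act -comp_assoc (fmap_comp F) (fmap_comp U).
have [g hg] : exists g : hom (E (map L xs)) (L y), g ∘ lfmap E (lnu xs) = k.
  have [_ _ fact _] := lnu_coeq xs; apply: fact.
  (* The condition [hii] is reflected to [V] by faithfulness of [U]; it will say that [k]
     coequalizes the pair presenting the arguments. *)
  have kii : k ∘ lfmap E (lmap F (lacts xs)) =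
      k ∘ lfmap E (lmap F (lcast (flatten_singletons (map G xs)))) ∘
        UEF_sub_E adj E (map (fun x => [:: x]) (map G xs)).
    have : msub D (map (fun x => [:: x]) (map G xs)) =
      fmap U (UEF_sub_E adj E (map (fun x => [:: x]) (map G xs))) by [].
    move: (UEF_sub_E _ _ _) => sF eD; rewrite eD in hii.
    apply: (monadic_faithful hmon); rewrite !fmap_comp hk -!comp_assoc.
    congr (_ ∘ _); apply: etrans hii _; exact/esym/comp_assoc.
  (* The units contained in [lalpha] pass through the counits and cancel the substitution by the
     right unit law of [E]; what remains is [leps]. *)
  rewrite lalphaE lfmap_comp comp_assoc kii /UEF_sub_E.
  have h1 : heq (lfmap E (lcounits adj E (map (fun w => [:: w]) (map G xs))) ∘
      lfmap E (lUunits xs)) (lfmap E (lunits (mt_unit E) (map F (map G xs))) ∘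
      lfmap E (leps xs)).
    by have := lheq_lfmap E (lcounits_Uunits xs); rewrite !lfmap_comp; apply.
  have h2 : heq (msub E (map (map F) (map (fun w => [:: w]) (map G xs))))
      (msub E (map (fun w => [:: w]) (map F (map G xs)))).
    by apply: heq_msub; rewrite -!map_comp.
  have h3 := heq_comp h2 h1.
  have h4 : msub E (map (fun w => [:: w]) (map F (map G xs))) ∘
      lfmap E (lunits (mt_unit E) (map F (map G xs))) =
      lfmap E (lcast (esym (flatten_singletons (map F (map G xs))))).
    exact: mt_unitr.
  have h5 := heq_trans h3 (eq_heq (comp_assoc _ _ _)).
  rewrite h4 in h5; have h6 := heq_trans h5 (heq_lcastl _ _).
  have p := f_equal (map F) (flatten_singletons (map G xs)).
  apply: heq_eq; rewrite (lmap_cast _ p).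
  have a1 (x1 x2 x3 x4 x5 x6 x7 : V) (a : hom x2 x1) (b : hom x3 x2)
      (d : hom x4 x3) (e : hom x5 x4) (f : hom x6 x5) (g' : hom x7 x6) :
      a ∘ b ∘ (d ∘ e ∘ f) ∘ g' = a ∘ b ∘ d ∘ (e ∘ (f ∘ g')).
    by rewrite !comp_assoc.
  rewrite a1; apply: heq_comp; last exact: h6.
  apply: heq_trans (heq_lcastr _ _) _; exact: heq_lcastr.
exists (eq_hom (KL y) ∘ fmap K g).
have e : fmap U g ∘ fmap U (lfmap E (lnu xs)) = iota y ∘ c.
  by rewrite -fmap_comp hg.
have -> : fmap G (eq_hom (KL y) ∘ fmap K g) ∘ ctheta xs =
    fmap G (eq_hom (KL y)) ∘ (kappa (L y) ∘ (iota y ∘ c)).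
  rewrite -e (comp_assoc (kappa _)) -kappa_nat fmap_comp -!comp_assoc.
  by [].
apply: heq_eq; apply: heq_trans (heq_compl_id _ (heq_fmap_id G (heq_eq_hom (KL y) erefl))) _.
apply: heq_trans (heq_idl _ _) _; exact: heq_idl.
Qed.

Theorem transport_ecat_iso : exists Phi : CatIso (ECat T) (ECat D),
  ecat_algebras D ⊚ Phi = ecat_graph T.
Proof.
exact: (@lift_iso W D T ctheta ctheta_nat ctheta_sub ctheta_act ctheta_fact
  ctheta_epi ctheta_epi2).
Qed.

End Concrete.

(** * Cocontinuity of left adjoints, and closure properties of the transport *)

Lemma left_adjoint_cocontinuous (C D : Category) (F : Functor D C)
    (U : Functor C D) : Adjunction F U -> preserves_colimits F.
Proof.
move=> adj J H c hc c'.
have tr x y (f : hom (F x) y) :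
    adj_counit adj y ∘ fmap F (fmap U f ∘ adj_unit adj x) = f.
  rewrite fmap_comp comp_assoc [_ ∘ fmap F (fmap U f)](nt_nat (adj_counit adj) f).
  by rewrite -comp_assoc adj_triangleF comp_idr.
have tr' x y (f : hom x (U y)) :
    fmap U (adj_counit adj y ∘ fmap F f) ∘ adj_unit adj x = f.
  rewrite fmap_comp -comp_assoc.
  rewrite -[fmap U (fmap F f) ∘ _](nt_nat (adj_unit adj) f).
  by rewrite comp_assoc adj_triangleU comp_idl.
have l (i j : J) (f : hom i j) :
    fmap U (leg c' j) ∘ adj_unit adj (H j) ∘ fmap H f =
    fmap U (leg c' i) ∘ adj_unit adj (H i).
  rewrite -comp_assoc [adj_unit adj _ ∘ _](nt_nat (adj_unit adj) (fmap H f)).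
  rewrite comp_assoc -(leg_nat c' f) fmap_comp; exact: erefl.
have [h [hh u]] := hc (MkCocone l).
exists (adj_counit adj _ ∘ fmap F h); split.
  by move=> j /=; rewrite -comp_assoc -fmap_comp hh tr.
move=> g hg; rewrite (u (fmap U g ∘ adj_unit adj _)) ?tr // => j /=.
rewrite -comp_assoc [adj_unit adj _ ∘ _](nt_nat (adj_unit adj) (leg c j)).
by rewrite comp_assoc -[in RHS]hg [in RHS]fmap_comp.
Qed.

Lemma preserves_colimit_comp (J A B C : Category) (G : Functor B C)
    (F : Functor A B) (H : Functor J A) :
  preserves_colimit F H -> preserves_colimit G (F ⊚ H) ->
  preserves_colimit (G ⊚ F) H.
Proof.
move=> hF hG c /hF /hG hc c'.
(* The two bracketings of the composite functor are not convertible, so the cocone is repackaged. *)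
exact: (hc (@MkCocone _ _ (G ⊚ (F ⊚ H)) (apex c') (leg c') (leg_nat c'))).
Qed.

Definition iso_opposite (C D : Category) (K : CatIso C D) : CatIso D C :=
  @MkCatIso D C (inverse (iso_inv K))
    (Invertible (Kinverse (iso_inv K)) (inverseK (iso_inv K))).

Lemma iso_cocontinuous (C D : Category) (K : CatIso C D) : preserves_colimits K.
Proof. exact: (left_adjoint_cocontinuous (iso_adjunction (iso_opposite K))). Qed.

Lemma iso_inverse_cocontinuous (C D : Category) (K : CatIso C D) :
  preserves_colimits (inverse (iso_inv K)).
Proof. exact: (left_adjoint_cocontinuous (iso_adjunction K)). Qed.

Lemma lmap_slot (C D : Category) (L : Functor C D) (l r : seq C) (x y : C)
    (f : hom x y) :
  lheq (lmap L (fmap (slot l r) f))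
       (fmap (slot (map L l) (map L r)) (fmap L f)).
Proof.
elim: l => [|a l IH] /=; last by rewrite fmap_id; apply: lheq_cons => //; apply: heq_refl.
by rewrite lmap_id; apply: lheq_refl.
Qed.

(** Normality is an equality of dependent pairs; generalizing the functor allows it to be replaced
    by the identity before the units are compared. *)
Lemma normal_intro (V : Category) (N : Multitensor V) :
  N ⊚ singleton V = functor_id V ->
  (forall x, heq (mt_unit N x) (idm x)) -> mt_normal N.
Proof.
rewrite /mt_normal; move: (mt_unit N); move: (N ⊚ singleton V) => S u e.
by subst S => h; congr existT; apply: nt_ext => x; apply: heq_eq.
Qed.

Section Transport.
Variables (C D : Category) (K : CatIso C D) (E : Multitensor C).
Let L := inverse (iso_inv K).

Lemma transport_slot l r :
  transport K E ⊚ slot l r = K ⊚ (E ⊚ slot (map L l) (map L r) ⊚ L).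
Proof.
apply: functor_eq => [x|x y f] /=; first by rewrite map_cat.
do 2!apply: heq_fmap; exact: lmap_slot.
Qed.

Lemma transport_distributive : mt_closed E -> mt_distributive (transport K E).
Proof.
move=> hE l r I H; rewrite transport_slot.
apply: preserves_colimit_comp; last exact: iso_cocontinuous.
apply: preserves_colimit_comp; last exact: hE.
exact: iso_inverse_cocontinuous.
Qed.

Lemma transport_normal : mt_normal E -> mt_normal (transport K E).
Proof.
move=> nE; apply: normal_intro.
  apply: functor_eq => [x|x y f] /=.
    have e := f_equal (fun H : Functor C C => H (L x)) (normal_functor nE).
    rewrite /= in e; rewrite e; exact: invertible_inv_ob.
  apply: heq_trans (invertible_inv_map (iso_inv K) f); apply: heq_fmap.
  exact: (normal_map_heq nE (fmap L f)).
move=> x; apply: heq_trans (heq_idr _ _) _.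
apply: heq_trans (heq_fmap_id K (normal_unit_heq nE _)) _.
by apply: heq_id; apply: invertible_inv_ob.
Qed.

End Transport.

Lemma cocontinuous_initial (C D : Category) (G : Functor C D) (x : C) :
  preserves_colimits G -> initial x -> initial (G x).
Proof. by move=> hG; apply: preserves_initial => I H; apply: hG. Qed.

Lemma cocomplete_initial (C : Category) : cocomplete C -> exists x : C, initial x.
Proof.
move=> hC; have [c hc] := hC (discrete Empty_set) (empty_functor C).
by exists (apex c); apply: (initial_colimit _ c).2 hc; case.
Qed.

(** The lifted multitensor is determined only up to isomorphism, so the result is stated for every
    [D'] with the defining property; existence keeps this from being vacuous. *)
Theorem theorem6p6 (V W : Category) (hW : locally_presentable W)
    (U : Functor V W) (F : Functor W V) (adj : Adjunction F U)
    (hmon : monadic adj) (hacc : accessible U) (hcop : preserves_coproducts U)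
    (E : Multitensor V) (hclosed : mt_closed E) (hnormal : mt_normal E) :
  (exists D' : Multitensor (EM (mt_monad (UEF adj E))),
     is_lifted (UEF adj E) D') /\
  (forall D' : Multitensor (EM (mt_monad (UEF adj E))),
     is_lifted (UEF adj E) D' ->
     multitensor_iso D' (transport (comparison_iso hmon hnormal) E)).
Proof.
set K := comparison_iso hmon hnormal.
have [k1 k2 k3] := comparison_iso_heq hmon (UEF_monad adj hnormal).
have hT : is_lifted (UEF adj E) (transport K E).
  split; [exact: transport_normal | exact: transport_distributive |].
  exact: (transport_ecat_iso hmon hclosed hnormal k1 k2 k3).
split; first by exists (transport K E).
move=> D' [_ hD' [Phi' e']]; case: hT => _ hT [Phi e].
have [w hw] := cocomplete_initial hW.1.
(* The initial object of [W] comes from cocompleteness; [F] and [K] preserve it, being left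
   adjoints. *)
have h0 : initial (K (F w)).
  apply: (@cocontinuous_initial _ _ K (F w)); first exact: iso_cocontinuous.
  apply: (@cocontinuous_initial _ _ F w) => //.
  exact: left_adjoint_cocontinuous adj.
apply: (multitensor_iso_of_ecat h0 hD' hT).
have assoc (C1 C2 C3 C4 : Category) (H3 : Functor C3 C4) (H2 : Functor C2 C3)
    (H1 : Functor C1 C2) : H3 ⊚ H2 ⊚ H1 = H3 ⊚ (H2 ⊚ H1) by exact: functor_ext.
have idl (C1 C2 : Category) (H : Functor C1 C2) : functor_id C2 ⊚ H = H.
  by case: H => ? ? ? ?; apply: functor_ext.
have idr (C1 C2 : Category) (H : Functor C1 C2) : H ⊚ functor_id C1 = H.
  by case: H => ? ? ? ?; apply: functor_ext.
case: Phi Phi' e e' => [Phi [Psi h1 h2]] [Phi' [Psi' h1' h2']] /= e e'.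
(* [Psi ⊚ Phi'] goes from [D']-categories to [T]-categories by way of [D]-categories; it commutes
   with the functors to graphs of algebras because [Phi] and [Phi'] do. *)
have i1 : (Psi' ⊚ Phi) ⊚ (Psi ⊚ Phi') = functor_id _.
  by rewrite assoc -(assoc _ _ _ _ Phi) h2 idl h1'.
have i2 : (Psi ⊚ Phi') ⊚ (Psi' ⊚ Phi) = functor_id _.
  by rewrite assoc -(assoc _ _ _ _ Phi') h2' idl h1.
exists (MkCatIso (Invertible i1 i2)) => /=.
by rewrite -e -assoc (assoc _ _ _ _ _ Phi) h2 idr.
Qed.
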